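(* Let $T=\mathbb C/\Lambda$ be a complex torus, let $N\ge1$, and let $\rho:C_N\to\mathrm{Aut}(\mathfrak{sl}_2)$ and $\sigma:C_N\to t(T)$ be injective homomorphisms, where $t(T)$ is the group of translations of $T$. Let $\mathbb T=T\setminus\sigma(C_N)\cdot\{0\}$. Then $$(\mathfrak{sl}_2\otimes_{\mathbb C}\mathcal O_{\mathbb T})^{\rho\otimes\tilde\sigma(C_N)}\cong\mathfrak{sl}_2\otimes_{\mathbb C}\mathcal O_{\mathbb T}^{\tilde\sigma(C_N)}.$$ Moreover, there are a lattice $\Lambda'$ and elements $E,F,H$ of $(\mathfrak{sl}_2\otimes_{\mathbb C}\mathcal O_{\mathbb T})^{\rho\otimes\tilde\sigma(C_N)}$ such that $$(\mathfrak{sl}_2\otimes_{\mathbb C}\mathcal O_{\mathbb T})^{\rho\otimes\tilde\sigma(C_N)}=\mathbb C\langle E,F,H\rangle\otimes_{\mathbb C}\mathbb C[\wp_{\Lambda'},\wp_{\Lambda'}'],$$ with $\mathbb C[\wp_{\Lambda'},\wp_{\Lambda'}']$-linear brackets $[H,E]=2E$, $[H,F]=-2F$ and $[E,F]=H$.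
   Context: $\mathfrak{sl}_2=\mathfrak{sl}_2(\mathbb C)$ and $C_N$ is the cyclic group of order $N$. $\mathcal O_{\mathbb T}$ is the $\mathbb C$-algebra of meromorphic functions on $T$ that are holomorphic on $\mathbb T$, and $\tilde\sigma(\gamma)f=f\circ\sigma(\gamma)^{-1}$. The current algebra $\mathfrak{sl}_2\otimes_{\mathbb C}\mathcal O_{\mathbb T}$ has bracket $[A\otimes f,B\otimes g]=[A,B]\otimes fg$, and $C_N$ acts on it by $\gamma\cdot(A\otimes f)=\rho(\gamma)A\otimes\tilde\sigma(\gamma)f$. A superscript $\rho\otimes\tilde\sigma(C_N)$ (respectively $\tilde\sigma(C_N)$) denotes the subspace of invariants. For a lattice $\Lambda'$, $\wp_{\Lambda'}(z)=z^{-2}+\sum_{0\neq\omega\in\Lambda'}\big((z-\omega)^{-2}-\omega^{-2}\big)$ is the Weierstrass function and $\wp_{\Lambda'}'$ is its derivative. *)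

(* Defs.v *)
From HB Require Import structures.
From mathcomp Require Import all_boot all_order all_algebra.
From mathcomp Require Import complex.
From mathcomp Require Import all_classical all_reals all_analysis.
Set Implicit Arguments. Unset Strict Implicit. Unset Printing Implicit Defensive.
Import Order.TTheory GRing.Theory Num.Theory.
Import numFieldTopology.Exports numFieldNormedType.Exports.

HB.instance Definition _ (R : realType) := PseudoPointedMetric.copy R[i] (R[i])^o.
HB.instance Definition _ (R : realType) := NormedModule.copy R[i] (R[i])^o.

Local Open Scope ring_scope.
Local Open Scope complex_scope.
Local Open Scope classical_set_scope.

Notation CC R := (@complex.complex (reals.Real.sort R)).

Section Defs.
Variable R : realType.
Local Notation C := (R[i]).

Definition is_lattice (w1 w2 : C) : Prop := w1 != 0 /\ 'Im (w2 / w1) != 0.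

Definition in_lattice (w1 w2 : C) (z : C) : Prop :=
  exists m n : int, z = m%:~R * w1 + n%:~R * w2.

(* sigma : C_N -> t(T) injective hom, given by the image t (mod Lambda) of
   a generator: translation by t has order exactly N in T = C/Lambda. *)
Definition translation_of_order (w1 w2 : C) (N : nat) (t : C) : Prop :=
  in_lattice w1 w2 (N%:R * t) /\
  forall k : nat, (0 < k < N)%N -> ~ in_lattice w1 w2 (k%:R * t).

(* lifts to C of the removed points sigma(C_N).{0} = { k t mod Lambda } *)
Definition in_S (w1 w2 t : C) (z : C) : Prop :=
  exists k : nat, in_lattice w1 w2 (z - k%:R * t).

Definition holo_at (f : C -> C) (z : C) : Prop :=
  exists l : C, (fun h : C => (f (z + h) - f z) / h) @ (0 : C)^' --> l.

Definition mero_at (f : C -> C) (p : C) : Prop :=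
  exists (k : nat) (g : C -> C),
    (\forall w \near p, holo_at g w) /\
    (\forall w \near p^', f w = g w / (w - p) ^+ k).

(* O_TT: meromorphic functions on T (lifted to Lambda-periodic functions on C)
   that are holomorphic on TT = T \ sigma(C_N).{0}.  Values at the removed
   points are irrelevant (see eqTT). *)
Definition O_TT (w1 w2 t : C) (f : C -> C) : Prop :=
  (forall z, ~ in_S w1 w2 t z -> f (z + w1) = f z /\ f (z + w2) = f z) /\
  (forall z, ~ in_S w1 w2 t z -> holo_at f z) /\
  (forall z, in_S w1 w2 t z -> mero_at f z).

Definition eqTT (w1 w2 t : C) {V : Type} (f g : C -> V) : Prop :=
  forall z, ~ in_S w1 w2 t z -> f z = g z.

Definition in_sl2 (A : 'M[C]_2) : Prop := \tr A = 0.

Definition lie_br (A B : 'M[C]_2) : 'M[C]_2 := A *m B - B *m A.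

(* Lie algebra automorphisms of sl_2 (maps defined on all matrices,
   only their behaviour on sl_2 matters) *)
Definition is_sl2_aut (r : 'M[C]_2 -> 'M[C]_2) : Prop :=
  (forall A, in_sl2 A -> in_sl2 (r A)) /\
  (forall (a : C) A B, in_sl2 A -> in_sl2 B -> r (a *: A + B) = a *: r A + r B) /\
  (forall A B, in_sl2 A -> in_sl2 B -> r (lie_br A B) = lie_br (r A) (r B)) /\
  (forall A B, in_sl2 A -> in_sl2 B -> r A = r B -> A = B) /\
  (forall B, in_sl2 B -> exists A, in_sl2 A /\ r A = B).

(* rho : C_N -> Aut(sl_2) injective hom, given by the image r of a generator:
   an automorphism of order exactly N. *)
Definition aut_of_order (N : nat) (r : 'M[C]_2 -> 'M[C]_2) : Prop :=
  is_sl2_aut r /\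
  (forall A, in_sl2 A -> iter N r A = A) /\
  (forall k : nat, (0 < k < N)%N -> exists A, in_sl2 A /\ iter k r A != A).

(* sl_2 (x) O_TT, realised as sl_2-valued functions with coefficients in O_TT *)
Definition in_current (w1 w2 t : C) (X : C -> 'M[C]_2) : Prop :=
  (forall i j, O_TT w1 w2 t (fun z => X z i j)) /\
  (forall z, ~ in_S w1 w2 t z -> in_sl2 (X z)).

Definition cur_br (X Y : C -> 'M[C]_2) : C -> 'M[C]_2 := fun z => lie_br (X z) (Y z).
Definition cur_add (X Y : C -> 'M[C]_2) : C -> 'M[C]_2 := fun z => X z + Y z.
Definition cur_scale (a : C) (X : C -> 'M[C]_2) : C -> 'M[C]_2 := fun z => a *: X z.
Definition cur_fmul (f : C -> C) (X : C -> 'M[C]_2) : C -> 'M[C]_2 := fun z => f z *: X z.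

(* invariants under rho (x) sigma~ : gamma^k . X = rho^k o X o sigma(gamma^k)^{-1},
   sigma(gamma^k)^{-1} being translation by -k t *)
Definition rs_invariant (w1 w2 t : C) (N : nat) (r : 'M[C]_2 -> 'M[C]_2)
    (X : C -> 'M[C]_2) : Prop :=
  in_current w1 w2 t X /\
  forall k : nat, (k < N)%N -> forall z, ~ in_S w1 w2 t z ->
    iter k r (X (z - k%:R * t)) = X z.

Definition s_invariant_fun (w1 w2 t : C) (N : nat) (f : C -> C) : Prop :=
  O_TT w1 w2 t f /\
  forall k : nat, (k < N)%N -> forall z, ~ in_S w1 w2 t z -> f (z - k%:R * t) = f z.

Definition in_current_sinv (w1 w2 t : C) (N : nat) (X : C -> 'M[C]_2) : Prop :=
  (forall i j, s_invariant_fun w1 w2 t N (fun z => X z i j)) /\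
  (forall z, ~ in_S w1 w2 t z -> in_sl2 (X z)).

(* Weierstrass p-function of the lattice Z v1 + Z v2: limit of the
   (absolutely convergent) series summed over the squares |m|,|n| <= K. *)
Definition wp_partial (v1 v2 z : C) (K : nat) : C :=
  z ^- 2 +
  \sum_(i < (K + K).+1) \sum_(j < (K + K).+1)
     (if (i == K :> nat) && (j == K :> nat) then 0 else
      let om := ((i%:Z - K%:Z)%R)%:~R * v1 + ((j%:Z - K%:Z)%R)%:~R * v2 in
      (z - om) ^- 2 - om ^- 2).

Definition wp (v1 v2 : C) (z : C) : C := lim (wp_partial v1 v2 z @ \oo).

Definition wp' (v1 v2 : C) (z : C) : C :=
  lim ((fun h : C => (wp v1 v2 (z + h) - wp v1 v2 z) / h) @ (0 : C)^').

Definition in_wp_ring (w1 w2 t v1 v2 : C) (f : C -> C) : Prop :=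
  exists P : {poly {poly C}},
    eqTT w1 w2 t f (fun z => (P.[(wp v1 v2 z)%:P]).[wp' v1 v2 z]).

End Defs.

(* Main.v *)
Require Import Defs.
From HB Require Import structures.
From mathcomp Require Import all_boot all_order all_algebra all_field.
From mathcomp Require Import complex.
From mathcomp Require Import all_classical all_reals all_analysis.
From mathcomp Require Import ring lra zify.
Import Order.TTheory GRing.Theory Num.Theory.
Import numFieldTopology.Exports numFieldNormedType.Exports.
Set Implicit Arguments. Unset Strict Implicit. Unset Printing Implicit Defensive.
Local Open Scope ring_scope.
Local Open Scope complex_scope.

(* Let Lambda' = Lambda + Z t; the removed points lift to Lambda'. The
   automorphism [r] is conjugation by a matrix whose eigenvalues have ratio a
   primitive N-th root of unity eps. In an eigenbasis, the diagonal entry of an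
   invariant current is Lambda'-periodic, and its off-diagonal entries are
   multiplied under Lambda' by the character chi with chi(Lambda) = 1 and
   chi(t) = eps, and by its inverse. Let psi be a character with psi^2 = chi
   that is nontrivial on both basis vectors of Lambda'. There is a determinant
   one matrix G whose rows are meromorphic sections of psi and psi^-1 with poles
   on Lambda' only; conjugation by G trivialises chi and so identifies invariant
   currents with sl2-valued Lambda'-elliptic functions, whose entries lie in
   C[wp, wp']. The currents E, F, H are the images of the standard basis.
   The rows of G are (s, s') and (a multiple of) (t, t' - c t), where s and t
   are sections of psi and psi^-1 with one simple pole: for a suitable c the
   Wronskian s t' - s' t - c s t has at most a simple pole, so it is constant
   by the residue and Liouville theorems. If it vanished, s and t would have the
   same zeros, and t / s would extend to an entire function with unitary
   multipliers, which is bounded and so constant, forcing psi^2 = 1. (For N = 1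
   take G = 1.) *)

(** * The real-valued modulus, limits and completeness of the complex numbers *)

Section Modulus.
Variable R : realType.
Local Notation C := (R[i]).
Implicit Types (x y z w : C) (e : R).

(** The determinant of G must have no zero outside Lambda': there the inverse of G would have a
    pole, and conjugation would leave the functions with poles on Lambda' only. An arbitrary pair of
    sections of psi and psi^-1 gives no control over these zeros; a Wronskian does, because its pole
    can be lowered until it is constant. The products s t' and s' t have triple poles with equal
    leading coefficients, and c removes the double pole that remains. Conjugation by diag(psi,
    psi^-1) multiplies off-diagonal entries by psi^2 and psi^-2, hence the square root of chi. When
    the root chosen at a basis vector is 1, it is replaced by -1, so that psi(v_i) - 1 can be
    inverted; this is what turns a Weierstrass zeta series twisted by psi, which is quasi-periodic
    only up to affine functions, into a true section with one simple pole. The values of psi are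
    roots of unity, so the modulus of a section is periodic and Liouville's theorem applies although
    the section is not periodic. For N = 1 the character chi is trivial, psi^2 = 1, and the argument
    against a vanishing Wronskian breaks down. *)

Definition cabs z : R := complex.Re `|z|.

(** The norm has values in [C] itself; passing to [cabs] moves all estimates to the real field,
    where [lra] and [nra] apply. *)
Lemma normE z : `|z| = (cabs z)%:C.
Proof. by rewrite /cabs normc_def. Qed.

Lemma cabsE z : cabs z = Num.sqrt ((complex.Re z) ^+ 2 + (complex.Im z) ^+ 2).
Proof. by rewrite /cabs normc_def. Qed.

Lemma cabs_ge0 z : 0 <= cabs z.
Proof. by rewrite cabsE sqrtr_ge0. Qed.

Lemma cabsM x y : cabs (x * y) = cabs x * cabs y.
Proof. by apply: (@complexI R); rewrite rmorphM /= -!normE normrM. Qed.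

Lemma cabsD x y : cabs (x + y) <= cabs x + cabs y.
Proof. by rewrite -lecR rmorphD /= -!normE ler_normD. Qed.

Lemma cabsN x : cabs (- x) = cabs x.
Proof. by rewrite /cabs normrN. Qed.

Lemma cabsC x y : cabs (x - y) = cabs (y - x).
Proof. by rewrite /cabs distrC. Qed.

Lemma cabs0 : cabs 0 = 0.
Proof. by rewrite /cabs normr0. Qed.

Lemma cabs1 : cabs 1 = 1.
Proof. by rewrite /cabs normr1. Qed.

Lemma cabsB x y : cabs (x - y) <= cabs x + cabs y.
Proof. by rewrite -(cabsN y) cabsD. Qed.

Lemma cabs_tri z x y : cabs (x - y) <= cabs (x - z) + cabs (z - y).
Proof. by rewrite (_ : x - y = (x - z) + (z - y)) ?cabsD //; ring. Qed.

Lemma cabs_subl x y : cabs x - cabs y <= cabs (x - y).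
Proof. by have := cabsD (x - y) y; rewrite subrK; lra. Qed.

Lemma cabs_eq0 x : (cabs x == 0) = (x == 0).
Proof. by rewrite -(normr_eq0 x) normE -(inj_eq (@complexI R)). Qed.

Lemma cabs_gt0 x : (0 < cabs x) = (x != 0).
Proof. by rewrite lt_neqAle cabs_ge0 andbT eq_sym cabs_eq0. Qed.

Lemma cabsV x : cabs x^-1 = (cabs x)^-1.
Proof. by apply: (@complexI R); rewrite -normE normfV normE fmorphV. Qed.

Lemma cabsX x n : cabs (x ^+ n) = cabs x ^+ n.
Proof. by apply: (@complexI R); rewrite -normE normrX normE rmorphXn. Qed.

Lemma cabsR (a : R) : cabs a%:C = `|a|.
Proof. by rewrite cabsE /= expr0n addr0 sqrtr_sqr. Qed.

Lemma Re_le_cabs x : `|complex.Re x| <= cabs x.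
Proof. by rewrite -lecR -normE normc_ge_Re. Qed.

Lemma Im_le_cabs x : `|complex.Im x| <= cabs x.
Proof. by rewrite cabsE -sqrtr_sqr ler_wsqrtr // lerDr sqr_ge0. Qed.

Lemma ReD x y : complex.Re (x + y) = complex.Re x + complex.Re y.
Proof. by case: x; case: y. Qed.
Lemma ImD x y : complex.Im (x + y) = complex.Im x + complex.Im y.
Proof. by case: x; case: y. Qed.
Lemma ReB x y : complex.Re (x - y) = complex.Re x - complex.Re y.
Proof. by case: x; case: y. Qed.
Lemma ImB x y : complex.Im (x - y) = complex.Im x - complex.Im y.
Proof. by case: x; case: y. Qed.

Lemma cabs_le x : cabs x <= `|complex.Re x| + `|complex.Im x|.
Proof.
rewrite {1}(complexE x); apply: le_trans (cabsD _ _) _.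
by rewrite cabsM !cabsR /= (_ : cabs 'i = 1) ?mul1r // cabsE /= expr0n add0r expr1n sqrtr1.
Qed.

Lemma cabs_natr (n : nat) : cabs n%:R = n%:R.
Proof. by rewrite /cabs normr_nat -(rmorph_nat (real_complex R)). Qed.

Lemma cabs_small x : (forall e, 0 < e -> cabs x <= e) -> x = 0.
Proof.
move=> h; apply/eqP; rewrite -cabs_eq0 eq_le cabs_ge0 andbT.
by apply/ler_addgt0Pr => e e0; rewrite add0r; apply: h.
Qed.

Definition ctends (u : nat -> C) (l : C) : Prop :=
  forall e, 0 < e -> exists n0, forall n, (n0 <= n)%N -> cabs (u n - l) <= e.

Lemma ctends_unique u l l' : ctends u l -> ctends u l' -> l = l'.
Proof.
move=> h h'; apply/eqP; rewrite -subr_eq0; apply/eqP/cabs_small => e e0.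
have [n0 H] := h _ (divr_gt0 e0 (ltr0n _ 2)); have [n1 H'] := h' _ (divr_gt0 e0 (ltr0n _ 2)).
have := H (maxn n0 n1) (leq_maxl _ _); have := H' (maxn n0 n1) (leq_maxr _ _).
by have := cabs_tri (u (maxn n0 n1)) l l'; rewrite (cabsC l (u _)); lra.
Qed.

(** Comparison with the single term [u n0] is equivalent to the usual condition by the triangle
    inequality and is easier to establish. *)
Definition rcauchy (V : Type) (d : V -> V -> R) (u : nat -> V) : Prop :=
  forall e, 0 < e -> exists n0, forall n, (n0 <= n)%N -> d (u n) (u n0) <= e.

Lemma real_complete (u : nat -> R) :
  rcauchy (fun x y : R => `|x - y|) u ->
  exists l, forall e, 0 < e -> exists n0, forall n, (n0 <= n)%N -> `|u n - l| <= e.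
Proof.
move=> h; have /cauchy_cvgP : cauchy (u @ \oo)%classic.
  apply: cauchy_exP => e e0.
  have [|n0 H] := h (e / 2); first by rewrite divr_gt0.
  exists (u n0); exists n0 => // n /= /H; rewrite -ball_normE /= distrC => h1.
  by apply: le_lt_trans h1 _; lra.
move=> /cvg_ex[l /cvgrPdist_le hl]; exists l => e e0.
have [n0 _ H] := hl e e0.
by exists n0 => n hn; rewrite distrC; apply: H.
Qed.

Lemma complex_complete (u : nat -> C) :
  rcauchy (fun x y => cabs (x - y)) u -> exists l, ctends u l.
Proof.
move=> h.
have [|a ha] := @real_complete (fun n => complex.Re (u n)).
  move=> e /h[n0 H]; exists n0 => n /H; rewrite -ReB; exact/le_trans/Re_le_cabs.
have [|b hb] := @real_complete (fun n => complex.Im (u n)).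
  move=> e /h[n0 H]; exists n0 => n /H; rewrite -ImB; exact/le_trans/Im_le_cabs.
exists (a +i* b) => e e0.
have [n0 H] := ha _ (divr_gt0 e0 (ltr0n _ 2)); have [n1 H'] := hb _ (divr_gt0 e0 (ltr0n _ 2)).
exists (maxn n0 n1) => n; rewrite geq_max => /andP[/H h1 /H' h2].
by apply: le_trans (cabs_le _) _; rewrite ReB ImB /=; lra.
Qed.

Lemma pow2_small (M e : R) : 0 < e -> exists n : nat, M / 2 ^+ n < e.
Proof.
move=> e0; have [n hn] : exists n : nat, `|M| / e < n%:R.
  by exists (Num.truncn (`|M| / e)).+1; rewrite truncnS_gt.
exists n; rewrite ltr_pdivrMr ?exprn_gt0 //.
rewrite ltr_pdivrMr // in hn; apply: le_lt_trans (ler_norm M) (lt_le_trans hn _).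
by rewrite mulrC ler_pM2l // -natrX ler_nat ltnW // ltn_expl.
Qed.

(** The explicit rate is what the bisection arguments of [fine_exists] and [goursat] use to locate
    their limit points. *)
Lemma geo_real (a : nat -> R) (M : R) :
  (forall n, `|a n.+1 - a n| <= M / 2 ^+ n) ->
  exists l, forall n, `|a n - l| <= 2 * M / 2 ^+ n.
Proof.
move=> h; have p2 n : 0 < (2 : R) ^+ n by rewrite exprn_gt0.
have M0 : 0 <= M by have := h 0%N; rewrite expr0 divr1; apply: le_trans.
(* Subtracting the tail makes the bound telescope, so that the induction closes. *)
have key n k : `|a (n + k)%N - a n| <= 2 * M / 2 ^+ n - 2 * M / 2 ^+ (n + k).
  elim: k => [|k IH]; first by rewrite addn0 !subrr normr0.
  have := h (n + k)%N; have := ler_distD (a (n + k)%N) (a (n + k.+1)%N) (a n).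
  have -> : 2 * M / 2 ^+ (n + k.+1) = M / 2 ^+ (n + k).
    by rewrite addnS exprS; field; rewrite lt0r_neq0.
  rewrite addnS.
  have e2 : 2 * M / 2 ^+ (n + k) = M / 2 ^+ (n + k) + M / 2 ^+ (n + k) by ring.
  by move: IH; rewrite e2; lra.
have key2 n m : (n <= m)%N -> `|a m - a n| <= 2 * M / 2 ^+ n.
  move=> /subnKC <-; apply: le_trans (key _ _) _.
  by rewrite gerBl divr_ge0 ?mulr_ge0 // ltW.
have [|l hl] := @real_complete a.
  move=> e /(pow2_small (2 * M))[n hn]; exists n => m /key2 hm.
  exact: le_trans hm (ltW hn).
exists l => n; apply/ler_addgt0Pr => e /hl[n0 H].
have := H _ (leq_maxr n n0); have := key2 _ _ (leq_maxl n n0).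
have := ler_distD (a (maxn n n0)) (a n) l.
by rewrite (distrC (a n) (a _)); lra.
Qed.

Lemma geo_lim_le (a : nat -> R) (M l b : R) :
  (forall n, `|a n - l| <= M / 2 ^+ n) -> (forall n, a n <= b) -> l <= b.
Proof.
move=> h1 h2; apply/ler_addgt0Pr => e /(pow2_small M)[n hn].
by have := h1 n; have := h2 n; rewrite ler_distl; lra.
Qed.

Lemma geo_lim_ge (a : nat -> R) (M l b : R) :
  (forall n, `|a n - l| <= M / 2 ^+ n) -> (forall n, b <= a n) -> b <= l.
Proof.
move=> h1 h2; apply/ler_addgt0Pr => e /(pow2_small M)[n hn].
by have := h1 n; have := h2 n; rewrite ler_distl; lra.
Qed.

End Modulus.

(** * Integrals along segments *)

Section PathIntegral.
Variable R : realType.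
Local Notation C := (R[i]).
Implicit Types (f g : R -> C) (n m : nat) (e : R).

(* Trapezoidal sums on the dyadic grid: reversal, bisection and affine
   functions are then treated exactly, before any passage to the limit. *)
Fixpoint trap n f : C :=
  if n is n'.+1 then (trap n' (fun s => f (s / 2)) + trap n' (fun s => f ((1 + s) / 2))) / 2
  else (f 0 + f 1) / 2.

Lemma trap_ext n f g : (forall s : R, 0 <= s <= 1 -> f s = g s) -> trap n f = trap n g.
Proof.
elim: n f g => [|n IH] f g h /=; first by rewrite !h ?lexx ?ler01.
by congr ((_ + _) / 2); apply: IH => s hs; apply: h; lra.
Qed.

Lemma trap_lin n c f g :
  trap n (fun s => c * f s + g s) = c * trap n f + trap n g.
Proof. by elim: n f g => [|n IH] f g /=; rewrite ?IH; ring. Qed.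

Lemma two_neq0 : (2 : C) != 0. Proof. by rewrite pnatr_eq0. Qed.

Lemma trap_const n c : trap n (fun=> c) = c.
Proof. by elim: n => [|n IH] /=; rewrite ?IH; field. Qed.

Lemma cabs2 : cabs (2 : C) = 2.
Proof. exact: cabs_natr. Qed.

Lemma trap_bound n f e :
  (forall s : R, 0 <= s <= 1 -> cabs (f s) <= e) -> cabs (trap n f) <= e.
Proof.
elim: n f => [|n IH] f h /=; rewrite cabsM cabsV cabs2 ler_pdivrMr // (mulrDr _ 1 1) mulr1;
  apply: le_trans (cabsD _ _) (lerD _ _).
- by apply: h; rewrite lexx ler01.
- by apply: h; rewrite lexx ler01.
- by apply: IH => s hs; apply: h; lra.
- by apply: IH => s hs; apply: h; lra.
Qed.

Lemma trap_rev n f : trap n (fun s => f (1 - s)) = trap n f.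
Proof.
elim: n f => [|n IH] f /=; first by rewrite subr0 subrr addrC.
rewrite addrC -(IH (fun s => f (s / 2))) -(IH (fun s => f ((1 + s) / 2))).
by congr ((_ + _) / 2); apply: trap_ext => s _; congr f; lra.
Qed.

Lemma trap_affine n a b : trap n (fun s => a + s%:C * b) = a + b / 2.
Proof.
elim: n a b => [|n IH] a b /=; first by field.
rewrite (@trap_ext n _ (fun s => a + s%:C * (b / 2))); last first.
  by move=> s _; rewrite rmorphM fmorphV rmorph_nat; ring.
rewrite (@trap_ext n (fun s => _ + ((1 + s) / 2)%:C * b) (fun s => (a + b / 2) + s%:C * (b / 2))); last first.
  by move=> s _; rewrite rmorphM rmorphD fmorphV rmorph1 rmorph_nat; ring.
by rewrite !IH; field.
Qed.

Lemma Im_half (z : C) : complex.Im (z / 2) = complex.Im z / 2.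
Proof.
rewrite -[in RHS](@divfK C 2 two_neq0 z) (mulrDr _ 1 1) mulr1 ImD; lra.
Qed.

(** The factor [X] has no prescribed sign, so one statement covers both orientations; it will be a
    cross product. *)
Lemma trap_Im_ge n f (X b : R) :
  (forall s : R, 0 <= s <= 1 -> b <= X * complex.Im (f s)) -> b <= X * complex.Im (trap n f).
Proof.
elim: n f => [|n IH] f h /=; rewrite Im_half ImD.
  have := h 0; have := h 1; rewrite !lexx ler01 => /(_ isT) h1 /(_ isT) h2; lra.
have h1 : b <= X * complex.Im (trap n (fun s => f (s / 2))) by apply: IH => s hs; apply: h; lra.
have h2 : b <= X * complex.Im (trap n (fun s => f ((1 + s) / 2))) by apply: IH => s hs; apply: h; lra.
lra.
Qed.

(** Oscillation at most [e] on each dyadic piece of level [n]. The recursion is that of [trap], so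
    that the two are compared by one induction. *)
Fixpoint fine n f e : Prop :=
  if n is n'.+1 then fine n' (fun s => f (s / 2)) e /\ fine n' (fun s => f ((1 + s) / 2)) e
  else forall s t : R, 0 <= s <= 1 -> 0 <= t <= 1 -> cabs (f s - f t) <= e.

Lemma fineS n f e : fine n f e -> fine n.+1 f e.
Proof.
elim: n f => [|n IH] f /=; last by move=> [/IH ? /IH ?].
by move=> h; split=> s t hs ht; apply: h; lra.
Qed.

Lemma fine_le n m f e : (n <= m)%N -> fine n f e -> fine m f e.
Proof. by move=> /subnK <-; elim: (m - n)%N => //= k IH /IH/fineS. Qed.

Lemma fine_trap n m f e : (n <= m)%N -> fine n f e -> cabs (trap m f - trap n f) <= e.
Proof.
elim: n m f => [|n IH] m f.
  move=> _ h; rewrite -(trap_const m (trap 0 f)) -mulN1r addrC -trap_lin.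
  apply: trap_bound => s hs /=.
  have -> : -1 * ((f 0 + f 1) / 2) + f s = ((f s - f 0) + (f s - f 1)) / 2.
    by field.
  rewrite cabsM cabsV cabs2 ler_pdivrMr // (mulrDr _ 1 1) mulr1.
  by apply: le_trans (cabsD _ _) (lerD _ _); apply: h; rewrite // lexx ler01.
case: m => // m /= hnm [/(IH _ _ hnm) h1 /(IH _ _ hnm) h2].
rewrite -mulrBl cabsM cabsV cabs2 ler_pdivrMr // (mulrDr _ 1 1) mulr1 opprD addrACA.
exact: le_trans (cabsD _ _) (lerD _ _).
Qed.

Definition pcont f := forall s : R, 0 <= s <= 1 -> forall e, 0 < e ->
  exists2 d : R, 0 < d & forall t : R, 0 <= t <= 1 -> `|t - s| < d -> cabs (f t - f s) <= e.

(** Uniform continuity by bisection: if no level works, one half always fails again, and the failing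
    pieces shrink to a point at which continuity is contradicted. *)
Lemma fine_exists f e : pcont f -> 0 < e -> exists n, fine n f e.
Proof.
move=> hf e0; apply: contrapT => hno.
pose sub (k : nat) (a : R) (s : R) : C := f (a + s / 2 ^+ k).
pose bad k a := ~ exists n, fine n (sub k a) e.
have halve k a : bad k a -> bad k.+1 a \/ bad k.+1 (a + 1 / 2 ^+ k.+1).
  move=> hb; apply: contrapT => /not_orP[/contrapT[n h1] /contrapT[n' h2]]; apply: hb.
  exists (maxn n n').+1; split.
    move: (fine_le (leq_maxl n n') h1); congr fine; apply/funext => s; congr f.
    by rewrite exprS; field; rewrite expf_neq0.
  move: (fine_le (leq_maxr n n') h2); congr fine; apply/funext => s; congr f.
  by rewrite exprS; field; rewrite expf_neq0.
pose step k a := if `[< bad k.+1 a >] then a else a + 1 / 2 ^+ k.+1.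
pose a := fix a k := if k is k'.+1 then step k' (a k') else 0 : R.
have p2 n : 0 < (2 : R) ^+ n by rewrite exprn_gt0.
have abad k : bad k (a k).
  elim: k => [|k IH] /=.
    move: hno; rewrite /= /bad; congr (~ ex _); apply/funext => n; congr fine.
    by apply/funext => s; rewrite /sub add0r expr0 divr1.
  by rewrite /step; case: asboolP => // h; case: (halve _ _ IH).
have astep k : a k <= a k.+1 <= a k + 1 / 2 ^+ k.+1.
  by rewrite /= /step; have h := ltW (divr_gt0 (@ltr01 R) (p2 k.+1)); case: ifP => _; lra.
have half k : 1 / 2 ^+ k = 2 * (1 / 2 ^+ k.+1) :> R.
  by rewrite exprS; field; rewrite expf_neq0.
have a01 k : 0 <= a k /\ a k + 1 / 2 ^+ k <= 1.
  elim: k => [|k [h1 h2]]; first by rewrite /= expr0; lra.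
  by have := astep k; have := half k; lra.
have [|x hx] := @geo_real R a 1.
  move=> k; have := astep k; have := half k; have := divr_gt0 (@ltr01 R) (p2 k.+1).
  by rewrite ler_norml; lra.
have x01 : 0 <= x <= 1.
  rewrite (geo_lim_ge hx) => [|n]; last by case: (a01 n).
  by rewrite (geo_lim_le hx) // => n; case: (a01 n); have := divr_gt0 (@ltr01 R) (p2 n); lra.
have [|d d0 hd] := hf x x01 (e / 2); first by rewrite divr_gt0.
(* 3 = 2 + 1: [a k] is within 2 / 2^k of [x], and the piece starting at [a k] has length 1 / 2^k. *)
have [k hk] := pow2_small 3 d0.
apply: (abad k); exists 0%N => s t hs ht.
have aux u : 0 <= u <= 1 -> cabs (sub k (a k) u - f x) <= e / 2.
  move=> hu; have h0 := divr_gt0 (@ltr01 R) (p2 k).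
  have h1 : 0 <= u / 2 ^+ k <= 1 / 2 ^+ k.
    by rewrite divr_ge0 ?(ltW (p2 k)) ?ler_pM2r ?invr_gt0 //; lra.
  apply: hd; first by have := a01 k; lra.
  have := hx k; have e3 : 3 / 2 ^+ k = 3 * (1 / 2 ^+ k) :> R by ring.
  have e2 : 2 * 1 / 2 ^+ k = 2 * (1 / 2 ^+ k) :> R by ring.
  by rewrite e2 ler_norml ltr_norml; lra.
have := aux _ hs; have := aux _ ht; have := cabs_tri (f x) (sub k (a k) s) (sub k (a k) t).
rewrite (cabsC (f x)); lra.
Qed.

Definition pint f : C := xget 0 [set l | ctends (fun n => trap n f) l].

Lemma pint_cvg f : pcont f -> ctends (fun n => trap n f) (pint f).
Proof.
move=> hf; have [|l hl] := @complex_complete R (fun n => trap n f).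
  move=> e e0; have [n hn] := fine_exists hf e0.
  by exists n => m /fine_trap; apply.
by rewrite /pint; case: xgetP => [l' -> //|/(_ l)].
Qed.

Lemma pint_unique f l : pcont f -> ctends (fun n => trap n f) l -> pint f = l.
Proof. by move=> /pint_cvg; apply: ctends_unique. Qed.

Lemma pint_ext f g : (forall s : R, 0 <= s <= 1 -> f s = g s) -> pint f = pint g.
Proof.
move=> h; rewrite /pint; congr xget; apply/funext => l /=.
by congr ctends; apply/funext => n; exact: trap_ext.
Qed.

Lemma pcont_ext f g : (forall s : R, 0 <= s <= 1 -> f s = g s) -> pcont f -> pcont g.
Proof.
move=> h hf s hs e e0; have [d d0 hd] := hf s hs e e0; exists d => // t ht.
by rewrite -!h //; apply: hd.
Qed.

Lemma pcont_lin c f g : pcont f -> pcont g -> pcont (fun s => c * f s + g s).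
Proof.
move=> hf hg s hs e e0.
have c0 : 0 < cabs c + 1 by have := cabs_ge0 c; lra.
have [d1 d10 h1] := hf s hs _ (divr_gt0 (divr_gt0 e0 (ltr0n _ 2)) c0).
have [d2 d20 h2] := hg s hs _ (divr_gt0 e0 (ltr0n _ 2)).
exists (Num.min d1 d2); rewrite ?lt_min ?d10 // => t ht; rewrite lt_min => /andP[/(h1 t ht) a1 /(h2 t ht) a2].
rewrite (_ : _ - _ = c * (f t - f s) + (g t - g s)); last by ring.
apply: le_trans (cabsD _ _) _; rewrite cabsM.
rewrite ler_pdivlMr // in a1; have := cabs_ge0 (f t - f s); nra.
Qed.

Lemma ctends_lin (u v : nat -> C) c a b : ctends u a -> ctends v b ->
  ctends (fun n => c * u n + v n) (c * a + b).
Proof.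
move=> hf hg e e0.
have c0 : 0 < cabs c + 1 by have := cabs_ge0 c; lra.
have [d1 h1] := hf _ (divr_gt0 (divr_gt0 e0 (ltr0n _ 2)) c0).
have [d2 h2] := hg _ (divr_gt0 e0 (ltr0n _ 2)).
exists (maxn d1 d2) => n; rewrite geq_max => /andP[/h1 a1 /h2 a2].
rewrite (_ : _ - _ = c * (u n - a) + (v n - b)); last by ring.
apply: le_trans (cabsD _ _) _; rewrite cabsM.
rewrite ler_pdivlMr // in a1; have := cabs_ge0 (u n - a); nra.
Qed.

Lemma pint_lin c f g : pcont f -> pcont g ->
  pint (fun s => c * f s + g s) = c * pint f + pint g.
Proof.
move=> hf hg; apply: pint_unique; first exact: pcont_lin.
move=> e e0; have [n h] := ctends_lin c (pint_cvg hf) (pint_cvg hg) e0.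
by exists n => m hm; rewrite trap_lin; apply: h.
Qed.

Lemma ctends_bound (u : nat -> C) l e : ctends u l -> (forall n, cabs (u n) <= e) -> cabs l <= e.
Proof.
move=> h1 h2; apply/ler_addgt0Pr => d /h1[n /(_ n (leqnn n)) h].
by have := h2 n; have := cabs_subl l (u n); rewrite (cabsC l); lra.
Qed.

Lemma pint_bound f e : pcont f ->
  (forall s : R, 0 <= s <= 1 -> cabs (f s) <= e) -> cabs (pint f) <= e.
Proof. by move=> /pint_cvg h hb; apply: ctends_bound h _ => n; apply: trap_bound. Qed.

Lemma pcont_rev f : pcont f -> pcont (fun s => f (1 - s)).
Proof.
move=> hf s hs e e0; have [|d d0 hd] := hf (1 - s) _ e e0; first by lra.
by exists d => // t ht; rewrite distrC => h; apply: hd; [lra|have <- : s - t = 1 - t - (1 - s) by ring].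
Qed.

Lemma pint_rev f : pcont f -> pint (fun s => f (1 - s)) = pint f.
Proof.
move=> hf; apply: pint_unique; first exact: pcont_rev.
by move=> e /(pint_cvg hf)[n h]; exists n => m hm; rewrite trap_rev; apply: h.
Qed.

Lemma pcont_half f (a : R) : (a = 0 \/ a = 1) -> pcont f -> pcont (fun s => f ((a + s) / 2)).
Proof.
move=> ha hf s hs e e0; have [|d d0 hd] := hf ((a + s) / 2) _ e e0.
  by case: ha => ->; lra.
exists d => // t ht h; apply: hd; first by case: ha => ->; lra.
have -> : (a + t) / 2 - (a + s) / 2 = (t - s) / 2 by lra.
rewrite normrM (@ger0_norm _ 2^-1) ?invr_ge0 //; have := normr_ge0 (t - s); lra.
Qed.

Lemma pint_half f : pcont f ->
  pint f = (pint (fun s => f (s / 2)) + pint (fun s => f ((1 + s) / 2))) / 2.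
Proof.
move=> hf; apply: pint_unique => //.
have hl : pcont (fun s => f (s / 2)).
  by apply: pcont_ext (pcont_half (or_introl erefl) hf) => s _ /=; rewrite add0r.
have hr := pcont_half (or_intror erefl) hf.
have h := ctends_lin (2^-1) (pint_cvg hl) (ctends_lin (2^-1) (pint_cvg hr) (pint_cvg hr)).
move=> e e0; have [n1 h1] := pint_cvg hl e0; have [n2 h2] := pint_cvg hr e0.
exists (maxn n1 n2).+1 => -[//|m]; rewrite ltnS geq_max => /andP[/h1 a1 /h2 a2] /=.
rewrite -mulrBl cabsM cabsV cabs2 ler_pdivrMr // (mulrDr _ 1 1) mulr1 opprD addrACA.
exact: le_trans (cabsD _ _) (lerD _ _).
Qed.

Lemma pint_affine a b : pcont (fun s => a + s%:C * b) -> pint (fun s => a + s%:C * b) = a + b / 2.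
Proof.
move=> h; apply: pint_unique => // e e0; exists 0%N => n _.
by rewrite trap_affine subrr cabs0 ltW.
Qed.

Lemma pint_Im_ge f (X b : R) : pcont f ->
  (forall s : R, 0 <= s <= 1 -> b <= X * complex.Im (f s)) -> b <= X * complex.Im (pint f).
Proof.
move=> hf hb; apply/ler_addgt0Pr => e e0.
have X0 : 0 < `|X| + 1 by have := normr_ge0 X; lra.
have [n /(_ n (leqnn n))] := pint_cvg hf (divr_gt0 e0 X0).
move=> /(le_trans (Im_le_cabs _)); rewrite ImB ler_pdivlMr //.
have := trap_Im_ge n hb; set y := complex.Im _; set z := complex.Im _ => h1 h2.
have : `|X * (y - z)| <= e by rewrite normrM; have := normr_ge0 (y - z); nra.
by rewrite ler_norml mulrBr; lra.
Qed.

End PathIntegral.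

(** * Complex differentiability *)

Section ComplexCalculus.
Variable R : realType.
Local Notation C := (R[i]).
Implicit Types (f g : C -> C) (a b c l w x z : C) (e d : R).

Definition ccont f z := forall e, 0 < e ->
  exists2 d : R, 0 < d & forall w, cabs (w - z) < d -> cabs (f w - f z) <= e.

(** Without a quotient the point [w = z] needs no exclusion; [cder_cvg] gives the link with
    difference quotients. *)
Definition cder f z l := forall e, 0 < e ->
  exists2 d : R, 0 < d & forall w, cabs (w - z) < d ->
    cabs (f w - f z - l * (w - z)) <= e * cabs (w - z).

Definition cdiff f z := exists l, cder f z l.

Definition cnear z (P : C -> Prop) := exists2 d : R, 0 < d & forall w, cabs (w - z) < d -> P w.

Definition cpnear z (P : C -> Prop) :=
  exists2 d : R, 0 < d & forall w, cabs (w - z) < d -> w != z -> P w.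

Lemma cnear_pnear z P : cnear z P -> cpnear z P.
Proof. by move=> [d d0 h]; exists d => // w /h. Qed.

Lemma cnear_at z P : cnear z P -> P z.
Proof. by move=> [d d0]; apply; rewrite subrr cabs0. Qed.

Lemma cnearI z P Q : cnear z P -> cnear z Q -> cnear z (fun w => P w /\ Q w).
Proof.
move=> [d d0 h] [d' d0' h']; exists (Num.min d d'); first by rewrite lt_min d0.
by move=> w; rewrite lt_min => /andP[/h ? /h'].
Qed.

Lemma cpnearI z P Q : cpnear z P -> cpnear z Q -> cpnear z (fun w => P w /\ Q w).
Proof.
move=> [d d0 h] [d' d0' h']; exists (Num.min d d'); first by rewrite lt_min d0.
by move=> w; rewrite lt_min => /andP[/h ? /h'] ? w0; split; auto.
Qed.

Lemma cnear_imp z (P Q : C -> Prop) : (forall w, P w -> Q w) -> cnear z P -> cnear z Q.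
Proof. by move=> h [d d0 hd]; exists d => // w /hd/h. Qed.

Lemma cpnear_imp z (P Q : C -> Prop) : (forall w, P w -> Q w) -> cpnear z P -> cpnear z Q.
Proof. by move=> h [d d0 hd]; exists d => // w /hd/[apply]/h. Qed.

Lemma cnear_ball z d : 0 < d -> cnear z (fun w => cabs (w - z) < d).
Proof. by exists d. Qed.

Lemma cnear_open z P : cnear z P -> cnear z (fun w => cnear w P).
Proof.
move=> [d d0 h]; exists d => // w hw; exists (d - cabs (w - z)); first by rewrite subr_gt0.
by move=> x hx; apply: h; have := cabs_tri w x z; lra.
Qed.

Lemma cpnear_open z P : cpnear z P -> cpnear z (fun w => cnear w P).
Proof.
move=> [d d0 h]; exists d => // w hw w0.
have w1 : 0 < cabs (w - z) by rewrite cabs_gt0 subr_eq0.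
exists (Num.min (d - cabs (w - z)) (cabs (w - z))); first by rewrite lt_min subr_gt0 hw.
move=> x; rewrite lt_min => /andP[h1 h2]; apply: h; first by have := cabs_tri w x z; lra.
by apply: contraTneq h2 => ->; rewrite cabsC ltxx.
Qed.

Lemma cpnear_ex z P : cpnear z P -> exists2 w, w != z & P w.
Proof.
move=> [d d0 h]; have d1 : (d / 2)%:C != 0 :> C by rewrite -cabs_eq0 cabsR gt_eqF // normr_gt0; lra.
have hw : z + (d / 2)%:C != z by rewrite -subr_eq0 addrAC subrr add0r.
by exists (z + (d / 2)%:C) => //; apply: h => //; rewrite addrAC subrr add0r cabsR ger0_norm; lra.
Qed.

Lemma cpnear_other z x : x != z -> cpnear z (fun w => w != x).
Proof.
move=> xz; exists (cabs (x - z)); first by rewrite cabs_gt0 subr_eq0.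
by move=> w h _; apply: contraTneq h => ->; rewrite ltxx.
Qed.

Lemma cnear_other z x : x != z -> cnear z (fun w => w != x).
Proof.
move=> xz; exists (cabs (x - z)); first by rewrite cabs_gt0 subr_eq0.
by move=> w h; apply: contraTneq h => ->; rewrite ltxx.
Qed.

Lemma cder_cont f z l : cder f z l -> ccont f z.
Proof.
move=> h e e0; have [d d0 hd] := h 1 ltr01.
have l0 : 0 < cabs l + 1 by have := cabs_ge0 l; lra.
exists (Num.min d (e / (cabs l + 1))); first by rewrite lt_min d0 divr_gt0.
move=> w; rewrite lt_min => /andP[/hd h1]; rewrite ltr_pdivlMr // => h2.
rewrite (_ : f w - f z = (f w - f z - l * (w - z)) + l * (w - z)); last by ring.
by apply: le_trans (cabsD _ _) _; rewrite cabsM; nra.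
Qed.

Lemma cdiff_cont f z : cdiff f z -> ccont f z.
Proof. by move=> [l /cder_cont]. Qed.

Lemma cder_near f g z l : cnear z (fun w => f w = g w) -> cder f z l -> cder g z l.
Proof.
move=> h hf e e0; have [d d0 hd] := hf e e0; have [d' d0' h'] := h.
exists (Num.min d d'); first by rewrite lt_min d0.
by move=> w; rewrite lt_min => /andP[/hd ? /h' <-]; rewrite -(cnear_at h).
Qed.

Lemma cdiff_near f g z : cnear z (fun w => f w = g w) -> cdiff f z -> cdiff g z.
Proof. by move=> h [l hl]; exists l; apply: cder_near hl. Qed.

Lemma ccont_unique f g z : ccont f z -> ccont g z -> cpnear z (fun w => f w = g w) -> f z = g z.
Proof.
move=> hf hg h; apply/eqP; rewrite -subr_eq0; apply/eqP/cabs_small => e e0.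
have [d d0 hd] := hf _ (divr_gt0 e0 (ltr0n _ 2)); have [d' d0' hd'] := hg _ (divr_gt0 e0 (ltr0n _ 2)).
have [w w0 [wf [w1 w2]]] := cpnear_ex (cpnearI h (cpnearI (cnear_pnear (cnear_ball z d0)) (cnear_pnear (cnear_ball z d0')))).
have := hd _ w1; have := hd' _ w2; have := cabs_tri (f w) (f z) (g z).
by rewrite -wf (cabsC (f z) (f w)); lra.
Qed.

Lemma cder_unique f z l l' : cder f z l -> cder f z l' -> l = l'.
Proof.
move=> hf hg; apply/eqP; rewrite -subr_eq0; apply/eqP/cabs_small => e e0.
have [d d0 hd] := hf _ (divr_gt0 e0 (ltr0n _ 2)); have [d' d0' hd'] := hg _ (divr_gt0 e0 (ltr0n _ 2)).
have [w w0 [w1 w2]] := cpnear_ex ((cpnearI (cnear_pnear (cnear_ball z d0)) (cnear_pnear (cnear_ball z d0')))).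
have p0 : 0 < cabs (w - z) by rewrite cabs_gt0 subr_eq0.
rewrite -(ler_pM2r p0) -cabsM.
rewrite (_ : _ * _ = (f w - f z - l' * (w - z)) - (f w - f z - l * (w - z))); last by ring.
by apply: le_trans (cabsB _ _) _; have := hd _ w1; have := hd' _ w2; nra.
Qed.

Lemma cder_const c z : cder (fun=> c) z 0.
Proof. by move=> e e0; exists 1 => // w _; rewrite subrr mul0r subr0 cabs0 mulr_ge0 ?cabs_ge0 ?ltW. Qed.

Lemma cder_id z : cder id z 1.
Proof. by move=> e e0; exists 1 => // w _; rewrite mul1r subrr cabs0 mulr_ge0 ?cabs_ge0 ?ltW. Qed.

Lemma cderD f g z l m : cder f z l -> cder g z m -> cder (fun w => f w + g w) z (l + m).
Proof.
move=> hf hg e e0.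
have [d d0 hd] := hf _ (divr_gt0 e0 (ltr0n _ 2)); have [d' d0' hd'] := hg _ (divr_gt0 e0 (ltr0n _ 2)).
exists (Num.min d d'); first by rewrite lt_min d0.
move=> w; rewrite lt_min => /andP[/hd h1 /hd' h2].
rewrite (_ : _ - _ = (f w - f z - l * (w - z)) + (g w - g z - m * (w - z))); last by ring.
by apply: le_trans (cabsD _ _) _; lra.
Qed.

Lemma cderM f g z l m : cder f z l -> cder g z m ->
  cder (fun w => f w * g w) z (l * g z + f z * m).
Proof.
move=> hf hg e e0.
(* [K] bounds the moduli of [f z], [l] and, near [z], of [g w]; each of the three error terms then
   costs at most [e1 * K] times the distance. *)
pose K := cabs (f z) + cabs (g z) + cabs l + 1.
have K0 : 0 < K by have := cabs_ge0 (f z); have := cabs_ge0 (g z); have := cabs_ge0 l; rewrite /K; lra.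
pose e1 := e / (3 * K).
have e10 : 0 < e1 by rewrite divr_gt0 // mulr_gt0.
have e1E : e1 * K * 3 = e by rewrite /e1; field; rewrite lt0r_neq0.
have [d d0 hd] := hf _ e10; have [d' d0' hd'] := hg _ e10.
have e1m : 0 < Num.min e1 1 by rewrite lt_min e10 ltr01.
have [d2 d20 hd2] := cder_cont hg e1m.
exists (Num.min d (Num.min d' d2)); first by rewrite !lt_min d0 d0'.
move=> w; rewrite !lt_min => /andP[/hd h1 /andP[/hd' h2 /hd2]].
rewrite le_min => /andP[h3 h4].
rewrite (_ : _ - _ = (f w - f z - l * (w - z)) * g w
   + f z * (g w - g z - m * (w - z)) + l * (w - z) * (g w - g z)); last by ring.
have hgw : cabs (g w) <= cabs (g z) + 1 by have := cabs_subl (g w) (g z); lra.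
apply: le_trans (cabsD _ _) _; apply: le_trans (lerD (cabsD _ _) (lexx _)) _.
rewrite !cabsM; set D := cabs (w - z) in h1 h2 *.
have D0 : 0 <= D := cabs_ge0 _.
have p1 : cabs (f w - f z - l * (w - z)) * cabs (g w) <= e1 * D * K.
  by apply: ler_pM; rewrite ?cabs_ge0 //; apply: le_trans hgw _; have := cabs_ge0 (f z); have := cabs_ge0 l; rewrite /K; lra.
have p2 : cabs (f z) * cabs (g w - g z - m * (w - z)) <= K * (e1 * D).
  by apply: ler_pM; rewrite ?cabs_ge0 //; have := cabs_ge0 (g z); have := cabs_ge0 l; rewrite /K; lra.
have p3 : cabs l * D * cabs (g w - g z) <= K * D * e1.
  apply: ler_pM; rewrite ?cabs_ge0 ?mulr_ge0 ?cabs_ge0 ?ler_wpM2r //.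
  by have := cabs_ge0 (f z); have := cabs_ge0 (g z); rewrite /K; lra.
by rewrite -e1E; lra.
Qed.

Lemma cderV f z l : cder f z l -> f z != 0 ->
  cder (fun w => (f w)^-1) z (- l / (f z) ^+ 2).
Proof.
move=> hf f0 e e0.
have p0 : 0 < cabs (f z) by rewrite cabs_gt0.
(* The tolerances keep [cabs (f w)] above [F / 2] and bound each of the two error terms by
   [e * F / 4] times the distance; their sum is absorbed by the division by [f w]. *)
pose F := cabs (f z).
have e20 : 0 < F / 2 by rewrite divr_gt0.
have e30 : 0 < e * F ^+ 2 / 4 by rewrite divr_gt0 // mulr_gt0 // exprn_gt0.
pose e4 := e * F ^+ 3 / (4 * (cabs l + 1)).
have l0 : 0 < cabs l + 1 by have := cabs_ge0 l; lra.
have e40 : 0 < e4 by rewrite divr_gt0 ?mulr_gt0 ?exprn_gt0.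
have [d d0 hd] := cder_cont hf e20; have [d' d0' hd'] := hf _ e30.
have [d2 d20 hd2] := cder_cont hf e40.
exists (Num.min d (Num.min d' d2)); first by rewrite !lt_min d0 d0'.
move=> w; rewrite !lt_min => /andP[/hd h1 /andP[/hd' h2 /hd2 h3]].
have hFw : F / 2 <= cabs (f w) by have := cabs_subl (f z) (f w); rewrite (cabsC (f z)) /F; move: h1; rewrite /F; lra.
have fw0 : f w != 0 by rewrite -cabs_gt0; lra.
rewrite (_ : _ - _ = (- (f w - f z - l * (w - z)) / f z + l * (w - z) * (f w - f z) / (f z ^+ 2)) / f w); last first.
  by field; rewrite f0 fw0.
rewrite cabsM cabsV ler_pdivrMr ?cabs_gt0 //.
apply: le_trans (cabsD _ _) _; rewrite !cabsM !cabsV cabsX cabsN -/F.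
set D := cabs (w - z) in h2 *; set A := cabs (_ - _) in h2 *; set B := cabs (_ - _) in h3 *.
have D0 : 0 <= D := cabs_ge0 _.
have q1 : A / F <= e * F / 4 * D.
  by rewrite ler_pdivrMr //; apply: le_trans h2 _; rewrite le_eqVlt; apply/orP; left; apply/eqP; field.
have q2 : cabs l * D * B / F ^+ 2 <= e * F / 4 * D.
  rewrite (ler_pdivrMr _ _ (exprn_gt0 2 p0)).
  have : cabs l * D * B <= (cabs l + 1) * D * e4.
    by apply: ler_pM; rewrite ?mulr_ge0 ?cabs_ge0 ?ler_wpM2r //; lra.
  have e4E : (cabs l + 1) * D * e4 = e * F / 4 * D * F ^+ 2.
    by rewrite /e4; field; rewrite lt0r_neq0.
  by rewrite e4E.
have : e * D * (F / 2) <= e * D * cabs (f w) by rewrite ler_wpM2l // mulr_ge0 // ltW.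
by lra.
Qed.

Lemma cdiff_const c z : cdiff (fun=> c) z.
Proof. by exists 0; apply: cder_const. Qed.
Lemma cdiff_id z : cdiff id z.
Proof. by exists 1; apply: cder_id. Qed.
Lemma cdiffD f g z : cdiff f z -> cdiff g z -> cdiff (fun w => f w + g w) z.
Proof. by move=> [l hl] [m hm]; exists (l + m); apply: cderD. Qed.
Lemma cdiffM f g z : cdiff f z -> cdiff g z -> cdiff (fun w => f w * g w) z.
Proof. by move=> [l hl] [m hm]; exists (l * g z + f z * m); apply: cderM. Qed.
Lemma cdiffV f z : cdiff f z -> f z != 0 -> cdiff (fun w => (f w)^-1) z.
Proof. by move=> [l hl] h; exists (- l / (f z) ^+ 2); apply: cderV. Qed.

Lemma cderZ c f z l : cder f z l -> cder (fun w => c * f w) z (c * l).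
Proof. by move=> hf; have := cderM (cder_const c z) hf; rewrite mul0r add0r. Qed.
Lemma cdiffZ c f z : cdiff f z -> cdiff (fun w => c * f w) z.
Proof. by move=> [l hl]; exists (c * l); apply: cderZ. Qed.
Lemma cdiffN f z : cdiff f z -> cdiff (fun w => - f w) z.
Proof.
move=> h; apply: cdiff_near (cdiffZ (-1) h).
by exists 1 => // w _; rewrite mulN1r.
Qed.
Lemma cdiffB f g z : cdiff f z -> cdiff g z -> cdiff (fun w => f w - g w) z.
Proof. by move=> hf /cdiffN; apply: cdiffD. Qed.
Lemma cdiffX f n z : cdiff f z -> cdiff (fun w => f w ^+ n) z.
Proof.
move=> h; elim: n => [|n IH]; first by under eq_fun do rewrite expr0; apply: cdiff_const.
by under eq_fun do rewrite exprS; apply: cdiffM.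
Qed.

Lemma cder_shift f v z l : cder f (z + v) l -> cder (fun w => f (w + v)) z l.
Proof.
move=> h e /h[d d0 hd]; exists d => // w hw.
have e1 : w + v - (z + v) = w - z by ring.
by have := hd (w + v); rewrite e1; apply.
Qed.

Lemma cdiff_shift f v z : cdiff f (z + v) -> cdiff (fun w => f (w + v)) z.
Proof. by move=> [l /cder_shift h]; exists l. Qed.

Lemma ccontM f g z : ccont f z -> ccont g z -> ccont (fun w => f w * g w) z.
Proof.
move=> hf hg e e0.
pose K := cabs (f z) + cabs (g z) + 1.
have K0 : 0 < K by rewrite /K; have := cabs_ge0 (f z); have := cabs_ge0 (g z); lra.
pose e1 := Num.min 1 (e / (2 * K)).
have e10 : 0 < e1 by rewrite lt_min ltr01 divr_gt0 // mulr_gt0.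
have e11 : e1 <= 1 by rewrite ge_min lexx.
have e12 : e1 * (2 * K) <= e by rewrite -ler_pdivlMr ?mulr_gt0 // ge_min lexx orbT.
have [x x0 hx] := hf _ e10; have [y y0 hy] := hg _ e10.
exists (Num.min x y); first by rewrite lt_min x0.
move=> w; rewrite lt_min => /andP[/hx h1 /hy h2].
rewrite (_ : _ - _ = (f w - f z) * (g w - g z) + (f w - f z) * g z + f z * (g w - g z)); last by ring.
apply: le_trans (cabsD _ _) _; apply: le_trans (lerD (cabsD _ _) (lexx _)) _; rewrite !cabsM.
have := cabs_ge0 (f w - f z); have := cabs_ge0 (g w - g z).
have := cabs_ge0 (f z); have := cabs_ge0 (g z); move: e12; rewrite /K; nra.
Qed.

(** The divided difference at [z], completed by [l]. Cauchy's formula comes from integrating it, and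
    repeated use splits off the factors of a zero. *)
Definition dslope f z l w := if w == z then l else (f w - f z) / (w - z).

Lemma dslope_at f z l : dslope f z l z = l.
Proof. by rewrite /dslope eqxx. Qed.

Lemma dslopeE f z l w : f w = f z + (w - z) * dslope f z l w.
Proof.
rewrite /dslope; case: eqVneq => [->|wz]; first by rewrite subrr mul0r addr0.
by field; rewrite subr_eq0.
Qed.

Lemma cdiff_dslope_neq f z l w : w != z -> cdiff f w -> cdiff (dslope f z l) w.
Proof.
move=> wz hf; apply: (@cdiff_near (fun w => (f w - f z) / (w - z))).
  have zw : z != w by rewrite eq_sym.
  have [x x0 hx] := cnear_other zw; exists x => // w' /hx; rewrite /dslope => /negbTE -> //.
apply: cdiffM; first exact: cdiffB hf (cdiff_const _ _).
by apply: cdiffV; [exact: cdiffB (cdiff_id _) (cdiff_const _ _)|rewrite subr_eq0].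
Qed.

Lemma ccont_dslope f z l : cder f z l -> ccont (dslope f z l) z.
Proof.
move=> hl e e0; have [x x0 hx] := hl e e0; exists x => // w /hx h.
rewrite dslope_at /dslope; case: eqVneq => [_|wz]; first by rewrite subrr cabs0 ltW.
have wz0 : w - z != 0 by rewrite subr_eq0.
rewrite (_ : _ - l = (f w - f z - l * (w - z)) / (w - z)); last by field.
by rewrite cabsM cabsV ler_pdivrMr // cabs_gt0.
Qed.

End ComplexCalculus.

(** * Integrals along complex segments and round triangles *)

Section SegmentIntegral.
Variable R : realType.
Local Notation C := (R[i]).
Implicit Types (f g : C -> C) (a b c l w x z : C) (e d s t : R).

Definition seg a b s : C := a + s%:C * (b - a).
Definition scont f a b := pcont (fun s => f (seg a b s)).
Definition J f a b : C := (b - a) * pint (fun s => f (seg a b s)).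

Lemma seg_rev a b s : seg b a s = seg a b (1 - s).
Proof. by rewrite /seg rmorphB rmorph1; ring. Qed.

Lemma seg_half a b s : seg a ((a + b) / 2) s = seg a b (s / 2).
Proof. by rewrite /seg rmorphM fmorphV rmorph_nat; field. Qed.

Lemma seg_half' a b s : seg ((a + b) / 2) b s = seg a b ((1 + s) / 2).
Proof. by rewrite /seg rmorphM rmorphD rmorph1 fmorphV rmorph_nat; field. Qed.

Lemma scontP f a b : (forall s, 0 <= s <= 1 -> ccont f (seg a b s)) -> scont f a b.
Proof.
move=> h s hs e e0; have [d d0 hd] := h s hs e e0.
have L0 : 0 < cabs (b - a) + 1 by have := cabs_ge0 (b - a); lra.
exists (d / (cabs (b - a) + 1)); first by rewrite divr_gt0.
move=> t ht; rewrite ltr_pdivlMr // => h1; apply: hd.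
rewrite (_ : _ - _ = (t - s)%:C * (b - a)); last by rewrite /seg rmorphB; ring.
rewrite cabsM cabsR; have := normr_ge0 (t - s); lra.
Qed.

Lemma J_ext f g a b : (forall s, 0 <= s <= 1 -> f (seg a b s) = g (seg a b s)) -> J f a b = J g a b.
Proof. by move=> h; rewrite /J (pint_ext h). Qed.

Lemma J_rev f a b : scont f a b -> J f b a = - J f a b.
Proof.
move=> h; rewrite /J -(pint_rev h) -mulNr opprB; congr (_ * _).
by apply: pint_ext => s _; rewrite (seg_rev a b s).
Qed.

Lemma J_half f a b : scont f a b ->
  J f a b = J f a ((a + b) / 2) + J f ((a + b) / 2) b.
Proof.
move=> h; rewrite /J (pint_half h).
rewrite (@pint_ext R (fun s => f (seg a ((a + b) / 2) s)) (fun s => f (seg a b (s / 2)))); last first.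
  by move=> s _; rewrite seg_half.
rewrite (@pint_ext R (fun s => f (seg ((a + b) / 2) b s)) (fun s => f (seg a b ((1 + s) / 2)))); last first.
  by move=> s _; rewrite seg_half'.
by field.
Qed.

Lemma scont_lin c f g a b : scont f a b -> scont g a b -> scont (fun w => c * f w + g w) a b.
Proof. exact: pcont_lin. Qed.

Lemma J_lin c f g a b : scont f a b -> scont g a b ->
  J (fun w => c * f w + g w) a b = c * J f a b + J g a b.
Proof. by move=> hf hg; rewrite /J (pint_lin _ hf hg); ring. Qed.

Lemma J_bound f a b e : scont f a b ->
  (forall s, 0 <= s <= 1 -> cabs (f (seg a b s)) <= e) -> cabs (J f a b) <= cabs (b - a) * e.
Proof. by move=> h hb; rewrite cabsM ler_wpM2l ?cabs_ge0 // (pint_bound h hb). Qed.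

Lemma ccont_affine c l x z : ccont (fun w => c + l * (w - x)) z.
Proof.
apply: cdiff_cont; apply: cdiffD (cdiff_const _ _) _; apply: cdiffZ.
exact: cdiffB (cdiff_id _) (cdiff_const _ _).
Qed.

Lemma J_affine c l x a b :
  J (fun w => c + l * (w - x)) a b = (b - a) * (c + l * ((a + b) / 2 - x)).
Proof.
have e s : c + l * (seg a b s - x) = (c + l * (a - x)) + s%:C * (l * (b - a)).
  by rewrite /seg; ring.
rewrite /J (@pint_ext R _ (fun s => (c + l * (a - x)) + s%:C * (l * (b - a)))) //.
rewrite pint_affine; first by field.
have h : scont (fun w => c + l * (w - x)) a b by apply: scontP => s _; apply: ccont_affine.
by apply: pcont_ext h => s _.
Qed.

Definition Tri f a b c := J f a b + J f b c + J f c a.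

(** Affine functions integrate to zero round a triangle by direct computation, so only the deviation
    of [f] from one contributes. *)
Lemma Tri_approx f a b c (c0 l x : C) (L e : R) :
  scont f a b -> scont f b c -> scont f c a -> 0 <= e ->
  cabs (b - a) <= L -> cabs (c - b) <= L -> cabs (a - c) <= L ->
  (forall s, 0 <= s <= 1 -> cabs (f (seg a b s) - (c0 + l * (seg a b s - x))) <= e) ->
  (forall s, 0 <= s <= 1 -> cabs (f (seg b c s) - (c0 + l * (seg b c s - x))) <= e) ->
  (forall s, 0 <= s <= 1 -> cabs (f (seg c a s) - (c0 + l * (seg c a s - x))) <= e) ->
  cabs (Tri f a b c) <= 3 * L * e.
Proof.
move=> s1 s2 s3 e0 l1 l2 l3 h1 h2 h3.
pose A w := c0 + l * (w - x).
have sA p q : scont A p q by apply: scontP => s _; apply: ccont_affine.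
have T0 : Tri A a b c = 0 by rewrite /Tri !J_affine; field.
have step p q : scont f p q -> cabs (q - p) <= L ->
   (forall s, 0 <= s <= 1 -> cabs (f (seg p q s) - A (seg p q s)) <= e) ->
   cabs (J f p q - J A p q) <= L * e.
  move=> hs hl hb; rewrite addrC -mulN1r -J_lin //.
  apply: le_trans (J_bound (scont_lin _ (sA _ _) hs) (e := e) _) _; last by rewrite ler_wpM2r.
  by move=> s hh; rewrite mulN1r addrC; apply: hb.
rewrite -[Tri f a b c]subr0 -T0 /Tri.
rewrite (_ : _ - _ = (J f a b - J A a b) + (J f b c - J A b c) + (J f c a - J A c a)); last by ring.
apply: le_trans (cabsD _ _) _; apply: le_trans (lerD (cabsD _ _) (lexx _)) _.
have := step _ _ s1 l1 h1; have := step _ _ s2 l2 h2; have := step _ _ s3 l3 h3; lra.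
Qed.

(** Subdivision by midpoints; each inner side is traversed twice in opposite directions. *)
Lemma Tri_quarter f a b c : scont f a b -> scont f b c -> scont f c a ->
  scont f ((a + b) / 2) ((c + a) / 2) -> scont f ((b + c) / 2) ((a + b) / 2) ->
  scont f ((c + a) / 2) ((b + c) / 2) ->
  Tri f a b c = Tri f a ((a + b) / 2) ((c + a) / 2) + Tri f ((a + b) / 2) b ((b + c) / 2)
   + Tri f ((c + a) / 2) ((b + c) / 2) c + Tri f ((b + c) / 2) ((c + a) / 2) ((a + b) / 2).
Proof.
move=> h1 h2 h3 k1 k2 k3; rewrite /Tri (J_half h1) (J_half h2) (J_half h3).
rewrite (J_rev k1) (J_rev k2) (J_rev k3); move: (J f _ _) (J f _ _) (J f _ _) => *; ring.
Qed.

End SegmentIntegral.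

(** * Cauchy's theorem and formula *)

Section Goursat.
Variable R : realType.
Local Notation C := (R[i]).

Definition simplex (p q : R) := [/\ 0 <= p, 0 <= q & p + q <= 1].
(** In barycentric coordinates the homothetic copies of the triangle are described by a corner and a
    ratio [t]; a negative ratio is the inverted middle piece of a subdivision. *)
Definition subtriangle (p q t : R) :=
  [/\ simplex p q, simplex (p + t) q & simplex p (q + t)].

Lemma subtriangle_quarter p q t : subtriangle p q t ->
  [/\ subtriangle p q (t / 2), subtriangle (p + t / 2) q (t / 2),
      subtriangle p (q + t / 2) (t / 2) & subtriangle (p + t / 2) (q + t / 2) (- (t / 2))].
Proof. by move=> [[? ? ?] [? ? ?] [? ? ?]]; split; split; split; lra. Qed.

Lemma simplex_conv p q p' q' s : simplex p q -> simplex p' q' -> 0 <= s <= 1 ->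
  simplex (p + s * (p' - p)) (q + s * (q' - q)).
Proof. by move=> [? ? ?] [? ? ?] ?; split; nra. Qed.

Variables (f : C -> C) (a b c : C).
Implicit Types (s t e d p q : R).

Definition bary p q : C := a + p%:C * (b - a) + q%:C * (c - a).


Lemma bary_seg p q p' q' s : seg (bary p q) (bary p' q') s = bary (p + s * (p' - p)) (q + s * (q' - q)).
Proof. by rewrite /seg /bary !(rmorphD, rmorphM, rmorphB); ring. Qed.

Lemma bary_mid p q p' q' : (bary p q + bary p' q') / 2 = bary ((p + p') / 2) ((q + q') / 2).
Proof.
have e x y : ((x + y) / 2)%:C = (x%:C + y%:C) / 2 :> C by rewrite rmorphM rmorphD fmorphV rmorph_nat.
by rewrite /bary !e; field.
Qed.

Definition bTri p q t := Tri f (bary p q) (bary (p + t) q) (bary p (q + t)).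

Lemma bTri_restrict p q t p' q' :
  bary p q + p'%:C * (bary (p + t) q - bary p q) + q'%:C * (bary p (q + t) - bary p q) =
  bary (p + t * p') (q + t * q').
Proof. by rewrite /bary !(rmorphD, rmorphM); ring. Qed.

Let L := cabs (b - a) + cabs (c - a).

Lemma bary_dist p q p' q' e : `|p - p'| <= e -> `|q - q'| <= e ->
  cabs (bary p q - bary p' q') <= L * e.
Proof.
move=> h1 h2; rewrite (_ : _ - _ = (p - p')%:C * (b - a) + (q - q')%:C * (c - a)); last first.
  by rewrite /bary !rmorphB; ring.
apply: le_trans (cabsD _ _) _; rewrite !cabsM !cabsR /L.
by have := cabs_ge0 (b - a); have := cabs_ge0 (c - a); nra.
Qed.

Hypothesis fc : forall p q, simplex p q -> ccont f (bary p q).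

Lemma bary_scont p q p' q' : simplex p q -> simplex p' q' -> scont f (bary p q) (bary p' q').
Proof.
move=> h h'; apply: scontP => s hs; rewrite bary_seg.
by apply: fc; apply: simplex_conv.
Qed.

Lemma bTri_quarter p q t : subtriangle p q t ->
  bTri p q t = bTri p q (t / 2) + bTri (p + t / 2) q (t / 2) + bTri p (q + t / 2) (t / 2)
    + bTri (p + t / 2) (q + t / 2) (- (t / 2)).
Proof.
move=> hok; have [[? ? ?] [_ k1 k2] _ [k3 k4 k5]] := subtriangle_quarter hok.
case: hok => o1 o2 o3.
have e1 (x : R) : (x + (x + t)) / 2 = x + t / 2 by field.
have e2 (x : R) : (x + t + x) / 2 = x + t / 2 by field.
have e3 (x : R) : (x + x) / 2 = x by field.
have e4 (x : R) : x + t / 2 + t / 2 = x + t by field.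
have e5 (x : R) : x + t / 2 + - (t / 2) = x by field.
by rewrite {1}/bTri Tri_quarter ?bary_mid ?(e1, e2, e3, e4, e5);
  [rewrite /bTri !(e1, e2, e3, e4, e5)|..]; try apply: bary_scont.
Qed.

(** Goursat's argument: a triangle with too large an integral has a quarter with the same defect,
    and the quarters shrink to a point at which [f] is nearly affine. *)
Lemma goursat : (forall p q, simplex p q -> cdiff f (bary p q)) -> Tri f a b c = 0.
Proof.
move=> fd.
have -> : Tri f a b c = bTri 0 0 1.
  rewrite /bTri /bary !add0r !mul0r !addr0 !mul1r.
  by rewrite (_ : a + (b - a) = b) 1?(_ : a + (c - a) = c) //; ring.
apply/eqP; rewrite -cabs_eq0 eq_le cabs_ge0 andbT.
apply/ler_addgt0Pr => e e0; rewrite add0r leNgt; apply/negP => hbad.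
(* The threshold scales with the area, so it is inherited by at least one of the four quarters. *)
pose bad p q t := subtriangle p q t /\ e * t ^+ 2 < cabs (bTri p q t).
have step p q t : bad p q t -> exists p' q' t',
    [/\ bad p' q' t', `|t'| = `|t| / 2, `|p' - p| <= `|t| / 2 & `|q' - q| <= `|t| / 2].
  move=> [hok hT]; apply: contrapT => hn.
  have nt : `|t / 2| = `|t| / 2 by rewrite normrM (@ger0_norm _ 2^-1) ?invr_ge0.
  have good p' q' t' : subtriangle p' q' t' -> `|t'| = `|t| / 2 -> `|p' - p| <= `|t| / 2 ->
      `|q' - q| <= `|t| / 2 -> cabs (bTri p' q' t') <= e * (t / 2) ^+ 2.
    move=> h1 h2 h3 h4; rewrite leNgt; apply/negP => h5; apply: hn.
    exists p', q', t'; split; [split; first exact: h1|exact: h2|exact: h3|exact: h4].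
    by rewrite -(real_normK (num_real t')) h2 -nt real_normK ?num_real.
  move: hT; rewrite (bTri_quarter hok) ltNge => /negP; apply.
  apply: le_trans (cabsD _ _) _; apply: le_trans (lerD (cabsD _ _) (lexx _)) _.
  apply: le_trans (lerD (lerD (cabsD _ _) (lexx _)) (lexx _)) _.
  have n0 : 0 <= `|t| / 2 by rewrite divr_ge0.
  have k1 : p + t / 2 - p = t / 2 by ring.
  have k2 : q + t / 2 - q = t / 2 by ring.
  have g1 := @good p q (t / 2); have g2 := @good (p + t / 2) q (t / 2).
  have g3 := @good p (q + t / 2) (t / 2); have g4 := @good (p + t / 2) (q + t / 2) (- (t / 2)).
  rewrite k1 k2 !subrr normr0 ?normrN nt in g1 g2 g3 g4.
  have [sb1 sb2 sb3 sb4] := subtriangle_quarter hok.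
  have -> : e * t ^+ 2 = e * (t / 2) ^+ 2 + e * (t / 2) ^+ 2 + e * (t / 2) ^+ 2 + e * (t / 2) ^+ 2 by field.
  by rewrite !lerD ?g1 ?g2 ?g3 ?g4.
(* Carrying the proof of badness in the type lets the choice of the next triangle be iterated. *)
pose St := {x : R * R * R | bad x.1.1 x.1.2 x.2}.
have init : bad 0 0 1.
  split; first by split; rewrite /simplex !add0r ?lexx ?ler01.
  by rewrite expr1n mulr1.
have nxt (x : St) : {y : St | [/\ `|(sval y).2| = `|(sval x).2| / 2,
    `|(sval y).1.1 - (sval x).1.1| <= `|(sval x).2| / 2 &
    `|(sval y).1.2 - (sval x).1.2| <= `|(sval x).2| / 2]}.
  apply: cid; case: x => [[[p q] t] /= h]; have [p' [q' [t' [h1 h2 h3 h4]]]] := step _ _ _ h.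
  by exists (exist _ (p', q', t') h1).
pose x0 : St := exist _ (0, 0, 1) init.
pose x n := iter n (fun y => sval (nxt y)) x0.
pose P n := (sval (x n)).1.1; pose Q n := (sval (x n)).1.2; pose t n := (sval (x n)).2.
have tn n : `|t n| = 1 / 2 ^+ n.
  elim: n => [|n IH]; first by rewrite /t /= normr1 expr0 divr1.
  rewrite /t /x iterS; case: (svalP (nxt (x n))) => -> _ _; rewrite -/(t n) IH exprS.
  by field; rewrite expf_neq0.
have hP n : `|P n.+1 - P n| <= 2^-1 / 2 ^+ n.
  have [_ h _] := svalP (nxt (x n)); rewrite /P /x iterS; apply: le_trans h _.
  by rewrite -/(t n) tn mul1r mulrC.
have hQ n : `|Q n.+1 - Q n| <= 2^-1 / 2 ^+ n.
  have [_ _ h] := svalP (nxt (x n)); rewrite /Q /x iterS; apply: le_trans h _.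
  by rewrite -/(t n) tn mul1r mulrC.
have [p0 hp0] := geo_real hP; have [q0 hq0] := geo_real hQ.
rewrite mulfV // in hp0 hq0.
have bx n : bad (P n) (Q n) (t n) by rewrite /P /Q /t; case: (x n).
have sn n : simplex (P n) (Q n) by case: (bx n) => -[].
have s0 : simplex p0 q0.
  split; first by apply: geo_lim_ge hp0 _ => n; case: (sn n).
    by apply: geo_lim_ge hq0 _ => n; case: (sn n).
  apply: (@geo_lim_le _ (fun n => P n + Q n) 2) => [n|n]; last by case: (sn n).
  rewrite (_ : _ - _ = (P n - p0) + (Q n - q0)); last by ring.
  by apply: le_trans (ler_normD _ _) _; have := hp0 n; have := hq0 n; lra.
have [l hl] : cdiff f (bary p0 q0) by apply: fd.
have L0 : 0 <= L by rewrite addr_ge0 ?cabs_ge0.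
(* Three sides of length at most [L * h], on which [f] deviates by at most [e1 * (L * (2 * h))],
   give [6 * L ^+ 2 * e1 * h ^+ 2]; the added 1 covers [L = 0]. *)
pose e1 := e / (6 * L ^+ 2 + 1).
have D0 : 0 < 6 * L ^+ 2 + 1 by have := sqr_ge0 L; lra.
have e10 : 0 < e1 by rewrite divr_gt0.
have [d d0 hd] := hl _ e10.
have [n hn] := pow2_small (2 * L) d0.
have [[sb1 sb2 sb3]] := bx n; rewrite ltNge => /negP; apply.
pose h : R := 1 / 2 ^+ n.
have h0 : 0 <= h by rewrite /h divr_ge0 ?exprn_ge0.
have hn' : L * (2 * h) < d.
  by have <- : 2 * L / 2 ^+ n = L * (2 * h) by rewrite /h; ring.
have pn : `|P n - p0| <= h by apply: hp0.
have qn : `|Q n - q0| <= h by apply: hq0.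
have tnn : `|t n| = h by apply: tn.
move: (P n) (Q n) (t n) sb1 sb2 sb3 pn qn tnn => p q tt sb1 sb2 sb3 pn qn tnn.
clear t tn hP hQ hp0 hq0 bx sn hn P Q x x0 nxt init step St bad hbad.
have close y z : simplex y z -> `|y - p0| <= 2 * h -> `|z - q0| <= 2 * h ->
    cabs (f (bary y z) - (f (bary p0 q0) + l * (bary y z - bary p0 q0))) <= e1 * (L * (2 * h)).
  move=> hs h1 h2; have := bary_dist h1 h2 => hb.
  rewrite opprD addrA; apply: le_trans (hd _ (le_lt_trans hb hn')) _.
  by rewrite ler_pM2l.
have pp0 : `|p - p0| <= 2 * h by lra.
have qq0 : `|q - q0| <= 2 * h by lra.
have pp1 : `|p + tt - p0| <= 2 * h.
  by rewrite addrAC; apply: le_trans (ler_normD _ _) _; rewrite tnn; lra.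
have qq1 : `|q + tt - q0| <= 2 * h.
  by rewrite addrAC; apply: le_trans (ler_normD _ _) _; rewrite tnn; lra.
have conv (y y' z k s : R) : 0 <= s <= 1 -> `|y - z| <= k -> `|y' - z| <= k -> `|y + s * (y' - y) - z| <= k.
  move=> hs; rewrite !ler_norml; nra.
rewrite /bTri; apply: le_trans (@Tri_approx _ f _ _ _ (f (bary p0 q0)) l (bary p0 q0) (L * h) (e1 * (L * (2 * h))) _ _ _ _ _ _ _ _ _ _) _;
  try (by apply: bary_scont);
  try (by move=> s hs; rewrite bary_seg; apply: close; [apply: simplex_conv|apply: conv|apply: conv]).
- by rewrite (mulr_ge0 (ltW e10)) // !mulr_ge0.
- by apply: bary_dist; rewrite ?subrr ?normr0 // addrAC subrr add0r tnn.
- apply: bary_dist; first by rewrite opprD addNKr normrN tnn.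
  by rewrite addrAC subrr add0r tnn.
- by apply: bary_dist; rewrite ?subrr ?normr0 // opprD addNKr normrN tnn.
have -> : tt ^+ 2 = h ^+ 2 by rewrite -(real_normK (num_real tt)) tnn.
have e1E : e1 * (6 * L ^+ 2 + 1) = e by rewrite /e1 divfK // lt0r_neq0.
rewrite -e1E; have := mulr_ge0 (ltW e10) (sqr_ge0 h); lra.
Qed.

End Goursat.

Section CauchyFormula.
Variable R : realType.
Local Notation C := (R[i]).
Implicit Types (f g : C -> C) (a b c l w x z : C) (e d s t : R).

(* The point [a] may be singular: halving towards [a] leaves only triangles
   on which [goursat] applies. *)
Lemma Tri_vertex f a b c :
  (forall p q, simplex p q -> ccont f (bary a b c p q)) ->
  (forall p q, simplex p q -> 0 < p + q -> cdiff f (bary a b c p q)) ->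
  Tri f a b c = 0.
Proof.
move=> fc fd.
(* The sum of the coordinates vanishes only at the vertex [a]; its values at the three corners are
   [p + q] and twice [p + q + t], so the piece avoids [a]. *)
have small p q t : subtriangle p q t -> 0 < p + q -> 0 < p + q + t -> bTri f a b c p q t = 0.
  move=> [[? ? ?] [? ? ?] [? ? ?]] h1 h2.
  have aux p' q' : simplex p' q' -> simplex (p + t * p') (q + t * q') /\ 0 < p + t * p' + (q + t * q').
    by move=> [? ? ?]; split; [split|]; nra.
  by apply: goursat => p' q' /aux[h3 h4]; rewrite /bary bTri_restrict;
    [apply: fc|apply: fd].
have halve t : 0 < t <= 1 -> bTri f a b c 0 0 t = bTri f a b c 0 0 (t / 2).
  move=> ht; have hs : subtriangle 0 0 t by split; split; lra.
  have [_ h2 h3 h4] := subtriangle_quarter hs.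
  have z2 := small _ _ _ h2; have z3 := small _ _ _ h3; have z4 := small _ _ _ h4.
  by rewrite (bTri_quarter fc hs) z2 ?z3 ?z4 ?addr0 //; lra.
(* The whole integral thus equals that over an arbitrarily small triangle at [a], where [f] stays
   within 1 of [f a] and only the perimeter counts. *)
have pow n : bTri f a b c 0 0 (1 / 2 ^+ n) = Tri f a b c.
  elim: n => [|n IH].
    rewrite expr0 divr1 /bTri /bary !add0r !mul0r !addr0 !mul1r.
    by rewrite (_ : a + (b - a) = b) 1?(_ : a + (c - a) = c) //; ring.
  rewrite -IH [in RHS]halve; last first.
    by rewrite divr_gt0 ?exprn_gt0 // ler_pdivrMr ?exprn_gt0 // mul1r exprn_ege1 // ler1n.
  by congr bTri; rewrite exprS; field; rewrite expf_neq0.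
pose L := cabs (b - a) + cabs (c - a).
have L0 : 0 <= L by rewrite addr_ge0 ?cabs_ge0.
have b0 : bary a b c 0 0 = a by rewrite /bary !mul0r !addr0.
have [|d d0 hd] := fc 0 0 _ 1 ltr01; first by split; lra.
apply: cabs_small => e e0; rewrite b0 in hd.
have [n hn] := pow2_small (3 * L) e0; have [m hm] := pow2_small L d0.
pose h : R := 1 / 2 ^+ maxn n m; rewrite -(pow (maxn n m)) -/h.
have h0 : 0 < h by rewrite /h divr_gt0 ?exprn_gt0.
have hle k : (k <= maxn n m)%N -> h <= 1 / 2 ^+ k.
  by move=> hk; rewrite /h !div1r lef_pV2 ?posrE ?exprn_gt0 // ler_weXn2l // ler1n.
have h1 : 3 * L * h <= e.
  apply: le_trans (ltW hn); rewrite -mulrA -[X in _ <= X]mulrA ler_wpM2l //.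
  by rewrite ler_wpM2l // -(mul1r (_ ^-1)) hle ?leq_maxl.
have h2 : L * h < d.
  apply: le_lt_trans hm; rewrite ler_wpM2l //.
  by rewrite -(mul1r (_ ^-1)) hle ?leq_maxr.
have h11 : h <= 1 by have := hle 0%N isT; rewrite expr0 divr1.
have hs : subtriangle 0 0 h by split; split; lra.
have near (y z : R) : simplex y z -> y <= h -> z <= h ->
    cabs (f (bary a b c y z) - (f a + 0 * (bary a b c y z - 0))) <= 1.
  move=> [y0 z0 _] yh zh; rewrite mul0r addr0; apply: hd; apply: le_lt_trans h2.
  rewrite -[X in _ - X]b0; apply: bary_dist; rewrite subr0 ger0_norm //.
have conv (y y' s : R) : 0 <= s <= 1 -> y <= h -> y' <= h -> y + s * (y' - y) <= h by nra.
have [s1 s2 s3] := hs.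
have hh0 : `|h| <= h by rewrite ger0_norm // ltW.
have n0 : `|0 : R| <= h by rewrite normr0 ltW.
rewrite /bTri; apply: le_trans (@Tri_approx _ f _ _ _ (f a) 0 0 (L * h) 1 _ _ _ _ _ _ _ _ _ _) _;
  try (by apply: (bary_scont fc));
  try (by move=> s hs'; rewrite bary_seg; apply: near; [apply: simplex_conv|apply: conv => //; lra|apply: conv => //; lra]).
- exact: ler01.
- by apply: bary_dist; rewrite ?subrr // addrAC subrr add0r.
- apply: bary_dist; first by rewrite opprD addNKr normrN.
  by rewrite addrAC subrr add0r.
- by apply: bary_dist; rewrite ?subrr // opprD addNKr normrN.
lra.
Qed.

(** The imaginary part of the conjugate of [a] times [b], that is, twice the signed area of the
    triangle 0, [a], [b]. *)
Definition cross a b : R := complex.Re a * complex.Im b - complex.Im a * complex.Re b.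

Lemma Im_div_cross a b : b != 0 -> complex.Im (a / b) = cross b a / cabs b ^+ 2.
Proof.
move=> b0; rewrite cabsE sqr_sqrtr ?addr_ge0 ?sqr_ge0 //; move: b0; rewrite /cross.
case: a => a1 a2; case: b => b1 b2 /= b0.
have n0 : b1 ^+ 2 + b2 ^+ 2 != 0.
  by apply: contra b0; rewrite paddr_eq0 ?sqr_ge0 // !sqrf_eq0 eq_complex.
by field.
Qed.

Lemma pcontZ c (f : R -> C) : pcont f -> pcont (fun s => c * f s).
Proof.
move=> h; apply: pcont_ext (pcont_lin (c - 1) h h) => s _ /=; ring.
Qed.

Lemma pintZ c (f : R -> C) : pcont f -> pint (fun s => c * f s) = c * pint f.
Proof.
move=> h; rewrite (@pint_ext R _ (fun s => (c - 1) * f s + f s)) => [|s _]; last by ring.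
by rewrite pint_lin //; ring.
Qed.

(** The imaginary part of [(b - a) / (w - p)] is [cross (w - p) (b - a)] over the squared modulus of
    [w - p], and this cross product is constant along the segment. So the integrand has a fixed sign
    and is bounded away from zero. *)
Lemma J_inv_Im (p a b : C) e : 0 < e -> cross (a - p) (b - p) != 0 ->
  cabs (a - p) <= e -> cabs (b - p) <= e ->
  scont (fun w => (w - p)^-1) a b /\
  cross (a - p) (b - p) ^+ 2 / e ^+ 2 <=
    cross (a - p) (b - p) * complex.Im (J (fun w => (w - p)^-1) a b).
Proof.
move=> e0; set X := cross _ _ => X0 ha hb.
have segp s : seg a b s - p = (1 - s)%:C * (a - p) + s%:C * (b - p).
  by rewrite /seg rmorphB rmorph1; ring.
have Xs s : cross (seg a b s - p) (b - a) = X.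
  rewrite segp /X /cross; case: (a) => a1 a2; case: (b) => b1 b2; case: (p) => p1 p2 /=; ring.
have y0 s : seg a b s - p != 0.
  by apply: contraNneq X0 => h; rewrite -(Xs s) h /cross /= !mul0r subrr.
have sc : scont (fun w => (w - p)^-1) a b.
  apply: scontP => s hs; apply: cdiff_cont; apply: cdiffV; last exact: y0.
  exact: cdiffB (cdiff_id _) (cdiff_const _ _).
split => //.
rewrite /J -pintZ //; apply: pint_Im_ge; first exact: pcontZ.
move=> s hs; rewrite Im_div_cross // Xs mulrA -expr2.
have yle : cabs (seg a b s - p) <= e.
  rewrite segp; apply: le_trans (cabsD _ _) _; rewrite !cabsM !cabsR !ger0_norm; nra.
rewrite ler_wpM2l ?sqr_ge0 // lef_pV2 ?posrE ?exprn_gt0 ?cabs_gt0 //.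
by rewrite ler_pXn2r ?nnegrE ?cabs_ge0 ?(ltW e0).
Qed.

(** The contour is a diamond: with powers of ['i] as corners, its four sides become a single
    computation. *)
Definition corner (p : C) d (k : nat) : C := p + d%:C * 'i ^+ k.
Definition oint (p : C) d f : C := \sum_(k < 4) J f (corner p d k) (corner p d k.+1).

Section Contour.
Variables (p : C) (d : R).
Hypothesis d0 : 0 < d.
Local Notation corner := (corner p d).
Local Notation oint := (oint p d).

Let cabsi k : cabs ('i ^+ k : C) = 1.
Proof. by rewrite cabsX (_ : cabs 'i = 1) ?expr1n // cabsE /= expr0n add0r expr1n sqrtr1. Qed.

Lemma seg_corner (k : nat) s : seg (corner k) (corner k.+1) s - p = d%:C * 'i ^+ k * ((1 - s) +i* s).
Proof.
rewrite /seg /corner exprS (_ : (1 - s) +i* s = (1 - s)%:C + s%:C * 'i) ?rmorphB ?rmorph1; first by ring.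
by apply/eqP; rewrite eq_complex /=; apply/andP; split; apply/eqP; ring.
Qed.

(** The sharp lower bound is d / sqrt 2; d / 2 comes at once from the larger of the two
    coordinates. *)
Lemma seg_corner_ring (k : nat) s : 0 <= s <= 1 ->
  d / 2 <= cabs (seg (corner k) (corner k.+1) s - p) <= d.
Proof.
move=> hs; rewrite seg_corner !cabsM cabsR cabsi mulr1 gtr0_norm //.
have h1 : cabs ((1 - s) +i* s) <= 1.
  apply: le_trans (cabs_le _) _; rewrite /= !ger0_norm; lra.
have h2 : 1 / 2 <= cabs ((1 - s) +i* s).
  have := Re_le_cabs ((1 - s) +i* s); have := Im_le_cabs ((1 - s) +i* s).
  rewrite /= !ger0_norm; lra.
by have := ler_wpM2l (ltW d0) h1; have := ler_wpM2l (ltW d0) h2; lra.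
Qed.

Lemma corner_diff (k : nat) : cabs (corner k.+1 - corner k) <= 2 * d.
Proof.
rewrite (_ : _ - _ = d%:C * 'i ^+ k.+1 - d%:C * 'i ^+ k); last by rewrite /corner; ring.
by apply: le_trans (cabsB _ _) _; rewrite !cabsM !cabsi cabsR gtr0_norm //; lra.
Qed.

Definition ring_cont f := forall w, d / 2 <= cabs (w - p) <= d -> ccont f w.

Lemma ring_scont f (k : nat) : ring_cont f -> scont f (corner k) (corner k.+1).
Proof. by move=> h; apply: scontP => s /(seg_corner_ring k); apply: h. Qed.

Lemma oint_ext f g : (forall w, d / 2 <= cabs (w - p) <= d -> f w = g w) -> oint f = oint g.
Proof.
move=> h; apply: eq_bigr => k _; apply: J_ext => s /(seg_corner_ring k); exact: h.
Qed.

Lemma oint_lin c f g : ring_cont f -> ring_cont g ->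
  oint (fun w => c * f w + g w) = c * oint f + oint g.
Proof.
move=> hf hg; rewrite /oint mulr_sumr -big_split; apply: eq_bigr => k _ /=.
by rewrite J_lin //; apply: ring_scont.
Qed.

Lemma oint_bound_seg f e : ring_cont f ->
  (forall (k : nat) s, (k < 4)%N -> 0 <= s <= 1 -> cabs (f (seg (corner k) (corner k.+1) s)) <= e) ->
  cabs (oint f) <= 8 * d * e.
Proof.
move=> hf hb.
have e0 : 0 <= e by apply: le_trans (cabs_ge0 _) (hb 0%N 0 isT _); rewrite lexx ler01.
have step (k : nat) : (k < 4)%N -> cabs (J f (corner k) (corner k.+1)) <= 2 * d * e.
  move=> hk; apply: le_trans (J_bound (ring_scont k hf) (fun s => hb k s hk)) _.
  by rewrite ler_wpM2r // corner_diff.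
rewrite /oint !big_ord_recr big_ord0 /= add0r.
apply: le_trans (cabsD _ _) _; apply: le_trans (lerD (cabsD _ _) (lexx _)) _.
apply: le_trans (lerD (lerD (cabsD _ _) (lexx _)) (lexx _)) _.
have := step 0%N isT; have := step 1%N isT; have := step 2%N isT; have := step 3%N isT; lra.
Qed.

Lemma oint_bound f e : ring_cont f ->
  (forall w, d / 2 <= cabs (w - p) <= d -> cabs (f w) <= e) -> cabs (oint f) <= 8 * d * e.
Proof. by move=> hf hb; apply: oint_bound_seg => // k s _ /(seg_corner_ring k); apply: hb. Qed.

(** Consecutive corners have cross product [d ^+ 2] and lie at distance [d] from [p], so [J_inv_Im]
    gives at least 1 for each side. *)
Lemma oint_inv_p : ring_cont (fun w => (w - p)^-1) /\ 4 <= complex.Im (oint (fun w => (w - p)^-1)).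
Proof.
split.
  move=> w hw; apply: cdiff_cont; apply: cdiffV; first exact: cdiffB (cdiff_id _) (cdiff_const _ _).
  by rewrite -cabs_gt0; move: hw; move: (d0); lra.
have step (k : nat) : 1 <= complex.Im (J (fun w => (w - p)^-1) (corner k) (corner k.+1)).
  have cp j : corner j - p = d%:C * 'i ^+ j by rewrite /corner addrAC subrr add0r.
  have X : cross (corner k - p) (corner k.+1 - p) = d ^+ 2.
    have := cabsi k; rewrite cabsE => /(congr1 (fun x : R => x ^+ 2)).
    rewrite sqr_sqrtr ?addr_ge0 ?sqr_ge0 // expr1n => h.
    rewrite !cp exprS /cross; case: ('i ^+ k) h => a1 a2 /= h.
    transitivity (d ^+ 2 * (a1 ^+ 2 + a2 ^+ 2)); last by rewrite h mulr1.
    by ring.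
  have [|||_] := @J_inv_Im p (corner k) (corner k.+1) d d0.
  - by rewrite X expf_neq0 // gt_eqF.
  - by rewrite cp cabsM cabsi cabsR gtr0_norm ?mulr1.
  - by rewrite cp cabsM cabsi cabsR gtr0_norm ?mulr1.
  by rewrite X expr2 mulfK ?expf_neq0 ?gt_eqF // ler_pMr ?exprn_gt0.
rewrite /oint !big_ord_recr big_ord0 /= add0r !ImD.
have := step 0%N; have := step 1%N; have := step 2%N; have := step 3%N; move: (d0); lra.
Qed.

(** The diamond is cut into four triangles with common vertex [z], the only point where
    differentiability may fail, and [Tri_vertex] applies to each. *)
Lemma oint_eq0 f z : cabs (z - p) <= d / 4 ->
  (forall w, cabs (w - p) <= d -> ccont f w) ->
  (forall w, cabs (w - p) <= d -> w != z -> cdiff f w) -> oint f = 0.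
Proof.
move=> hz fc fd.
have cp j : cabs (corner j - p) = d.
  by rewrite /corner addrAC subrr add0r cabsM cabsi cabsR gtr0_norm ?mulr1.
have inball (k : nat) q q' : simplex q q' -> cabs (bary z (corner k) (corner k.+1) q q' - p) <= d.
  move=> [q0 q0' q1].
  rewrite (_ : _ - p = (1 - q - q')%:C * (z - p) + q%:C * (corner k - p) + q'%:C * (corner k.+1 - p)); last first.
    by rewrite /bary !rmorphB rmorph1; ring.
  apply: le_trans (cabsD _ _) _; apply: le_trans (lerD (cabsD _ _) (lexx _)) _.
  by rewrite !cabsM !cabsR !cp !ger0_norm; move: (d0); nra.
have tri (k : nat) : Tri f z (corner k) (corner k.+1) = 0.
  apply: Tri_vertex => q q' hq; first by apply: fc; apply: inball.
  move=> q0; apply: fd; first exact: inball.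
  case: hq => h1 h2 h3; apply/eqP => hbz.
  (* If a point with positive coordinate sum were [z], rescaling its coordinates to sum 1 would put
     [z] on the opposite side, which lies at distance at least [d / 2] from [p]. *)
  have hs : 0 <= q' / (q + q') <= 1.
    by rewrite divr_ge0 ?(ltW q0) // ler_pdivrMr // mul1r; move: (d0); lra.
  have := seg_corner_ring k hs; suff -> : seg (corner k) (corner k.+1) (q' / (q + q')) = z by move: hz; move: (d0); lra.
  have qC : (q + q')%:C != 0 :> C by rewrite -cabs_eq0 cabsR normr_eq0 gt_eqF.
  apply: (mulfI qC); rewrite /seg mulrDr mulrA -rmorphM mulrCA mulfV ?gt_eqF // mulr1.
  move: hbz; rewrite /bary => hbz.
  apply/eqP; rewrite -subr_eq0; apply/eqP; rewrite rmorphD /=.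
  rewrite -[RHS](subrr z) -{2}hbz; ring.
have sc (k : nat) : scont f z (corner k).
  apply: scontP => s hs; apply: fc.
  have := inball k s 0; rewrite /bary mul0r addr0; apply; split; move: (d0); lra.
have fr : ring_cont f by move=> w /andP[_]; apply: fc.
have E (k : nat) : J f (corner k) (corner k.+1) = J f z (corner k.+1) - J f z (corner k).
  have := tri k; rewrite /Tri (J_rev (sc k.+1)) => h.
  by apply/eqP; rewrite -subr_eq0 -[X in _ == X]h; apply/eqP; ring.
rewrite /oint !big_ord_recr big_ord0 /= add0r !E.
have -> : corner 4 = corner 0.
  by rewrite /corner (exprM _ 2 2) sqr_i sqrrN expr1n expr0.
by ring.
Qed.

Definition cint f z : C := oint (fun w => f w / (w - z)).

Lemma ring_far z w : cabs (z - p) <= d / 4 -> d / 2 <= cabs (w - p) <= d -> d / 4 <= cabs (w - z).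
Proof. move=> hz hw; have := cabs_tri z w p; move: (d0); lra. Qed.

Lemma ring_cont_kernel f z n : cabs (z - p) <= d / 4 -> ring_cont f ->
  ring_cont (fun w => f w / (w - z) ^+ n).
Proof.
move=> hz hf w hw.
have h : ccont (fun w => ((w - z) ^+ n)^-1) w.
  apply: cdiff_cont; apply: cdiffV; first by apply: cdiffX; exact: cdiffB (cdiff_id _) (cdiff_const _ _).
  by rewrite expf_neq0 // -cabs_gt0; have := ring_far hz hw; move: (d0); lra.
exact: ccontM (hf w hw) h.
Qed.

(** The divided difference at [z] is continuous there and differentiable elsewhere, so its contour
    integral vanishes. *)
Lemma cauchy_formula f z : cabs (z - p) <= d / 4 -> (forall w, cabs (w - p) <= d -> cdiff f w) ->
  cint f z = f z * cint (fun=> 1) z.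
Proof.
move=> hz hf.
have zin : cabs (z - p) <= d by move: (d0); lra.
have [l hl] := hf z zin.
have g0 : oint (dslope f z l) = 0.
  apply: (@oint_eq0 _ z hz) => [|w hw wz]; last exact: cdiff_dslope_neq wz (hf _ hw).
  move=> w hw; case: (eqVneq w z) => [->|wz]; first exact: ccont_dslope.
  exact: cdiff_cont (cdiff_dslope_neq _ wz (hf _ hw)).
have fr : ring_cont f by move=> w /andP[_ /hf/cdiff_cont].
have r1 : ring_cont (fun w => f w / (w - z)).
  by have := ring_cont_kernel 1 hz fr.
have r2 : ring_cont (fun w => 1 / (w - z)).
  have r2 : ring_cont (fun=> 1) by move=> w _; apply: cdiff_cont; apply: cdiff_const.
  by have := ring_cont_kernel 1 hz r2.
apply/eqP; rewrite -subr_eq0 -g0; apply/eqP; rewrite /cint.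
rewrite addrC -mulNr -oint_lin //; apply: oint_ext => w hw.
have wz : w != z by rewrite -subr_eq0 -cabs_gt0; have := ring_far hz hw; move: (d0); lra.
rewrite /dslope (negbTE wz); ring.
Qed.

Lemma cint_diff_bound f e z z' : ring_cont f ->
  (forall w, d / 2 <= cabs (w - p) <= d -> cabs (f w) <= e) ->
  cabs (z - p) <= d / 4 -> cabs (z' - p) <= d / 4 ->
  cabs (cint f z - cint f z') <= 128 * e * cabs (z - z') / d.
Proof.
move=> hf hb hz hz'.
have r1 : ring_cont (fun w => f w / (w - z)) by have := ring_cont_kernel 1 hz hf.
have r2 : ring_cont (fun w => f w / (w - z')) by have := ring_cont_kernel 1 hz' hf.
rewrite /cint addrC -mulN1r -oint_lin //.
(* The contour has length at most [8 * d], and both [w - z] and [w - z'] have modulus at least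
   [d / 4] on it. *)
have -> : 128 * e * cabs (z - z') / d = 8 * d * (e * cabs (z - z') * (16 / d ^+ 2)).
  by field; rewrite gt_eqF.
apply: oint_bound.
  move=> w hw e1 e10.
  have d01 : 0 < e1 / 2 by rewrite divr_gt0.
  have [x x0 hx] := r1 w hw _ d01; have [y y0 hy] := r2 w hw _ d01.
  exists (Num.min x y); first by rewrite lt_min x0.
  move=> w'; rewrite lt_min => /andP[/hx h1 /hy h2].
  rewrite (_ : _ - _ = (f w' / (w' - z) - f w / (w - z)) - (f w' / (w' - z') - f w / (w - z'))); last by ring.
  by apply: le_trans (cabsB _ _) _; move: (d0); lra.
move=> w hw; have h1 := ring_far hz hw; have h2 := ring_far hz' hw.
have n1 : w - z != 0 by rewrite -cabs_gt0; move: (d0); lra.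
have n2 : w - z' != 0 by rewrite -cabs_gt0; move: (d0); lra.
rewrite (_ : _ + _ = f w * (z - z') * ((w - z) * (w - z'))^-1); last by field; rewrite n1 n2.
rewrite !cabsM ler_pM ?mulr_ge0 ?cabs_ge0 ?ler_wpM2r ?cabs_ge0 ?hb //.
rewrite cabsV cabsM (_ : 16 / d ^+ 2 = (d ^+ 2 / 16)^-1); last by field; rewrite gt_eqF.
rewrite lef_pV2 ?posrE ?mulr_gt0 ?cabs_gt0 ?divr_gt0 ?exprn_gt0 //; move: (d0); nra.
Qed.

(** The modulus is at least 4 at the centre, and a displacement of [d / 256] changes the integral by
    at most 128 / 256. This is the origin of all radii [d / 256] below. *)
Lemma cint1_lower z : cabs (z - p) <= d / 256 -> 1 <= cabs (cint (fun=> 1) z).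
Proof.
move=> hz.
have r1 : ring_cont (fun=> 1) by move=> w _; apply: cdiff_cont; apply: cdiff_const.
have hp : cabs (p - p) <= d / 4 by rewrite subrr cabs0 divr_ge0 // ltW.
have hz4 : cabs (z - p) <= d / 4 by move: (d0); lra.
have b1 w : d / 2 <= cabs (w - p) <= d -> cabs (1 : C) <= 1 by rewrite cabs1.
have := cint_diff_bound r1 b1 hz4 hp; rewrite mulr1.
have -> : 128 * cabs (z - p) / d = 128 * (cabs (z - p) / d) by ring.
have : cabs (z - p) / d <= 1 / 256 by rewrite ler_pdivrMr //; move: (d0); lra.
have := oint_inv_p.2; have -> : oint (fun w => (w - p)^-1) = cint (fun=> 1) p.
  by apply: oint_ext => w _; rewrite mul1r.
have := Im_le_cabs (cint (fun=> 1) p); rewrite ler_norml.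
have := cabs_subl (cint (fun=> 1) p) (cint (fun=> 1) z); rewrite (cabsC (cint _ p) (cint _ z)); move: (d0); lra.
Qed.

End Contour.

End CauchyFormula.

(** * Liouville's theorem, removable singularities, orders of vanishing *)

Section CauchyConsequences.
Variable R : realType.
Local Notation C := (R[i]).
Implicit Types (f g : C -> C) (a b c l w x z p : C) (e d s t : R).

Lemma pcont_bounded (f : R -> C) : pcont f ->
  exists2 M : R, 0 <= M & forall s : R, 0 <= s <= 1 -> cabs (f s) <= M.
Proof.
move=> /fine_exists /(_ ltr01)[n]; elim: n f => [|n IH] f /=.
  move=> h; exists (cabs (f 0) + 1); first by have := cabs_ge0 (f 0); lra.
  move=> s hs; have := h s 0 hs; rewrite lexx ler01 => /(_ isT).
  have := cabs_subl (f s) (f 0); lra.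
move=> [/IH[M M0 hM] /IH[M' M0' hM']]; exists (M + M'); first by rewrite addr_ge0.
move=> s hs; case: (lerP s (1 / 2)) => h.
  have := hM (2 * s); rewrite [2 * s]mulrC mulfK //; lra.
have := hM' (2 * s - 1); rewrite (_ : (1 + (2 * s - 1)) / 2 = s); [lra|by field].
Qed.

Lemma ring_cont_lin p d c f g : ring_cont p d f -> ring_cont p d g ->
  ring_cont p d (fun w => c * f w + g w).
Proof.
move=> hf hg w hw e e0.
have c0 : 0 < cabs c + 1 by have := cabs_ge0 c; lra.
have [d1 d10 h1] := hf w hw _ (divr_gt0 (divr_gt0 e0 (ltr0n _ 2)) c0).
have [d2 d20 h2] := hg w hw _ (divr_gt0 e0 (ltr0n _ 2)).
exists (Num.min d1 d2); rewrite ?lt_min ?d10 // => t; rewrite lt_min => /andP[/h1 a1 /h2 a2].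
rewrite (_ : _ - _ = c * (f t - f w) + (g t - g w)); last by ring.
apply: le_trans (cabsD _ _) _; rewrite cabsM.
rewrite ler_pdivlMr // in a1; have := cabs_ge0 (f t - f w); nra.
Qed.

Definition kint p d (n : nat) f z : C := oint p d (fun w => f w / (w - z) ^+ n).

Section Kernel.
Variables (p : C) (d : R).
Hypothesis d0 : 0 < d.

Lemma ring_bounded f : ring_cont p d f -> exists2 M : R, 0 <= M &
  forall (k : nat) s, (k < 4)%N -> 0 <= s <= 1 -> cabs (f (seg (corner p d k) (corner p d k.+1) s)) <= M.
Proof.
move=> hf.
have [M0 h0 b0] := pcont_bounded (ring_scont d0 0 hf).
have [M1 h1 b1] := pcont_bounded (ring_scont d0 1 hf).
have [M2 h2 b2] := pcont_bounded (ring_scont d0 2 hf).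
have [M3 h3 b3] := pcont_bounded (ring_scont d0 3 hf).
exists (M0 + M1 + M2 + M3); first lra.
move=> [|[|[|[|//]]]] s _ hs; [have := b0 s hs|have := b1 s hs|have := b2 s hs|have := b3 s hs]; lra.
Qed.

(** Differentiation under the integral sign: the last hypothesis is a second-order estimate of the
    kernel, uniform on the contour. *)
Lemma kint_cder (n m : nat) c (B : R) f z : ring_cont p d f -> cabs (z - p) < d / 4 ->
  (forall w z', d / 2 <= cabs (w - p) <= d -> cabs (z' - p) <= d / 4 ->
     cabs (((w - z') ^+ n)^-1 - ((w - z) ^+ n)^-1 - (z' - z) * (c / (w - z) ^+ m))
       <= B * cabs (z' - z) ^+ 2) ->
  cder (kint p d n f) z (c * kint p d m f z).
Proof.
move=> hf hz hB e e0; have [M M0 hM] := ring_bounded hf.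
have B0 : 0 <= `|B| by [].
have K0 : 0 < 8 * d * M * `|B| + 1.
  by have := mulr_ge0 (mulr_ge0 (ltW d0) M0) B0; lra.
exists (Num.min (d / 4 - cabs (z - p)) (e / (8 * d * M * `|B| + 1))).
  by rewrite lt_min subr_gt0 hz divr_gt0.
move=> z'; rewrite lt_min => /andP[h1]; rewrite ltr_pdivlMr // => h2.
have hz' : cabs (z' - p) <= d / 4 by have := cabs_tri z z' p; lra.
have rc k y : cabs (y - p) <= d / 4 -> ring_cont p d (fun w => f w / (w - y) ^+ k).
  by move=> hy; apply: ring_cont_kernel.
have r1 := rc n z' hz'; have r2 := rc n z (ltW hz); have r3 := rc m z (ltW hz).
have aux (X Y Z a : C) : X - Y - c * Z * a = (- (c * a)) * Z + ((-1) * Y + X) by ring.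
rewrite aux.
rewrite /kint -!oint_lin //; last exact: ring_cont_lin.
have E w : - (c * (z' - z)) * (f w / (w - z) ^+ m) + (-1 * (f w / (w - z) ^+ n) + f w / (w - z') ^+ n) =
   f w * (((w - z') ^+ n)^-1 - ((w - z) ^+ n)^-1 - (z' - z) * (c / (w - z) ^+ m)).
  by move: (w - z) (w - z') (z' - z) (f w) => y1 y2 y3 y4; ring.
apply: le_trans (oint_bound_seg d0 (e := M * (`|B| * cabs (z' - z) ^+ 2)) _ _) _.
- by apply: ring_cont_lin => //; apply: ring_cont_lin.
- move=> k s hk hs; rewrite E cabsM ler_pM ?cabs_ge0 ?hM //.
  have hb := hB _ _ (seg_corner_ring p d0 k hs) hz'.
  apply: le_trans hb _.
  by rewrite ler_wpM2r ?exprn_ge0 ?cabs_ge0 // ler_norm.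
have := cabs_ge0 (z' - z); set D := cabs _ in h2 *; nra.
Qed.

Lemma kint_cder1 f z : ring_cont p d f -> cabs (z - p) < d / 4 ->
  cder (cint p d f) z (kint p d 2 f z).
Proof.
move=> hf hz; have := @kint_cder 1 2 1 ((d / 4) ^- 3) f z hf hz; rewrite mul1r; apply.
move=> w z' hw hz'.
have h1 := ring_far d0 hz' hw; have h2 := ring_far d0 (ltW hz) hw.
have n1 : w - z != 0 by rewrite -cabs_gt0; have := d0; lra.
have n2 : w - z' != 0 by rewrite -cabs_gt0; have := d0; lra.
rewrite (_ : _ - _ - _ = (z' - z) ^+ 2 * ((w - z') * (w - z) ^+ 2)^-1); last by field; rewrite n1 n2.
rewrite mulrC cabsM cabsX ler_wpM2r ?exprn_ge0 ?cabs_ge0 // cabsV cabsM cabsX.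
have d4 : 0 < d / 4 by rewrite divr_gt0.
rewrite lef_pV2 ?posrE ?exprn_gt0 ?mulr_gt0 ?cabs_gt0 ?exprn_gt0 ?cabs_gt0 //.
rewrite exprS ler_pM ?exprn_ge0 ?(ltW d4) //.
by rewrite ler_pXn2r // nnegrE ?cabs_ge0 ?(ltW d4).
Qed.

Lemma kint_cder2 f z : ring_cont p d f -> cabs (z - p) < d / 4 ->
  cder (kint p d 2 f) z (2 * kint p d 3 f z).
Proof.
move=> hf hz; apply: (@kint_cder 2 3 2 (6 * d * (d / 4) ^- 5)) => //.
move=> w z' hw hz'.
have h1 := ring_far d0 hz' hw; have h2 := ring_far d0 (ltW hz) hw.
have n1 : w - z != 0 by rewrite -cabs_gt0; have := d0; lra.
have n2 : w - z' != 0 by rewrite -cabs_gt0; have := d0; lra.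
rewrite (_ : _ - _ - _ = (w - z + 2 * (w - z')) * (z' - z) ^+ 2 * ((w - z') ^+ 2 * (w - z) ^+ 3)^-1); last first.
  by field; rewrite n1 n2.
rewrite mulrAC cabsM cabsX ler_wpM2r ?exprn_ge0 ?cabs_ge0 // cabsM cabsV cabsM !cabsX.
have d4 : 0 < d / 4 by rewrite divr_gt0.
apply: ler_pM; rewrite ?cabs_ge0 ?invr_ge0 ?mulr_ge0 ?exprn_ge0 ?cabs_ge0 //.
  apply: le_trans (cabsD _ _) _; rewrite cabsM cabs2.
  have := cabs_tri p w z; have := cabs_tri p w z'; rewrite (cabsC p z) (cabsC p z').
  by have := d0; lra.
rewrite lef_pV2 ?posrE ?exprn_gt0 ?mulr_gt0 ?exprn_gt0 ?cabs_gt0 //.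
rewrite (exprD _ 2 3) ler_pM ?exprn_ge0 ?(ltW d4) //.
  by rewrite ler_pXn2r // nnegrE ?cabs_ge0 ?(ltW d4).
by rewrite ler_pXn2r // nnegrE ?cabs_ge0 ?(ltW d4).
Qed.

Lemma one_ring_cont : ring_cont p d (fun=> 1).
Proof. by move=> w _; apply: cdiff_cont; apply: cdiff_const. Qed.

Lemma cint1_neq0 z : cabs (z - p) <= d / 256 -> cint p d (fun=> 1) z != 0.
Proof. by move=> h; rewrite -cabs_gt0; have := cint1_lower d0 h; lra. Qed.

(* The winding integral [cint 1] is only bounded below, never evaluated, so
   Cauchy's formula is used as a quotient. *)
Lemma cauchy_div f z : cabs (z - p) <= d / 256 -> (forall w, cabs (w - p) <= d -> cdiff f w) ->
  f z = cint p d f z / cint p d (fun=> 1) z.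
Proof.
move=> hz hf; rewrite (cauchy_formula d0 _ hf) ?mulfK ?cint1_neq0 //; have := d0; lra.
Qed.

Lemma cint_bound f z (M : R) : ring_cont p d f -> cabs (z - p) <= d / 4 ->
  (forall (k : nat) s, (k < 4)%N -> 0 <= s <= 1 -> cabs (f (seg (corner p d k) (corner p d k.+1) s)) <= M) ->
  cabs (cint p d f z) <= 32 * M.
Proof.
move=> hf hz hM.
have r1 : ring_cont p d (fun w => f w / (w - z)) := ring_cont_kernel d0 1 hz hf.
apply: le_trans (oint_bound_seg d0 (e := M * (4 / d)) r1 _) _.
  move=> k s hk hs; rewrite cabsM cabsV ler_pM ?invr_ge0 ?cabs_ge0 ?hM //.
  have := ring_far d0 hz (seg_corner_ring p d0 k hs) => h.
  have d4 : 0 < d / 4 by rewrite divr_gt0.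
  rewrite (_ : 4 / d = (d / 4)^-1); last by field; rewrite gt_eqF.
  by rewrite lef_pV2 ?posrE // (lt_le_trans d4).
by rewrite (_ : 8 * d * (M * (4 / d)) = 32 * M) //; field; rewrite gt_eqF.
Qed.

End Kernel.

Lemma ball_ring_cont p d f : (forall w, cabs (w - p) <= d -> cdiff f w) -> ring_cont p d f.
Proof. by move=> h w /andP[_ /h/cdiff_cont]. Qed.

Lemma cnear_closed_ball p (P : C -> Prop) : cnear p P ->
  exists2 d : R, 0 < d & forall w, cabs (w - p) <= d -> P w.
Proof. by move=> [d d0 h]; exists (d / 2); [rewrite divr_gt0 ?ltr0n|move=> w hw; apply: h; lra]. Qed.

Lemma cnear_in_ball p d z : cabs (z - p) < d -> cnear z (fun w => cabs (w - p) < d).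
Proof.
move=> h; exists (d - cabs (z - p)); first by rewrite subr_gt0.
by move=> w hw; have := cabs_tri z w p; lra.
Qed.

(** Near [p] the function is a quotient of two Cauchy integrals, each differentiable twice by
    explicit kernels, so no power series is needed. *)
Lemma cder_cdiff p f (D : C -> C) : cnear p (fun w => cder f w (D w)) -> cdiff D p.
Proof.
move=> /cnear_closed_ball[d d0 h].
have hf w : cabs (w - p) <= d -> cdiff f w by move=> /h; exists (D w).
have rf := ball_ring_cont hf; have r1 := one_ring_cont (p := p) (d := d).
pose h1 := cint p d (fun=> 1); pose A := cint p d f.
pose h2 := kint p d 2 (fun=> 1); pose A2 := kint p d 2 f.
have d256 : 0 < d / 256 by rewrite divr_gt0 ?ltr0n.
have pp : cabs (p - p) < d / 256 by rewrite subrr cabs0.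
have n0 z : cabs (z - p) < d / 256 -> h1 z != 0 by move=> /ltW; apply: cint1_neq0.
have dA z : cabs (z - p) < d / 256 -> cder A z (A2 z) by move=> hz; apply: kint_cder1 => //; lra.
have dh z : cabs (z - p) < d / 256 -> cder h1 z (h2 z) by move=> hz; apply: kint_cder1 => //; lra.
have pp4 : cabs (p - p) < d / 4 by lra.
apply: (@cdiff_near _ (fun z => A2 z / h1 z + A z * (- h2 z / h1 z ^+ 2))).
  exists (d / 256) => // z hz.
  apply: (@cder_unique _ f z); last by apply: h; lra.
  apply: (@cder_near _ (fun w => A w / h1 w)).
    apply: cnear_imp (cnear_in_ball hz) => w /ltW hw.
    by rewrite [RHS](cauchy_div d0 hw hf).
  by apply: cderM; [apply: dA|apply: cderV; [apply: dh|apply: n0]].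
have cA : cdiff A p by exists (A2 p); apply: dA.
have ch : cdiff h1 p by exists (h2 p); apply: dh.
have cA2 : cdiff A2 p by exists (2 * kint p d 3 f p); apply: kint_cder2.
have ch2 : cdiff h2 p by exists (2 * kint p d 3 (fun=> 1) p); apply: kint_cder2.
have np := n0 p pp.
apply: cdiffD; first by apply: cdiffM => //; apply: cdiffV.
apply: cdiffM => //; apply: cdiffM; first exact: cdiffN.
by apply: cdiffV; [apply: cdiffX|rewrite expf_neq0].
Qed.

(** The factor [z - p] can be taken out of the difference of two values of a Cauchy integral, hence
    also of the quotient representing [f]; what is left is differentiable at [p]. *)
Lemma cdiff_dslope p f l : cnear p (cdiff f) -> cder f p l -> cdiff (dslope f p l) p.
Proof.
move=> /cnear_closed_ball[d d0 hf] hl.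
have rf := ball_ring_cont hf; have r1 := one_ring_cont (p := p) (d := d).
pose h := cint p d (fun=> 1); pose A := cint p d f.
have d256 : 0 < d / 256 by rewrite divr_gt0 ?ltr0n.
have pp : cabs (p - p) < d / 256 by rewrite subrr cabs0.
have pp4 : cabs (p - p) < d / 4 by lra.
have rf1 : ring_cont p d (fun w => f w / (w - p)).
  exact: (ring_cont_kernel d0 1 (ltW pp4)).
have r11 : ring_cont p d (fun w => 1 / (w - p)).
  exact: (ring_cont_kernel d0 1 (ltW pp4)).
pose A1 := cint p d (fun w => f w / (w - p)); pose h1 := cint p d (fun w => 1 / (w - p)).
(* This integrates 1/(w - z) - 1/(w - p) = (z - p) / ((w - p)(w - z)). *)
have slope g z : ring_cont p d g -> cabs (z - p) < d / 256 ->
    cint p d g z - cint p d g p = (z - p) * cint p d (fun w => g w / (w - p)) z.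
  move=> hg hz; have hz4 : cabs (z - p) <= d / 4 by lra.
  have r2 : ring_cont p d (fun w => g w / (w - z)) by exact: (ring_cont_kernel d0 1).
  have r3 : ring_cont p d (fun w => g w / (w - p)) by exact: (ring_cont_kernel d0 1 (ltW pp4)).
  have r4 : ring_cont p d (fun w => g w / (w - p) / (w - z)) by exact: (ring_cont_kernel d0 1).
  have r0 : ring_cont p d (fun=> 0) by move=> w _; apply: cdiff_cont; apply: cdiff_const.
  have o0 : oint p d (fun=> 0) = 0.
    have -> : oint p d (fun=> 0 : C) = oint p d (fun w => (-1) * 1 + 1 : C).
      by apply: (oint_ext d0) => w _; ring.
    by rewrite oint_lin //; ring.
  rewrite /cint addrC -mulN1r -oint_lin // -[RHS]addr0 -o0 -oint_lin //.
  apply: (oint_ext d0) => w hw.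
  have n1 : w - p != 0 by rewrite -cabs_gt0; lra.
  have n2 : w - z != 0 by rewrite -cabs_gt0; have := ring_far d0 hz4 hw; lra.
  by field; rewrite n1 n2.
have n0 z : cabs (z - p) < d / 256 -> h z != 0 by move=> /ltW; apply: cint1_neq0.
(* The difference [A z / h z - A p / h p] after cancelling [z - p]. *)
pose G z := (A1 z * h p - A p * h1 z) / (h z * h p).
have cd g : ring_cont p d g -> cdiff (cint p d g) p.
  by move=> hg; exists (kint p d 2 g p); apply: kint_cder1.
have cG : cdiff G p.
  apply: cdiffM.
    apply: cdiffB; first by apply: cdiffM; [apply: cd|apply: cdiff_const].
    by apply: cdiffZ; apply: cd.
  apply: cdiffV; last by rewrite mulf_neq0 ?n0.
  by apply: cdiffM; [apply: cd|apply: cdiff_const].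
have GE z : cabs (z - p) < d / 256 -> z != p -> dslope f p l z = G z.
  move=> hz zp; rewrite /dslope (negbTE zp) /G.
  rewrite (cauchy_div d0 (ltW hz) hf) (cauchy_div d0 (ltW pp) hf) -/A -/h.
  have eA : A z = A p + (z - p) * A1 z by rewrite /A1 -slope // addrC subrK.
  have eh : h z = h p + (z - p) * h1 z by rewrite /h1 -slope // addrC subrK.
  have nz := n0 z hz; have np := n0 p pp.
  have zp0 : z - p != 0 by rewrite subr_eq0.
  rewrite eA; rewrite eh in nz *.
  move: (h p) (A p) (A1 z) (h1 z) (z - p) nz np zp0 => y1 y2 y3 y4 y5 *.
  by field; apply/and3P.
have eql : dslope f p l p = G p.
  apply: ccont_unique (ccont_dslope hl) (cdiff_cont cG) _.
  by exists (d / 256) => // z hz; apply: GE.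
apply: (cdiff_near _ cG); exists (d / 256) => // z hz.
by case: (eqVneq z p) => [->|]; [rewrite eql|move/(GE z hz) ->].
Qed.

(** The classical estimate on large contours bounds the variation of [f] times the winding integral.
    The winding integral is not known to be constant, so its own variation, the case of the function
    1, is subtracted. *)
Lemma liouville f (M : R) : (forall w, cdiff f w) -> (forall w, cabs (f w) <= M) ->
  forall z p, f z = f p.
Proof.
move=> hf hM z p; apply/eqP; rewrite -subr_eq0; apply/eqP/cabs_small => e e0.
have M0 : 0 <= M := le_trans (cabs_ge0 _) (hM p).
pose d := 256 * (M + 1) * (cabs (z - p) + 1) / e + 256 * (cabs (z - p) + 1).
have z0 := cabs_ge0 (z - p).
have dd : 0 < 256 * (M + 1) * (cabs (z - p) + 1) / e by rewrite divr_gt0 ?mulr_gt0 ?ltr0n //; lra.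
have d0 : 0 < d by rewrite /d; lra.
have hz : cabs (z - p) <= d / 4 by rewrite /d; lra.
have hp : cabs (p - p) <= d / 4 by rewrite subrr cabs0; lra.
have hp' : cabs (p - p) <= d / 256 by rewrite subrr cabs0; lra.
have rf := ball_ring_cont (fun w (_ : cabs (w - p) <= d) => hf w).
have r1 := one_ring_cont (p := p) (d := d).
have h1 : cabs (1 : C) <= 1 by rewrite cabs1.
have b1 := cint_diff_bound d0 rf (fun w _ => hM w) hz hp.
have b2 := cint_diff_bound d0 r1 (fun w _ => h1) hz hp.
rewrite !(cauchy_formula d0 _ (fun w _ => hf w)) // in b1.
have b3 := cint1_lower d0 hp'.
move: b1 b2 b3; set H := cint p d (fun=> 1) => b1 b2 b3.
have b4 : cabs (f z - f p) * cabs (H p) <= 256 * M * cabs (z - p) / d.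
  rewrite -cabsM (_ : _ * _ = (f z * H z - f p * H p) - f z * (H z - H p)); last by ring.
  apply: le_trans (cabsB _ _) _; rewrite cabsM.
  have b5 : cabs (f z) * cabs (H z - H p) <= M * (128 * 1 * cabs (z - p) / d).
    by rewrite ler_pM ?cabs_ge0.
  rewrite (_ : 256 * M * cabs (z - p) / d = 128 * M * cabs (z - p) / d + M * (128 * 1 * cabs (z - p) / d)); last by ring.
  exact: lerD.
have b6 : cabs (f z - f p) <= 256 * M * cabs (z - p) / d.
  by apply: le_trans b4; rewrite ler_peMr ?cabs_ge0.
apply: le_trans b6 _; rewrite ler_pdivrMr // mulrC.
have de : 256 * (M + 1) * (cabs (z - p) + 1) <= d * e.
  by rewrite -ler_pdivrMr // /d; lra.
nra.
Qed.

(** Cauchy's formula passes to a uniform limit, and a quotient of Cauchy integrals is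
    differentiable. *)
Lemma uniform_limit_cdiff (u : nat -> C -> C) f p d : 0 < d ->
  (forall n w, cabs (w - p) <= d -> cdiff (u n) w) ->
  (forall e, 0 < e -> exists n, forall w, cabs (w - p) <= d -> cabs (u n w - f w) <= e) ->
  cdiff f p.
Proof.
move=> d0 hu hl.
have cf w : cabs (w - p) < d -> ccont f w.
  move=> hw e e0; have [n hn] := hl _ (divr_gt0 e0 (ltr0n _ 3)).
  have [x x0 hx] := cdiff_cont (hu n w (ltW hw)) (divr_gt0 e0 (ltr0n _ 3)).
  exists (Num.min x (d - cabs (w - p))); first by rewrite lt_min x0 subr_gt0.
  move=> w'; rewrite lt_min => /andP[/hx h1 h2].
  have hw' : cabs (w' - p) <= d by have := cabs_tri w w' p; lra.
  have h3 := hn w (ltW hw); have h4 := hn w' hw'.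
  have := cabs_tri (u n w') (f w') (f w); have := cabs_tri (u n w) (u n w') (f w).
  rewrite (cabsC (f w') (u n w')); lra.
pose k := d / 2; have k0 : 0 < k by rewrite divr_gt0.
have rf : ring_cont p k f by move=> w hw; apply: cf; rewrite /k in hw; lra.
have r1 := one_ring_cont (p := p) (d := k).
have pp4 : cabs (p - p) < k / 4 by rewrite subrr cabs0 divr_gt0.
have E z : cabs (z - p) < k / 256 -> f z = cint p k f z / cint p k (fun=> 1) z.
  move=> hz; have n0 := cint1_neq0 k0 (ltW hz).
  apply: (canRL (mulfK n0)); apply/eqP; rewrite -subr_eq0; apply/eqP/cabs_small => e e0.
  set H := cint p k (fun=> 1) in n0 *.
  have H0 : 0 < cabs (H z) + 32 by have := cabs_ge0 (H z); lra.
  have [n hn] := hl _ (divr_gt0 e0 H0).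
  have hn' w : cabs (w - p) <= k -> cdiff (u n) w by move=> hw; apply: hu; rewrite /k in hw; lra.
  have hz4 : cabs (z - p) <= k / 4 by lra.
  have ru := ball_ring_cont hn'.
  have := cauchy_formula k0 hz4 hn' => hc; rewrite -/H in hc.
  have rd : ring_cont p k (fun w => (-1) * f w + u n w) by apply: ring_cont_lin.
  have hd : cint p k (fun w => (-1) * f w + u n w) z = (-1) * cint p k f z + cint p k (u n) z.
    rewrite /cint -oint_lin //; first by apply: (oint_ext k0) => w _; ring.
      exact: (ring_cont_kernel k0 1).
    exact: (ring_cont_kernel k0 1).
  have hb : cabs (cint p k (fun w => (-1) * f w + u n w) z) <= 32 * (e / (cabs (H z) + 32)).
    apply: cint_bound => // j s _ hs; rewrite mulN1r addrC; apply: hn.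
    by have := seg_corner_ring p k0 j hs; rewrite /k; lra.
  rewrite (_ : _ - _ = (f z - u n z) * H z + ((-1) * cint p k f z + cint p k (u n) z)); last by rewrite hc; ring.
  apply: le_trans (cabsD _ _) _; rewrite -hd cabsM.
  have hzd : cabs (z - p) <= d by rewrite /k in hz; lra.
  have := hn z hzd; rewrite (cabsC (u n z)) => h1.
  have h2 : cabs (f z - u n z) * cabs (H z) <= e / (cabs (H z) + 32) * cabs (H z).
    by rewrite ler_wpM2r ?cabs_ge0.
  have h3 : e = e / (cabs (H z) + 32) * cabs (H z) + 32 * (e / (cabs (H z) + 32)).
    by rewrite [32 * _]mulrC -mulrDr divfK // gt_eqF.
  by rewrite [X in _ <= X]h3 lerD.
apply: (@cdiff_near _ (fun z => cint p k f z / cint p k (fun=> 1) z)).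
  by exists (k / 256); [rewrite divr_gt0 ?ltr0n|move=> z /E].
apply: cdiffM; first by exists (kint p k 2 f p); apply: kint_cder1.
apply: cdiffV; last by apply: cint1_neq0; rewrite // subrr cabs0 divr_ge0 ?ler0n ?ltW.
by exists (kint p k 2 (fun=> 1) p); apply: kint_cder1.
Qed.

(** If [f] is divisible by every power of [w - p], the n-th quotient is at most M / (d/2)^n on the
    contour, hence at most 32 times this inside. As [z] is within d / 4 of [p], [f z] is at most 32
    M / 2^n for all n. *)
Lemma cdiff_order p f : cnear p (cdiff f) ->
  cnear p (fun w => f w = 0) \/
  exists (k : nat) g, [/\ cnear p (cdiff g), g p != 0 & cnear p (fun w => f w = (w - p) ^+ k * g w)].
Proof.
move=> /cnear_closed_ball[d d0 hf].
have [[k [g [g1 g2 g3]]]|hno] := pselect (exists (k : nat) g, [/\ (forall w, cabs (w - p) <= d -> cdiff g w),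
   g p != 0 & forall w, cabs (w - p) <= d -> f w = (w - p) ^+ k * g w]).
  right; exists k, g; split => //; exists d => // w /ltW; [exact: g1|exact: g3].
left.
have P k : exists g, (forall w, cabs (w - p) <= d -> cdiff g w) /\
    forall w, cabs (w - p) <= d -> f w = (w - p) ^+ k * g w.
  elim: k => [|k [g [h1 h2]]]; first by exists f; split => // w _; rewrite expr0 mul1r.
  have gp : g p = 0.
    by apply/eqP; apply: contrapT => /negP hg; apply: hno; exists k, g.
  have pp : cabs (p - p) <= d by rewrite subrr cabs0 ltW.
  have [l hl] := h1 _ pp.
  exists (dslope g p l); split => w hw.
    case: (eqVneq w p) => [->|wp]; last exact: cdiff_dslope_neq (h1 _ hw).
    by apply: cdiff_dslope => //; exists d => // x /ltW; apply: h1.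
  by rewrite (h2 _ hw) (dslopeE g p l w) gp add0r exprSr mulrA.
have [M M0 hM] := ring_bounded d0 (ball_ring_cont hf).
exists (d / 256) => [|z hz]; first by rewrite divr_gt0 ?ltr0n.
apply: cabs_small => e e0; have [n hn] := pow2_small (32 * M) e0.
have [g [h1 h2]] := P n.
have hz4 : cabs (z - p) <= d / 4 by lra.
have hzd : cabs (z - p) <= d by lra.
have rg := ball_ring_cont h1.
have hb (k : nat) s : (k < 4)%N -> 0 <= s <= 1 ->
    cabs (g (seg (corner p d k) (corner p d k.+1) s)) <= M / (d / 2) ^+ n.
  move=> hk hs; have /andP[q1 q2] := seg_corner_ring p d0 k hs.
  have := hM k s hk hs; rewrite (h2 _ q2) cabsM cabsX => h.
  have d2 : 0 < d / 2 by rewrite divr_gt0.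
  rewrite ler_pdivlMr ?exprn_gt0 // mulrC; apply: le_trans h.
  by rewrite ler_wpM2r ?cabs_ge0 // lerXn2r ?nnegrE ?cabs_ge0 ?(ltW d2).
have := cint_bound d0 rg hz4 hb; rewrite (cauchy_formula d0 hz4 h1) cabsM => h3.
have h4 := cint1_lower d0 (ltW hz).
have h5 : cabs (g z) <= 32 * (M / (d / 2) ^+ n).
  by apply: le_trans h3; rewrite ler_peMr ?cabs_ge0.
apply: le_trans (ltW hn); rewrite (h2 _ hzd) cabsM cabsX.
have h6 : cabs (z - p) ^+ n <= (d / 4) ^+ n by rewrite lerXn2r ?nnegrE ?cabs_ge0 ?divr_ge0 ?(ltW d0).
apply: le_trans (ler_pM _ _ h6 h5) _; rewrite ?exprn_ge0 ?cabs_ge0 //.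
rewrite le_eqVlt; apply/orP; left; apply/eqP.
have -> : d / 4 = d / 2 * 2^-1 by field.
rewrite exprMn exprVn; field; rewrite expf_neq0 // expf_neq0 //.
by rewrite mulf_neq0 ?gt_eqF // invr_neq0.
Qed.

(** Local extensions are glued by evaluating the one centred at [w] at [w] itself; two of them agree
    where both are defined because they are continuous and equal to [F] off their centres. *)
Lemma removable (F : C -> C) :
  (forall p, exists2 g, cnear p (cdiff g) & cpnear p (fun w => F w = g w)) ->
  exists2 G : C -> C, (forall p, cdiff G p) &
    forall p, cpnear p (fun w => F w = G w) /\ (ccont F p -> F p = G p).
Proof.
move=> h; have /choice[g hg] : forall p, exists g, cnear p (cdiff g) /\ cpnear p (fun w => F w = g w).
  by move=> p; have [g ? ?] := h p; exists g.
have gc p : cdiff (g p) p by case: (hg p) => /cnear_at.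
have near p : cnear p (fun w => g p w = g w w).
  have [[x x0 hx] [y y0 hy]] := hg p.
  exists (Num.min x y); first by rewrite lt_min x0.
  move=> w; rewrite lt_min => /andP[h1 h2]; case: (eqVneq w p) => [-> //|wp].
  have [_ h3] := hg w.
  apply: ccont_unique (cdiff_cont (hx w h1)) (cdiff_cont (gc w)) _.
  have e1 : cpnear w (fun v => F v = g p v).
    apply: cpnear_imp (cpnearI (cnear_pnear (cnear_in_ball h2)) (cpnear_other (z := w) (x := p) _)).
      by move=> v [? ?]; apply: hy.
    by rewrite eq_sym.
  by apply: cpnear_imp (cpnearI e1 h3) => v [<- <-].
exists (fun w => g w w) => p; first exact: cdiff_near (near p) (gc p).
have [_ h2] := hg p; split.
  by apply: cpnear_imp (cpnearI h2 (cnear_pnear (near p))) => v [-> ->].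
by move=> hF; apply: ccont_unique hF (cdiff_cont (gc p)) h2.
Qed.

End CauchyConsequences.

(** * Passage between epsilon-delta notions and filter limits *)

Section Bridge.
Local Open Scope classical_set_scope.
Variable R : realType.
Local Notation C := (R[i]).
Implicit Types (f g : C -> C) (a b c l w x z p : C) (e d s t : R).

Lemma nbhs_cnear p (P : C -> Prop) : (\forall w \near p, P w) <-> cnear p P.
Proof.
split.
  move=> /nbhs_normP[e /= e0 h].
  have [a ea] : exists a : R, e = a%:C by exists (complex.Re e); rewrite RRe_real // gtr0_real.
  exists a; first by rewrite -ltcR -ea.
  by move=> w hw; apply: h; rewrite /= distrC normE ea ltcR.
move=> [d d0 h]; apply/nbhs_normP; exists d%:C; first by rewrite /= ltcR.
by move=> w /=; rewrite distrC normE ltcR; apply: h.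
Qed.

Lemma dnbhs_cpnear p (P : C -> Prop) : (\forall w \near p^', P w) <-> cpnear p P.
Proof.
split.
  by move=> /nbhs_cnear[d d0 h]; exists d => // w /h.
by move=> [d d0 h]; apply/nbhs_cnear; exists d => // w /h.
Qed.

Lemma ctends_cvg (u : nat -> C) l : ctends u l -> u @ \oo --> l.
Proof.
move=> h; apply/cvgrPdist_le => e e0.
have ea : e = (complex.Re e)%:C by rewrite RRe_real // gtr0_real.
have [|n0 hn] := h (complex.Re e); first by rewrite -ltcR -ea.
by exists n0 => // n /= hh; rewrite distrC normE ea lecR; apply: hn.
Qed.

Lemma ctends_lim (u : nat -> C) l : ctends u l -> lim (u @ \oo) = l.
Proof. by move=> /ctends_cvg/cvg_lim; apply; exact: norm_hausdorff. Qed.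

Lemma cder_cvg f z l : cder f z l <-> (fun h => (f (z + h) - f z) / h) @ (0 : C)^' --> l.
Proof.
split.
  move=> hl; apply/cvgrPdist_le => e e0.
  have ea : e = (complex.Re e)%:C by rewrite RRe_real // gtr0_real.
  have [|d d0 hd] := hl (complex.Re e); first by rewrite -ltcR -ea.
  apply/dnbhs_cpnear; exists d => // h; rewrite subr0 => h1 h0.
  rewrite distrC normE ea lecR (_ : _ - l = (f (z + h) - f z - l * h) / h); last by field.
  rewrite cabsM cabsV ler_pdivrMr ?cabs_gt0 //.
  by have := hd (z + h); rewrite addrAC subrr add0r; apply.
move=> /cvgrPdist_le hl e e0.
have [|d d0 hd] := (dnbhs_cpnear _ _).1 (hl e%:C _); first by rewrite ltcR.
exists d => // w hw; case: (eqVneq w z) => [->|wz].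
  by rewrite !subrr mulr0 subr0 cabs0 mulr0.
have wz0 : w - z != 0 by rewrite subr_eq0.
have := hd (w - z); rewrite subr0 => /(_ hw wz0); rewrite distrC normE lecR (_ : z + (w - z) = w); last by ring.
move=> h.
rewrite (_ : _ - _ - _ = ((f w - f z) / (w - z) - l) * (w - z)); last by field.
by rewrite cabsM ler_wpM2r ?cabs_ge0.
Qed.

Lemma holo_atP f z : holo_at f z <-> cdiff f z.
Proof. by split=> -[l hl]; exists l; apply/cder_cvg. Qed.

Lemma cder_lim f z l : cder f z l -> lim ((fun h : C => (f (z + h) - f z) / h) @ (0 : C)^') = l.
Proof. by move=> /cder_cvg/cvg_lim; apply; exact: norm_hausdorff. Qed.

Lemma mero_atP f p : mero_at f p <->
  exists (k : nat) g, cnear p (cdiff g) /\ cpnear p (fun w => f w = g w / (w - p) ^+ k).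
Proof.
split=> -[k [g [h1 h2]]]; exists k, g; split.
- by move/nbhs_cnear: h1; apply: cnear_imp => w /holo_atP.
- exact/dnbhs_cpnear.
- by apply/nbhs_cnear; apply: cnear_imp h1 => w /holo_atP.
- exact/dnbhs_cpnear.
Qed.

End Bridge.

(** * Orders and leading coefficients of poles at the origin *)

Section Poles.
Variable R : realType.
Local Notation C := (R[i]).
Implicit Types (f g : C -> C) (a b c l w x z p : C) (k : nat).

(* [f = c z^-k + c' z^-(k-1) + ...] near the origin; [c = 0] is allowed. *)
Definition pole k c f := exists g, [/\ cnear 0 (cdiff g), g 0 = c &
  cpnear 0 (fun w => f w = g w / w ^+ k)].

Lemma cnear_all p (P : C -> Prop) : (forall w, P w) -> cnear p P.
Proof. by move=> h; exists 1. Qed.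

Lemma pole_ext k c f g : cpnear 0 (fun w => f w = g w) -> pole k c f -> pole k c g.
Proof.
move=> h [u [u1 u2 u3]]; exists u; split => //.
by apply: cpnear_imp (cpnearI h u3) => w [<-].
Qed.

Lemma poleM k m a b f g : pole k a f -> pole m b g -> pole (k + m) (a * b) (fun w => f w * g w).
Proof.
move=> [u [u1 u2 u3]] [v [v1 v2 v3]]; exists (fun w => u w * v w); split.
- by apply: cnear_imp (cnearI u1 v1) => w [? ?]; apply: cdiffM.
- by rewrite u2 v2.
by apply: cpnear_imp (cpnearI u3 v3) => w [-> ->]; rewrite exprD invfM; ring.
Qed.

Lemma pole_lin k a b c f g : pole k a f -> pole k b g -> pole k (c * a + b) (fun w => c * f w + g w).
Proof.
move=> [u [u1 u2 u3]] [v [v1 v2 v3]]; exists (fun w => c * u w + v w); split.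
- by apply: cnear_imp (cnearI u1 v1) => w [? ?]; apply: cdiffD => //; apply: cdiffZ.
- by rewrite u2 v2.
by apply: cpnear_imp (cpnearI u3 v3) => w [-> ->]; ring.
Qed.

Lemma pole_raise k c f : pole k c f -> pole k.+1 0 f.
Proof.
move=> [u [u1 u2 u3]]; exists (fun w => w * u w); split; last 2 first.
- by rewrite mul0r.
- have h1 : cpnear (0 : C) (fun w => w != 0) by exists 1.
  apply: cpnear_imp (cpnearI h1 u3) => w [w0 ->]; rewrite exprS invfM mulrACA mulfV // mul1r //.
by apply: cnear_imp u1 => w h; apply: cdiffM => //; apply: cdiff_id.
Qed.

Lemma pole_drop k f : pole k.+1 0 f -> exists c, pole k c f.
Proof.
move=> [u [u1 u2 u3]]; have [l hl] := cnear_at u1.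
exists l, (dslope u 0 l); split; last 2 first.
- exact: dslope_at.
- have h1 : cpnear (0 : C) (fun w => w != 0) by exists 1.
  apply: cpnear_imp (cpnearI h1 u3) => w [w0 ->].
  rewrite (dslopeE u 0 l w) u2 add0r subr0 exprS invfM mulrACA mulfV // mul1r //.
have [d d0 hd] := u1; exists d => // w hw; case: (eqVneq w 0) => [->|w0].
  exact: cdiff_dslope.
by apply: cdiff_dslope_neq => //; apply: hd.
Qed.

Lemma cderX n z : cder (fun w : C => w ^+ n.+1) z (n.+1%:R * z ^+ n).
Proof.
elim: n => [|n IH]; first by rewrite expr0 mulr1; under eq_fun do rewrite expr1; apply: cder_id.
have -> : n.+2%:R * z ^+ n.+1 = 1 * z ^+ n.+1 + z * (n.+1%:R * z ^+ n).
  by rewrite -natr1 exprS; ring.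
by under eq_fun do rewrite exprS; apply: cderM => //; apply: cder_id.
Qed.

(** The derivative of u / w^k is (w u' - k u) / w^(k+1); the numerator is differentiable because u'
    is. *)
Lemma pole_der k c f (D : C -> C) : pole k c f -> cpnear 0 (fun w => cder f w (D w)) ->
  pole k.+1 (- k%:R * c) D.
Proof.
move=> [u [u1 u2 u3]] h.
have [D1 hD1] : exists D1, cnear 0 (fun w => cder u w (D1 w)).
  have /choice[D1 h1] : forall w, exists l, cdiff u w -> cder u w l.
    by move=> w; have [[l hl]|no] := pselect (cdiff u w); [exists l|exists 0].
  by exists D1; apply: cnear_imp u1 => w /h1.
exists (fun w => w * D1 w - k%:R * u w); split.
- apply: cnear_imp (cnearI u1 (cnear_open hD1)) => w [hu /cder_cdiff hd].
  by apply: cdiffB; [apply: cdiffM => //; apply: cdiff_id|apply: cdiffZ].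
- by rewrite u2 mul0r sub0r mulNr.
have h1 : cpnear (0 : C) (fun w => w != 0) by exists 1.
have u4 : cpnear 0 (fun w => cnear w (fun v => f v = u v / v ^+ k)).
  exact: cpnear_open u3.
apply: cpnear_imp (cpnearI (cpnearI h1 h) (cpnearI u4 (cnear_pnear hD1))) => w [[w0 hw] [e1 hd]].
apply: cder_unique hw _; apply: cder_near (cnear_imp _ e1) _ => [v h2|]; first by symmetry; exact: h2.
case: k {u3 u4 e1} => [|k].
  rewrite expr1 mul0r subr0 mulrC mulKf //.
  by apply: cder_near hd; apply: cnear_all => v; rewrite expr0 divr1.
have wk : w ^+ k.+1 != 0 by rewrite expf_neq0.
have := cderM hd (cderV (cderX k w) wk).
have -> : D1 w * (w ^+ k.+1)^-1 + u w * (- (k.+1%:R * w ^+ k) / w ^+ k.+1 ^+ 2) =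
  (w * D1 w - k.+1%:R * u w) / w ^+ k.+2; last by [].
by rewrite !exprS; field; rewrite w0 expf_neq0.
Qed.

Lemma poleZ k c a f : pole k c f -> pole k (a * c) (fun w => a * f w).
Proof.
move=> [u [u1 u2 u3]]; exists (fun w => a * u w); split.
- by apply: cnear_imp u1 => w; apply: cdiffZ.
- by rewrite u2.
- by apply: cpnear_imp u3 => w ->; rewrite mulrA.
Qed.

Lemma pole0_cdiff f : cnear 0 (cdiff f) -> pole 0 (f 0) f.
Proof. by move=> h; exists f; split => //; exists 1 => // w _ _; rewrite expr0 divr1. Qed.

Lemma mero_pole f : mero_at f 0 -> exists k c, pole k c f.
Proof.
move=> /mero_atP[k [u [u1 u2]]]; exists k, (u 0), u; split => //.
by apply: cpnear_imp u2 => w ->; rewrite subr0.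
Qed.

Lemma poleX k c f n : pole k c f -> pole (n * k) (c ^+ n) (fun w => f w ^+ n).
Proof.
move=> h; elim: n => [|n IH].
  by apply: (pole_ext _ (@pole0_cdiff (fun=> 1) _)); [exists 1|apply: cnear_all => w; apply: cdiff_const].
rewrite mulSn exprS; apply: pole_ext (poleM h IH).
by exists 1 => // w _ _; rewrite exprS.
Qed.

End Poles.

(** * Lattice sums *)

Section LatticeSums.
Variable R : realType.
Local Notation C := (R[i]).
Implicit Types (f g : C -> C) (a b c l w x z p : C) (m n : int) (k K : nat).

(** The range -K, ..., K with the indexing of [wp_partial]. *)
Definition rowsum (g : int -> C) K : C := \sum_(i < (K + K).+1) g (i%:Z - K%:Z).
Definition sqsum (F : int -> int -> C) K : C := rowsum (fun m => rowsum (F m) K) K.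

Lemma rowsumS (g : int -> C) K :
  rowsum g K.+1 = g (- K.+1%:Z) + rowsum g K + g K.+1%:Z.
Proof.
rewrite /rowsum addSn addnS big_ord_recl big_ord_recr /= sub0r addrA.
congr (_ + _ + _); last by congr g; rewrite /bump /=; lia.
by apply: eq_bigr => i _; congr g; rewrite /bump /=; lia.
Qed.

Lemma rowsum_shift (g : int -> C) K :
  rowsum (fun m => g (m + 1)) K = rowsum g K - g (- K%:Z) + g K.+1%:Z.
Proof.
rewrite /rowsum [in LHS]big_ord_recr [in RHS]big_ord_recl /= sub0r [g _ + _]addrC addrK.
congr (_ + _); last by congr g; lia.
by apply: eq_bigr => i _; congr g; rewrite /bump /=; lia.
Qed.

Lemma rowsum_opp (g : int -> C) K : rowsum (fun m => g (- m)) K = rowsum g K.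
Proof.
rewrite /rowsum [RHS](reindex_inj rev_ord_inj) /=.
by apply: eq_bigr => i _; congr g; have := ltn_ord i; rewrite /=; lia.
Qed.

Lemma rowsum_lin a (g h : int -> C) K :
  rowsum (fun m => a * g m + h m) K = a * rowsum g K + rowsum h K.
Proof. by rewrite /rowsum mulr_sumr -big_split. Qed.

Lemma rowsum_ext (g h : int -> C) K : (forall m, (absz m <= K)%N -> g m = h m) -> rowsum g K = rowsum h K.
Proof. by move=> e; apply: eq_bigr => i _; apply: e; have := ltn_ord i; lia. Qed.

Lemma rowsum_bound (g : int -> C) K (B : R) :
  (forall m, (absz m <= K)%N -> cabs (g m) <= B) -> cabs (rowsum g K) <= (K + K).+1%:R * B.
Proof.
rewrite /rowsum => h; have hb (i : 'I_(K + K).+1) : cabs (g (i%:Z - K%:Z)) <= B.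
  by apply: h; have := ltn_ord i; lia.
move: hb; move: {h} ((K + K).+1) => n.
elim: n => [|n IH] hb; first by rewrite big_ord0 cabs0 mul0r.
rewrite big_ord_recr /= -natr1 mulrDl mul1r; apply: le_trans (cabsD _ _) (lerD _ _).
  by apply: IH => i; apply: (hb (widen_ord (leqnSn n) i)).
exact: (hb ord_max).
Qed.

Lemma sqsum_lin a (F G : int -> int -> C) K :
  sqsum (fun m n => a * F m n + G m n) K = a * sqsum F K + sqsum G K.
Proof. by rewrite /sqsum -rowsum_lin; apply: rowsum_ext => m _; rewrite rowsum_lin. Qed.

Lemma sqsum_ext (F G : int -> int -> C) K : (forall m n, F m n = G m n) -> sqsum F K = sqsum G K.
Proof. by move=> e; apply: rowsum_ext => m _; apply: rowsum_ext. Qed.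

Lemma sqsum_swap (F : int -> int -> C) K : sqsum (fun m n => F n m) K = sqsum F K.
Proof. by rewrite /sqsum /rowsum exchange_big. Qed.

Lemma sqsum_opp (F : int -> int -> C) K : sqsum (fun m n => F (- m) (- n)) K = sqsum F K.
Proof.
rewrite /sqsum -[RHS](rowsum_opp _ K); apply: rowsum_ext => m _.
by rewrite -(rowsum_opp (F (- m))).
Qed.

Definition off0 (F : int -> int -> C) m n : C := if (m == 0) && (n == 0) then 0 else F m n.

Lemma rowsum_pt0 a K : rowsum (fun m => if m == 0 then a else 0) K = a.
Proof.
elim: K => [|K IH]; first by rewrite /rowsum big_ord_recr big_ord0 /= add0r.
by rewrite rowsumS IH oppr_eq0 /= add0r addr0.
Qed.

Lemma sqsum_off0 (F : int -> int -> C) K : sqsum F K = F 0 0 + sqsum (off0 F) K.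
Proof.
rewrite (@sqsum_ext F (fun m n => 1 * (if m == 0 then (if n == 0 then F 0 0 else 0) else 0) + off0 F m n)).
  rewrite sqsum_lin mul1r; congr (_ + _).
  rewrite /sqsum -[RHS](rowsum_pt0 _ K); apply: rowsum_ext => m _.
  case: eqP => _; first exact: rowsum_pt0.
  by rewrite -[RHS](rowsum_pt0 0 K); apply: rowsum_ext => n _; case: ifP.
move=> m n; rewrite /off0; case: (eqVneq m 0) => [->|_] /=; case: (eqVneq n 0) => [->|_]; ring.
Qed.

(** The added shell has 8(K+1) points: two lines of 2K+3 and two of 2K+1. *)
Lemma sqsum_step (F : int -> int -> C) K (B : R) :
  (forall m n, maxn (absz m) (absz n) = K.+1 -> cabs (F m n) <= B) ->
  cabs (sqsum F K.+1 - sqsum F K) <= 8 * K.+1%:R * B.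
Proof.
move=> h.
have E : sqsum F K.+1 - sqsum F K = rowsum (F (- K.+1%:Z)) K.+1 + rowsum (F K.+1%:Z) K.+1
   + (rowsum (fun m => F m (- K.+1%:Z)) K + rowsum (fun m => F m K.+1%:Z) K).
  rewrite {1}/sqsum rowsumS.
  rewrite (@rowsum_ext (fun m => rowsum (F m) K.+1) (fun m => 1 * rowsum (F m) K + (1 * F m (- K.+1%:Z) + F m K.+1%:Z))).
    by rewrite !rowsum_lin /sqsum; ring.
  by move=> m _; rewrite rowsumS; ring.
rewrite E; apply: le_trans (cabsD _ _) _.
apply: le_trans (lerD (cabsD _ _) (cabsD _ _)) _.
have h1 : cabs (rowsum (F (- K.+1%:Z)) K.+1) <= (K.+1 + K.+1).+1%:R * B.
  by apply: rowsum_bound => m hm; apply: h; lia.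
have h2 : cabs (rowsum (F K.+1%:Z) K.+1) <= (K.+1 + K.+1).+1%:R * B.
  by apply: rowsum_bound => m hm; apply: h; lia.
have h3 : cabs (rowsum (fun m => F m (- K.+1%:Z)) K) <= (K + K).+1%:R * B.
  by apply: rowsum_bound => m hm; apply: h; lia.
have h4 : cabs (rowsum (fun m => F m K.+1%:Z) K) <= (K + K).+1%:R * B.
  by apply: rowsum_bound => m hm; apply: h; lia.
have e1 : (K.+1 + K.+1).+1%:R = 2 * K.+1%:R + 1 :> R by rewrite -[LHS]natr1 natrD; ring.
have e2 : (K + K).+1%:R = 2 * K.+1%:R - 1 :> R by rewrite -!natr1 natrD; ring.
rewrite e1 in h1 h2; rewrite e2 in h3 h4.
have := lerD (lerD h1 h2) (lerD h3 h4).
have -> : (2 * K.+1%:R + 1) * B + (2 * K.+1%:R + 1) * B + ((2 * K.+1%:R - 1) * B + (2 * K.+1%:R - 1) * B) = 8 * K.+1%:R * B by ring.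
exact: le_trans.
Qed.

Definition cubic_decay (F : int -> int -> C) (M : R) (K0 : nat) :=
  forall m n, (K0 <= maxn (absz m) (absz n))%N -> (0 < maxn (absz m) (absz n))%N ->
    cabs (F m n) <= M / (maxn (absz m) (absz n))%:R ^+ 3.

Lemma sqsum_cauchy F (M : R) K0 K L : 0 <= M -> cubic_decay F M K0 -> (K0 <= K)%N -> (0 < K)%N -> (K <= L)%N ->
  cabs (sqsum F L - sqsum F K) <= 8 * M / K%:R.
Proof.
move=> M0 hF h0 hK hL.
(* The shell of radius k+1 contributes at most 8M/(k+1)^2, which is below the telescoping term 8M/k
   - 8M/(k+1). *)
suff : cabs (sqsum F L - sqsum F K) <= 8 * M / K%:R - 8 * M / L%:R.
  by move=> /le_trans; apply; rewrite gerBl divr_ge0 // mulr_ge0.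
rewrite -(subnK hL); elim: (L - K)%N => [|j IH]; first by rewrite add0n !subrr cabs0.
rewrite addSn; set k := (j + K)%N in IH *.
have k0 : (0 < k)%N by rewrite /k; lia.
have kR : 0 < k%:R :> R by rewrite ltr0n.
have k1R : 0 < k.+1%:R :> R by rewrite ltr0n.
have st : cabs (sqsum F k.+1 - sqsum F k) <= 8 * k.+1%:R * (M / k.+1%:R ^+ 3).
  by apply: sqsum_step => m n e; rewrite -e; apply: hF; rewrite e // /k; lia.
have -> : sqsum F k.+1 - sqsum F K = (sqsum F k.+1 - sqsum F k) + (sqsum F k - sqsum F K) by ring.
apply: le_trans (cabsD _ _) _; apply: le_trans (lerD st IH) _.
have e1 : 8 * k.+1%:R * (M / k.+1%:R ^+ 3) = 8 * M / k.+1%:R ^+ 2 by field; rewrite gt_eqF.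
have e2 : 8 * M / k%:R - 8 * M / k.+1%:R = 8 * M / (k%:R * k.+1%:R).
  have aux (x : R) : 0 < x -> 8 * M / x - 8 * M / (x + 1) = 8 * M / (x * (x + 1)).
    by move=> x0; field; rewrite !gt_eqF //; lra.
  by rewrite -(natr1 k) aux.
have : 8 * M / k.+1%:R ^+ 2 <= 8 * M / (k%:R * k.+1%:R).
  rewrite ler_wpM2l ?mulr_ge0 // lef_pV2 ?posrE ?exprn_gt0 ?mulr_gt0 //.
  by rewrite expr2 ler_pM2r // ler_nat.
by rewrite e1 -e2 => h; apply: le_trans (lerD h (lexx _)) _; rewrite addrC subrKA.
Qed.

Lemma sqsum_cvg F (M : R) K0 : 0 <= M -> cubic_decay F M K0 ->
  exists2 s, ctends (sqsum F) s &
   forall K, (K0 <= K)%N -> (0 < K)%N -> cabs (sqsum F K - s) <= 8 * M / K%:R.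
Proof.
move=> M0 hF.
have [|s hs] := @complex_complete R (sqsum F).
  move=> e e0; pose n := (maxn K0 (Num.truncn (8 * M / e)).+1).
  exists n => L hL; have n0 : (0 < n)%N by rewrite /n; lia.
  apply: le_trans (sqsum_cauchy M0 hF _ n0 hL) _; first by rewrite /n; lia.
  have h : 8 * M / e < n%:R.
    by apply: lt_le_trans (truncnS_gt _) _; rewrite ler_nat /n leq_maxr.
  by rewrite ler_pdivrMr ?ltr0n // -ler_pdivrMl // mulrC ltW.
exists s => // K h1 h2; apply/ler_addgt0Pr => e e0; have [n0 hn] := hs e e0.
have := hn _ (leq_maxr K n0); have := sqsum_cauchy M0 hF h1 h2 (leq_maxl K n0).
by have := cabs_tri (sqsum F (maxn K n0)) (sqsum F K) s; rewrite (cabsC (sqsum F K) (sqsum F (maxn K n0))); lra.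
Qed.

(** Translating the square exchanges one boundary line for another. With cubic decay both are
    negligible, so limits of square sums are invariant under translation of the lattice. *)
Lemma sqsum_shift F K (B : R) :
  (forall m n, maxn (absz m) (absz n) = K \/ maxn (absz m) (absz n) = K.+1 -> cabs (F m n) <= B) ->
  cabs (sqsum (fun m n => F (m + 1) n) K - sqsum F K) <= 2 * (K + K).+1%:R * B.
Proof.
move=> h; rewrite /sqsum (rowsum_shift (fun m => rowsum (F m) K)).
rewrite (_ : _ - _ = rowsum (F K.+1%:Z) K - rowsum (F (- K%:Z)) K); last by ring.
apply: le_trans (cabsB _ _) _.
rewrite -mulrA mulrDl mul1r; apply: lerD.
  by apply: rowsum_bound => m hm; apply: h; right; lia.
by apply: rowsum_bound => m hm; apply: h; left; lia.
Qed.

End LatticeSums.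

(** * Geometry of a lattice and convergence of sums over it *)

Section Lattice.
Variable R : realType.
Local Notation C := (R[i]).
Implicit Types (f g : C -> C) (a b c l w x z p : C) (m n : int) (k K : nat).

Lemma crossD a b c : cross a (b + c) = cross a b + cross a c.
Proof. by rewrite /cross ReD ImD; ring. Qed.

Lemma crossZ a (s : R) b : cross a (s%:C * b) = s * cross a b.
Proof. by rewrite /cross; case: b => b1 b2 /=; ring. Qed.

Lemma crossC a b : cross a b = - cross b a.
Proof. by rewrite /cross; ring. Qed.

Lemma crossxx a : cross a a = 0.
Proof. by rewrite /cross; ring. Qed.

Lemma cross_bound a b : `|cross a b| <= 2 * cabs a * cabs b.
Proof.
rewrite /cross; apply: le_trans (ler_normB _ _) _; rewrite !normrM.
have := Re_le_cabs a; have := Re_le_cabs b; have := Im_le_cabs a; have := Im_le_cabs b.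
have := normr_ge0 (complex.Re a); have := normr_ge0 (complex.Re b).
have := normr_ge0 (complex.Im a); have := normr_ge0 (complex.Im b); nra.
Qed.

Lemma intrC m : m%:~R = (m%:~R : R)%:C :> C.
Proof. by rewrite rmorph_int. Qed.

Section Basis.
Variables v1 v2 : C.
Hypothesis X0 : cross v1 v2 != 0.

Definition lat m n : C := m%:~R * v1 + n%:~R * v2.

(** The cross product of a lattice point with [v1] isolates [n], and that with [v2] isolates [m]. *)
Lemma lat_lower : exists2 e : R, 0 < e & forall m n, e * (maxn (absz m) (absz n))%:R <= cabs (lat m n).
Proof.
have X1 : 0 < `|cross v1 v2| by rewrite normr_gt0.
have v10 := cabs_ge0 v1; have v20 := cabs_ge0 v2.
pose V := 2 * cabs v1 + 2 * cabs v2 + 1; have V0 : 0 < V by rewrite /V; lra.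
exists (`|cross v1 v2| / V) => [|m n]; first by rewrite divr_gt0.
rewrite mulrAC ler_pdivrMr //.
have h1 : `|cross v1 v2| * (absz n)%:R <= 2 * cabs v1 * cabs (lat m n).
  apply: le_trans (cross_bound v1 (lat m n)).
  rewrite /lat crossD !intrC !crossZ crossxx mulr0 add0r normrM mulrC.
  by rewrite -intr_norm -abszE.
have h2 : `|cross v1 v2| * (absz m)%:R <= 2 * cabs v2 * cabs (lat m n).
  apply: le_trans (cross_bound v2 (lat m n)).
  rewrite /lat crossD !intrC !crossZ crossxx mulr0 addr0 normrM mulrC (crossC v2 v1) normrN.
  by rewrite -intr_norm -abszE.
have := cabs_ge0 (lat m n); rewrite /V.
by case: (leqP (absz m) (absz n)) => _ h0; move: h1 h2; nra.
Qed.

Lemma lat0 : lat 0 0 = 0. Proof. by rewrite /lat !mul0r addr0. Qed.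

Lemma in_lattice0 : in_lattice v1 v2 0.
Proof. by exists 0, 0; rewrite !mul0r addr0. Qed.

Lemma in_latticeD a b : in_lattice v1 v2 a -> in_lattice v1 v2 b -> in_lattice v1 v2 (a + b).
Proof. by move=> [m [n ->]] [m' [n' ->]]; exists (m + m'), (n + n'); rewrite !rmorphD /=; ring. Qed.

Lemma in_latticeN a : in_lattice v1 v2 a -> in_lattice v1 v2 (- a).
Proof. by move=> [m [n ->]]; exists (- m), (- n); rewrite !rmorphN /=; ring. Qed.

Lemma in_latticeB a b : in_lattice v1 v2 a -> in_lattice v1 v2 b -> in_lattice v1 v2 (a - b).
Proof. by move=> ha /in_latticeN; apply: in_latticeD. Qed.

Lemma in_lattice_shift a b : in_lattice v1 v2 b -> in_lattice v1 v2 (a + b) <-> in_lattice v1 v2 a.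
Proof.
move=> hb; split => [h|h]; last exact: in_latticeD.
by rewrite -(addrK b a); apply: in_latticeB.
Qed.

Lemma in_lattice1 : in_lattice v1 v2 v1.
Proof. by exists 1, 0; rewrite mul0r addr0 mul1r. Qed.

Lemma in_lattice2 : in_lattice v1 v2 v2.
Proof. by exists 0, 1; rewrite mul0r add0r mul1r. Qed.

Lemma in_latticeM (k : int) a : in_lattice v1 v2 a -> in_lattice v1 v2 (k%:~R * a).
Proof. by move=> [m [n ->]]; exists (k * m), (k * n); rewrite !rmorphM /=; ring. Qed.

(** Distinct lattice points are at distance at least [e], so at most one of them other than [p] lies
    within [e / 2] of [p]. *)
Lemma lattice_pnear p : cpnear p (fun w => ~ in_lattice v1 v2 w).
Proof.
have [e e0 h] := lat_lower.
have sep a b : in_lattice v1 v2 a -> in_lattice v1 v2 b -> cabs (a - b) < e -> a = b.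
  move=> ha hb; have [m [n emn]] := in_latticeB ha hb; rewrite emn -/(lat m n) => hlt.
  apply/eqP; rewrite -subr_eq0 emn -/(lat m n).
  have : (maxn (absz m) (absz n) < 1)%N.
    by rewrite -(ltr_nat R) -(ltr_pM2l e0) mulr1; apply: le_lt_trans hlt.
  move=> hm; have -> : m = 0 by lia.
  have -> : n = 0 by lia.
  by rewrite lat0.
have [[a [ha ap hap]]|hno] := pselect (exists a, [/\ in_lattice v1 v2 a, a != p & cabs (a - p) < e / 2]).
  have e2 : 0 < e / 2 by rewrite divr_gt0.
  apply: cpnear_imp (cpnearI (cpnear_other ap) (cnear_pnear (cnear_ball p e2))) => w [wa hw] hl.
  move/eqP: wa; apply; apply: sep => //.
  by have := cabs_tri p w a; rewrite (cabsC p a); lra.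
exists (e / 2) => [|w hw wp hl]; first by rewrite divr_gt0.
by apply: hno; exists w.
Qed.

Lemma lattice_near p : ~ in_lattice v1 v2 p -> cnear p (fun w => ~ in_lattice v1 v2 w).
Proof.
move=> hp; have [d d0 hd] := lattice_pnear p; exists d => // w hw.
by case: (eqVneq w p) => [-> //|]; apply: hd.
Qed.

Lemma real_coord z : exists s t : R, z = s%:C * v1 + t%:C * v2.
Proof.
exists (cross z v2 / cross v1 v2), (cross v1 z / cross v1 v2).
move: X0; rewrite /cross; case: v1 => a1 a2; case: v2 => b1 b2; case: z => z1 z2 /= h.
by apply/eqP; rewrite eq_complex /=; apply/andP; split; apply/eqP; field.
Qed.

Lemma reduce_mod z : exists s t : R, [/\ 0 <= s <= 1, 0 <= t <= 1 &
  in_lattice v1 v2 (z - (s%:C * v1 + t%:C * v2))].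
Proof.
have [s [t ->]] := real_coord z.
exists (s - (Num.floor s)%:~R), (t - (Num.floor t)%:~R).
have h (x : R) : 0 <= x - (Num.floor x)%:~R <= 1.
  by have := floor_le_tmp x; have := floorD1_gt x; rewrite intrD; lra.
split => //; exists (Num.floor s), (Num.floor t).
by rewrite !rmorphB /= !rmorph_int; ring.
Qed.

Section Sums.
Variable T : int -> int -> C -> C.

(** The decay is uniform on discs. Beyond modulus [2 * r] a lattice point is at least half its
    modulus away from [z], which is the range in which the estimates hold. *)
Definition lat_decay := forall r : R, 0 < r -> exists2 A : R, 0 <= A & forall z m n,
  cabs z <= r -> 0 < cabs (lat m n) -> 2 * r <= cabs (lat m n) ->
  cabs (T m n z) <= A / cabs (lat m n) ^+ 3.

Definition lsum z : C := xget 0 [set l | ctends (sqsum (fun m n => T m n z)) l].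

Hypothesis hT : lat_decay.

Lemma lat_decay_cubic (r : R) : 0 < r -> exists2 M : R, 0 <= M & exists K0, forall z, cabs z <= r ->
  cubic_decay (fun m n => T m n z) M K0.
Proof.
move=> r0; have [A A0 hA] := hT r0; have [e e0 he] := lat_lower.
exists (A / e ^+ 3); first by rewrite divr_ge0 // exprn_ge0 // ltW.
exists (Num.truncn (2 * r / e)).+1 => z hz m n hm hm0.
have mR : 0 < (maxn (absz m) (absz n))%:R :> R by rewrite ltr0n.
have em := mulr_gt0 e0 mR.
have l0 : 0 < cabs (lat m n) by apply: lt_le_trans (he m n).
apply: le_trans (hA z m n hz l0 _) _.
  apply: le_trans (he m n); rewrite -ler_pdivrMl // mulrC.
  by apply: le_trans (ltW (truncnS_gt _)) _; rewrite ler_nat.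
rewrite -mulrA -invfM -exprMn ler_wpM2l // lef_pV2 ?posrE ?exprn_gt0 //.
by rewrite lerXn2r ?nnegrE ?(ltW em) ?(ltW l0).
Qed.

Lemma lsum_unif (r : R) : 0 < r -> forall e : R, 0 < e -> exists K0, forall K z, (K0 <= K)%N -> cabs z <= r ->
  cabs (sqsum (fun m n => T m n z) K - lsum z) <= e.
Proof.
move=> r0 e e0; have [M M0 [K0 hK]] := lat_decay_cubic r0.
exists (maxn K0 (Num.truncn (8 * M / e)).+1) => K z hKK hz.
have hK0 : (K0 <= K)%N by apply: leq_trans hKK; rewrite leq_maxl.
have hK1 : ((Num.truncn (8 * M / e)).+1 <= K)%N by apply: leq_trans hKK; rewrite leq_maxr.
have K0' : (0 < K)%N by apply: leq_trans hK1.
have [s hs hb] := sqsum_cvg M0 (hK z hz).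
have -> : lsum z = s.
  rewrite /lsum; case: xgetP => [s' -> /= h|/(_ s) //]; exact: ctends_unique h hs.
apply: le_trans (hb K hK0 K0') _.
rewrite ler_pdivrMr ?ltr0n // -ler_pdivrMl // mulrC.
by apply: le_trans (ltW (truncnS_gt _)) _; rewrite ler_nat.
Qed.

Lemma lsum_cvg z : ctends (sqsum (fun m n => T m n z)) (lsum z).
Proof.
move=> e e0; have [|K0 hK] := @lsum_unif (cabs z + 1) _ e e0; first by have := cabs_ge0 z; lra.
by exists K0 => K h; apply: hK => //; lra.
Qed.

Lemma lsum_eq z l : ctends (sqsum (fun m n => T m n z)) l -> lsum z = l.
Proof. by move=> h; apply: ctends_unique (lsum_cvg z) h. Qed.

Lemma rowsum_cdiff (g : int -> C -> C) K w : (forall m, cdiff (g m) w) ->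
  cdiff (fun z => rowsum (fun m => g m z) K) w.
Proof.
move=> h; rewrite /rowsum; elim: (K + K).+1 => [|j IH].
  by under eq_fun do rewrite big_ord0; apply: cdiff_const.
by under eq_fun do rewrite big_ord_recr; apply: cdiffD.
Qed.

Lemma lsum_cdiff p : cnear p (fun w => forall m n, cdiff (T m n) w) -> cdiff lsum p.
Proof.
move=> /cnear_closed_ball[d d0 h].
have r0 : 0 < cabs p + d by have := cabs_ge0 p; lra.
have /choice[N hN] : forall j : nat, exists K, forall z, cabs (z - p) <= d ->
    cabs (sqsum (fun m n => T m n z) K - lsum z) <= 1 / 2 ^+ j.
  move=> j; have [|K0 hK] := lsum_unif r0 (e := 1 / 2 ^+ j); first by rewrite divr_gt0 // exprn_gt0.
  exists K0 => z hz; apply: hK => //.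
  by have := cabs_subl z p; lra.
apply: (@uniform_limit_cdiff _ (fun j z => sqsum (fun m n => T m n z) (N j)) _ _ d) => //.
  by move=> j w hw; do 2!apply: rowsum_cdiff => ?; apply: h.
move=> e e0; have [j hj] := pow2_small 1 e0; exists j => w hw.
exact: le_trans (hN j w hw) (ltW hj).
Qed.

End Sums.

End Basis.

End Lattice.

(** * The Weierstrass function and twisted zeta series as lattice sums *)

Section LatticeFunctions.
Variable R : realType.
Local Notation C := (R[i]).
Implicit Types (f g : C -> C) (a b c l w x z p : C) (m n : int) (k K : nat).

Lemma sqsum0 K : sqsum (fun _ _ => 0 : C) K = 0.
Proof.
have h := sqsum_lin (-1) (fun _ _ => 0 : C) (fun _ _ => 0) K.
transitivity (sqsum (fun _ _ => -1 * 0 + 0 : C) K); first by apply: sqsum_ext => m n; ring.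
by rewrite h; ring.
Qed.

Lemma ctends_ext (u v : nat -> C) l : (forall k, u k = v k) -> ctends u l -> ctends v l.
Proof. by move=> e h d /h[n0 H]; exists n0 => n /H; rewrite e. Qed.

Lemma ctends_close (u v : nat -> C) l (M : R) (n0 : nat) : ctends u l -> 0 <= M ->
  (forall n : nat, (n0 <= n)%N -> (0 < n)%N -> cabs (v n - u n) <= M / n%:R) -> ctends v l.
Proof.
move=> hu M0 h e e0; have [n1 h1] := hu _ (divr_gt0 e0 (ltr0n _ 2)).
pose n2 := (Num.truncn (2 * M / e)).+1.
exists (maxn n0 (maxn n1 n2)) => n; rewrite !geq_max => /and3P[a1 a2 a3].
have np : (0 < n)%N by apply: leq_trans a3.
have := h n a1 np; have := h1 n a2; have := cabs_tri (u n) (v n) l.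
suff : M / n%:R <= e / 2 by lra.
rewrite ler_pdivrMr ?ltr0n // mulrAC ler_pdivlMr // -ler_pdivrMl //.
rewrite (_ : e^-1 * _ = 2 * M / e); last by ring.
by apply: le_trans (ltW (truncnS_gt _)) _; rewrite ler_nat.
Qed.

Lemma lsum_swap (T : int -> int -> C -> C) z : lsum (fun m n => T n m) z = lsum T z.
Proof.
rewrite /lsum; congr xget; apply/funext => l /=; congr ctends; apply/funext => K.
exact: (sqsum_swap (fun m n => T m n z)).
Qed.

(** Convergence of the sums of [al] and [be] is not assumed: it follows from that of the two series,
    translation of the summation index costing only boundary terms. *)
Lemma lsum_shift (v1 v2 : C) (T : int -> int -> C -> C) (u : C) (al be : int -> int -> C) :
  cross v1 v2 != 0 -> lat_decay v1 v2 T ->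
  (forall m n z, T (m + 1) n (z + v1) = u * T m n z + (z * be m n + al m n)) ->
  exists A B : C, ctends (sqsum be) B /\ forall z, lsum T (z + v1) = u * lsum T z + (z * B + A).
Proof.
move=> X0 hT hs.
pose L z := lsum T (z + v1) - u * lsum T z.
have hL z : ctends (fun K => z * sqsum be K + sqsum al K) (L z).
  have hz := lsum_cvg X0 hT z.
  have r0 : 0 < cabs (z + v1) + 1 by have := cabs_ge0 (z + v1); lra.
  have [M M0 [K0 hK]] := lat_decay_cubic X0 hT r0.
  have h1 : ctends (sqsum (fun m n => T (m + 1) n (z + v1))) (lsum T (z + v1)).
    apply: (ctends_close (lsum_cvg X0 hT (z + v1)) (M := 6 * M) (n0 := K0)); first by rewrite mulr_ge0.
    move=> K hK0 K1; have KR : 0 < K%:R :> R by rewrite ltr0n.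
    have K1R : 1 <= K%:R :> R by rewrite ler1n.
    apply: le_trans (@sqsum_shift _ (fun m n => T m n (z + v1)) K (M / K%:R ^+ 3) _) _.
      move=> m n hmn; apply: le_trans (hK (z + v1) _ m n _ _) _; first lra.
      - by case: hmn => ->; lia.
      - by case: hmn => ->; lia.
      rewrite ler_wpM2l // lef_pV2 ?posrE ?exprn_gt0 ?ltr0n //; last by case: hmn => ->; lia.
      by rewrite lerXn2r ?nnegrE // ler_nat; case: hmn => ->.
    have -> : (K + K).+1%:R = 2 * K%:R + 1 :> R by rewrite -[LHS]natr1 natrD; ring.
    have e1 : 2 * (2 * K%:R + 1) * (M / K%:R ^+ 3) = (2 * (2 * K%:R + 1) / K%:R ^+ 2) * (M / K%:R).
      by field; rewrite gt_eqF.
    rewrite e1 -[X in _ <= X]mulrA ler_wpM2r ?divr_ge0 ?(ltW KR) //.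
    by rewrite ler_pdivrMr ?exprn_gt0 //; nra.
  have h2 := ctends_lin (- u) hz h1.
  have -> : L z = - u * lsum T z + lsum T (z + v1) by rewrite /L; ring.
  apply: ctends_ext h2 => K.
  rewrite (@sqsum_ext _ (fun m n => T (m + 1) n (z + v1)) (fun m n => u * T m n z + (z * be m n + al m n))) //.
  by rewrite !sqsum_lin; ring.
(* An affine expression that converges at 0 and at 1 has convergent slope. *)
have hB : ctends (sqsum be) (L 1 - L 0).
  have := ctends_lin (-1) (hL 0) (hL 1); rewrite mulN1r addrC; apply: ctends_ext => K; ring.
exists (L 0), (L 1 - L 0); split => // z.
have h := ctends_lin z hB (hL 0).
have h' : ctends (fun K => z * sqsum be K + sqsum al K) (z * (L 1 - L 0) + L 0).
  by apply: ctends_ext h => K; ring.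
by rewrite -(ctends_unique (hL z) h') /L; ring.
Qed.

Section Pole.
Variables (v1 v2 : C) (T : int -> int -> C -> C).
Hypothesis X0 : cross v1 v2 != 0.
Hypothesis hT : lat_decay v1 v2 T.
Hypothesis hd : forall m n w, w != lat v1 v2 m n -> cdiff (T m n) w.

Lemma lsum_cdiff_off z : ~ in_lattice v1 v2 z -> cdiff (lsum T) z.
Proof.
move=> /(lattice_near X0) hz; apply: (lsum_cdiff X0 hT).
apply: cnear_imp hz => w hw m n; apply: hd.
by apply/eqP => e; apply: hw; exists m, n.
Qed.

(** Once the term of the origin is set aside, all others are differentiable in the disc below the
    minimal modulus of the lattice. *)
Lemma lsum_pole : exists2 g, cnear 0 (cdiff g) & forall z, lsum T z = T 0 0 z + g z.
Proof.
pose T0 m n z := if (m == 0) && (n == 0) then 0 else T m n z.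
have hT0 : lat_decay v1 v2 T0.
  move=> r r0; have [A A0 hA] := hT r0; exists A => // z m n h1 h2 h3; rewrite /T0.
  case: ifP => _; last exact: hA.
  by rewrite cabs0 divr_ge0 // exprn_ge0 // cabs_ge0.
exists (lsum T0).
  have [e e0 he] := lat_lower X0.
  have : cnear (0 : C) (fun w => cabs w < e).
    by exists e => // w; rewrite subr0.
  move=> /cnear_open; apply: cnear_imp => z hz; apply: (lsum_cdiff X0 hT0).
  apply: cnear_imp hz => w hw m n; rewrite /T0.
  case hmn : (_ && _); first exact: cdiff_const.
  apply: hd; apply: contraTneq hw => ->; rewrite -leNgt; apply: le_trans (he m n).
  rewrite ler_peMr ?(ltW e0) // ler1n; lia.
move=> z; apply: (lsum_eq X0 hT) => e /(lsum_cvg X0 hT0 z)[n0 h].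
exists n0 => K /h; rewrite (sqsum_off0 (fun m n => T m n z)).
by rewrite [_ - lsum _ _]addrC; congr (cabs _ <= _); rewrite /T0 /off0; ring.
Qed.

End Pole.

Section Terms.
Variables (v1 v2 : C).
Hypothesis X0 : cross v1 v2 != 0.

(** As the inverse of 0 is 0, the term for [m = n = 0] is [z ^- 2], and the whole series is one sum
    without an exceptional index. *)
Definition wp_term m n z : C := (z - lat v1 v2 m n) ^- 2 - lat v1 v2 m n ^- 2.

Lemma wp_term_decay : lat_decay v1 v2 wp_term.
Proof.
(* With W the modulus of the lattice point, the term is at most r times (5/2) W times 4 / W^4. *)
move=> r r0; exists (10 * r) => [|z m n hz]; first by rewrite mulr_ge0 // ltW.
rewrite /wp_term; set om := lat _ _ _ _ => om0 hom.
have o0 : om != 0 by rewrite -cabs_gt0.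
have hzo : cabs om / 2 <= cabs (z - om) by have := cabs_subl om z; rewrite (cabsC om z); lra.
have zo0 : z - om != 0 by rewrite -cabs_gt0; lra.
rewrite (_ : _ - _ = z * (2 * om - z) * ((z - om) ^+ 2 * om ^+ 2)^-1); last by field; rewrite o0 zo0.
rewrite !cabsM cabsV cabsM !cabsX; set W := cabs om in hzo hom om0 *.
have h1 : cabs (2 * om - z) <= 5 / 2 * W.
  by apply: le_trans (cabsB _ _) _; rewrite cabsM cabs2; rewrite -/W; lra.
have h2 : (cabs (z - om) ^+ 2 * W ^+ 2)^-1 <= 4 / W ^+ 4.
  rewrite (_ : 4 / W ^+ 4 = ((W / 2) ^+ 2 * W ^+ 2)^-1); last by field; rewrite gt_eqF.
  rewrite lef_pV2 ?posrE ?mulr_gt0 ?exprn_gt0 ?cabs_gt0 ?divr_gt0 //.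
  by rewrite ler_pM2r ?exprn_gt0 // lerXn2r ?nnegrE ?cabs_ge0 ?divr_ge0 ?(ltW om0).
have -> : 10 * r / W ^+ 3 = r * (5 / 2 * W) * (4 / W ^+ 4) by field; rewrite gt_eqF.
apply: ler_pM h2; rewrite ?mulr_ge0 ?cabs_ge0 ?invr_ge0 ?mulr_ge0 ?exprn_ge0 ?cabs_ge0 ?(ltW om0) //.
by apply: ler_pM; rewrite ?cabs_ge0.
Qed.

Lemma wp_term_cdiff m n w : w != lat v1 v2 m n -> cdiff (wp_term m n) w.
Proof.
move=> h; apply: cdiffB (cdiff_const _ _); apply: cdiffV; last by rewrite expf_neq0 // subr_eq0.
by apply: cdiffX; exact: cdiffB (cdiff_id _) (cdiff_const _ _).
Qed.

Lemma wp_lsum z : wp v1 v2 z = lsum wp_term z.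
Proof.
rewrite /wp; apply: ctends_lim; apply: ctends_ext (lsum_cvg X0 wp_term_decay z) => K.
rewrite sqsum_off0 /wp_partial /wp_term lat0 subr0 expr0n invr0 subr0.
congr (_ + _); apply: eq_bigr => i _; apply: eq_bigr => j _.
by rewrite /off0 !subr_eq0 !eqz_nat.
Qed.

Lemma wp_even z : wp v1 v2 (- z) = wp v1 v2 z.
Proof.
rewrite !wp_lsum; apply: (lsum_eq X0 wp_term_decay).
apply: ctends_ext (lsum_cvg X0 wp_term_decay z) => K.
rewrite -[RHS]sqsum_opp; apply: sqsum_ext => m n; rewrite /wp_term.
have -> : lat v1 v2 (- m) (- n) = - lat v1 v2 m n by rewrite /lat !rmorphN /=; ring.
by rewrite sqrrN -opprD sqrrN.
Qed.

Lemma latS m n : lat v1 v2 (m + 1) n = lat v1 v2 m n + v1.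
Proof. by rewrite /lat rmorphD /= rmorph1; ring. Qed.

Lemma wp_cdiff z : ~ in_lattice v1 v2 z -> cdiff (wp v1 v2) z.
Proof.
rewrite (_ : wp v1 v2 = lsum wp_term); last by apply/funext => w; apply: wp_lsum.
exact: (lsum_cdiff_off X0 wp_term_decay wp_term_cdiff).
Qed.

Lemma wp_pole : pole 2 1 (wp v1 v2).
Proof.
have [g g1 g2] := lsum_pole X0 wp_term_decay wp_term_cdiff.
exists (fun w => 1 + w ^+ 2 * g w); split.
- apply: cnear_imp g1 => w hw; apply: cdiffD; first exact: cdiff_const.
  by apply: cdiffM => //; apply: cdiffX; apply: cdiff_id.
- by rewrite expr0n mul0r addr0.
exists 1 => // w _ w0; rewrite wp_lsum g2 /wp_term lat0 subr0 expr0n invr0 subr0.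
by field.
Qed.

(** The translation defect is a constant, and evaluating it at [- (v1 / 2)] shows that it is zero,
    since the function is even. Total inverses make the identity hold at the poles as well. *)
Lemma wp_shift1 z : wp v1 v2 (z + v1) = wp v1 v2 z.
Proof.
have [|A [B [hB hs]]] := @lsum_shift v1 v2 wp_term 1 (fun m n => (lat v1 v2 m n) ^- 2 - (lat v1 v2 m n + v1) ^- 2) (fun _ _ => 0) X0 wp_term_decay.
  by move=> m n w; rewrite /wp_term latS (_ : w + v1 - _ = w - lat v1 v2 m n); ring.
have B0 : B = 0.
  apply: ctends_unique hB _ => e e0; exists 0%N => K _.
  by rewrite sqsum0 subrr cabs0 ltW.
have h w : wp v1 v2 (w + v1) = wp v1 v2 w + A by rewrite !wp_lsum hs B0; ring.
have A0 : A = 0.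
  have := h (- (v1 / 2)); rewrite (_ : - (v1 / 2) + v1 = v1 / 2); last by field.
  by rewrite wp_even -[X in X = _]addr0 => /addrI.
by rewrite h A0 addr0.
Qed.

(* For [m = n = 0] the junk inverses vanish and the term is [z^-1]. *)
Definition zeta_term (u1 u2 : C) m n z : C :=
  u1 ^ m * u2 ^ n * ((z - lat v1 v2 m n)^-1 + (lat v1 v2 m n)^-1 + z / lat v1 v2 m n ^+ 2).

Section Zeta.
Variables u1 u2 : C.
Hypotheses (hu1 : cabs u1 = 1) (hu2 : cabs u2 = 1).

Lemma cabs_exprz (u : C) m : cabs u = 1 -> cabs (u ^ m) = 1.
Proof. by move=> h; case: m => n; rewrite ?cabsV cabsX h expr1n ?invr1. Qed.

Lemma zeta_term_decay : lat_decay v1 v2 (zeta_term u1 u2).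
Proof.
move=> r r0; exists (2 * r ^+ 2) => [|z m n hz]; first by rewrite mulr_ge0 // exprn_ge0 // ltW.
rewrite /zeta_term; set om := lat _ _ _ _ => om0 hom.
have o0 : om != 0 by rewrite -cabs_gt0.
have hzo : cabs om / 2 <= cabs (z - om) by have := cabs_subl om z; rewrite (cabsC om z); lra.
have zo0 : z - om != 0 by rewrite -cabs_gt0; lra.
rewrite (_ : _^-1 + _ + _ = z ^+ 2 * ((z - om) * om ^+ 2)^-1); last by field; rewrite o0 zo0.
rewrite !cabsM !cabs_exprz // !mul1r cabsV cabsM !cabsX; set W := cabs om in hzo hom om0 *.
have h2 : (cabs (z - om) * W ^+ 2)^-1 <= 2 / W ^+ 3.
  rewrite (_ : 2 / W ^+ 3 = (W / 2 * W ^+ 2)^-1); last by field; rewrite gt_eqF.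
  rewrite lef_pV2 ?posrE ?mulr_gt0 ?exprn_gt0 ?cabs_gt0 ?divr_gt0 //.
  by rewrite ler_pM2r ?exprn_gt0.
have -> : 2 * r ^+ 2 / W ^+ 3 = r ^+ 2 * (2 / W ^+ 3) by field; rewrite gt_eqF.
apply: ler_pM h2; rewrite ?invr_ge0 ?mulr_ge0 ?exprn_ge0 ?cabs_ge0 ?(ltW om0) //.
by rewrite expr2 ler_pM ?cabs_ge0.
Qed.

Lemma zeta_term_cdiff m n w : w != lat v1 v2 m n -> cdiff (zeta_term u1 u2 m n) w.
Proof.
move=> h; apply: cdiffZ; apply: cdiffD; last exact: cdiffM (cdiff_id _) (cdiff_const _ _).
apply: cdiffD (cdiff_const _ _); apply: cdiffV; last by rewrite subr_eq0.
exact: cdiffB (cdiff_id _) (cdiff_const _ _).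
Qed.

Lemma zeta_pole : pole 1 1 (lsum (zeta_term u1 u2)).
Proof.
have [g g1 g2] := lsum_pole X0 zeta_term_decay zeta_term_cdiff.
exists (fun w => 1 + w * g w); split.
- apply: cnear_imp g1 => w hw; apply: cdiffD; first exact: cdiff_const.
  by apply: cdiffM => //; apply: cdiff_id.
- by rewrite mul0r addr0.
exists 1 => // w _ w0; rewrite g2 /zeta_term lat0 subr0 expr0n invr0 mulr0 !addr0 !expr0z.
by field.
Qed.

Lemma zeta_shift1 : exists A B : C, forall z,
  lsum (zeta_term u1 u2) (z + v1) = u1 * lsum (zeta_term u1 u2) z + (z * B + A).
Proof.
pose om := lat v1 v2.
have [|A [B [_ hs]]] := @lsum_shift v1 v2 (zeta_term u1 u2) u1
  (fun m n => u1 * (u1 ^ m * u2 ^ n) * ((om m n + v1)^-1 - (om m n)^-1 + v1 / (om m n + v1) ^+ 2))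
  (fun m n => u1 * (u1 ^ m * u2 ^ n) * (((om m n + v1) ^+ 2)^-1 - (om m n ^+ 2)^-1)) X0 zeta_term_decay.
  move=> m n z; rewrite /zeta_term latS (_ : z + v1 - _ = z - lat v1 v2 m n); last by ring.
  have u0 : u1 != 0 by rewrite -cabs_gt0 hu1 ltr01.
  by rewrite addrC exprzDr ?unitfE // expr1z /om; ring.
by exists A, B.
Qed.

End Zeta.
End Terms.
End LatticeFunctions.

(** * Functions with multipliers on a lattice *)

Section EllipticFunctions.
Variable R : realType.
Local Notation C := (R[i]).
Implicit Types (f g G : C -> C) (a b c l u v w x z p : C) (m n : int) (k K : nat).

(** Cauchy's formula transfers a bound on a large contour to its inside; the factor 256 keeps the
    ball where the winding integral has modulus at least 1. *)
Lemma entire_bounded_on_ball f (r : R) : (forall w, cdiff f w) ->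
  exists M : R, forall z, cabs z <= r -> cabs (f z) <= M.
Proof.
move=> hf; pose d := 256 * (`|r| + 1).
have d0 : 0 < d by rewrite /d; have := normr_ge0 r; lra.
have rf := ball_ring_cont (fun w (_ : cabs (w - 0) <= d) => hf w).
have [M M0 hM] := ring_bounded d0 rf; exists (32 * M) => z hz.
have hz' : cabs (z - 0) <= d / 256 by rewrite subr0 /d; have := ler_norm r; lra.
have hz4 : cabs (z - 0) <= d / 4 by lra.
have := cint_bound d0 rf hz4 hM; rewrite (cauchy_formula d0 hz4 (fun w _ => hf w)) cabsM.
apply: le_trans; rewrite ler_peMr ?cabs_ge0 //; exact: cint1_lower.
Qed.

Variables v1 v2 : C.
Hypothesis X0 : cross v1 v2 != 0.
Local Notation in_lat := (in_lattice v1 v2).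

Lemma cabs_shift_int f v (m : int) z : (forall z, cabs (f (z + v)) = cabs (f z)) ->
  cabs (f (z + m%:~R * v)) = cabs (f z).
Proof.
move=> h; have hn (k : nat) y : cabs (f (y + k%:R * v)) = cabs (f y).
  elim: k y => [|k IH] y; first by rewrite mul0r addr0.
  by rewrite -[k.+1%:R]natr1 mulrDl mul1r addrA h IH.
case: m => k; first exact: hn.
by rewrite NegzE mulrNz -(hn k.+1 (z + _)) mulNr subrK.
Qed.

(** Only the modulus is periodic, but this suffices to carry a bound from a fundamental
    parallelogram to the plane. *)
Lemma entire_unitary_const G : (forall z, cdiff G z) ->
  (forall z, cabs (G (z + v1)) = cabs (G z)) -> (forall z, cabs (G (z + v2)) = cabs (G z)) ->
  forall z w, G z = G w.
Proof.
move=> hG h1 h2.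
have [M hM] := entire_bounded_on_ball (cabs v1 + cabs v2) hG.
apply: (liouville hG (M := M)) => z.
have [s [t [hs ht [m [n e]]]]] := reduce_mod X0 z.
have -> : z = s%:C * v1 + t%:C * v2 + m%:~R * v1 + n%:~R * v2 by rewrite -addrA -e; ring.
rewrite cabs_shift_int // cabs_shift_int //; apply: hM.
apply: le_trans (cabsD _ _) _; rewrite !cabsM !cabsR !ger0_norm; try lra.
by have := cabs_ge0 v1; have := cabs_ge0 v2; nra.
Qed.

Lemma notin_lat_shift a z : in_lat a -> ~ in_lat z -> ~ in_lat (z + a).
Proof. by move=> ha hz /(in_lattice_shift z ha). Qed.

(** Sections of the character with values [u1] and [u2] on the basis. Nothing is asked at lattice
    points; the pole at the origin is recorded separately by [pole]. *)
Definition ell (u1 u2 : C) f := forall z, ~ in_lat z ->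
  [/\ cdiff f z, f (z + v1) = u1 * f z & f (z + v2) = u2 * f z].

Lemma ell_lin u1 u2 c f g : ell u1 u2 f -> ell u1 u2 g -> ell u1 u2 (fun z => c * f z + g z).
Proof.
move=> hf hg z hz; have [a1 a2 a3] := hf z hz; have [b1 b2 b3] := hg z hz; split.
- by apply: cdiffD => //; apply: cdiffZ.
- by rewrite a2 b2; ring.
- by rewrite a3 b3; ring.
Qed.

Lemma ellZ u1 u2 c f : ell u1 u2 f -> ell u1 u2 (fun z => c * f z).
Proof.
move=> hf z /hf[a1 a2 a3]; split; [exact: cdiffZ|rewrite a2; ring|rewrite a3; ring].
Qed.

Lemma ellM u1 u2 w1 w2 f g : ell u1 u2 f -> ell w1 w2 g -> ell (u1 * w1) (u2 * w2) (fun z => f z * g z).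
Proof.
move=> hf hg z hz; have [a1 a2 a3] := hf z hz; have [b1 b2 b3] := hg z hz; split.
- exact: cdiffM.
- by rewrite a2 b2; ring.
- by rewrite a3 b3; ring.
Qed.

Lemma ell_const c : ell 1 1 (fun=> c).
Proof. by move=> z _; split; [exact: cdiff_const|rewrite mul1r|rewrite mul1r]. Qed.

Lemma ell_ext u1 u2 f g : (forall z, ~ in_lat z -> f z = g z) -> ell u1 u2 f -> ell u1 u2 g.
Proof.
move=> e hf z hz; have [a1 a2 a3] := hf z hz; have h1 := notin_lat_shift (in_lattice1 _ _) hz; have h2 := notin_lat_shift (in_lattice2 _ _) hz.
rewrite -!e //; split => //.
by apply: cdiff_near a1; apply: cnear_imp (lattice_near X0 hz) => w; apply: e.
Qed.

Lemma ell_der u1 u2 f : ell u1 u2 f ->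
  exists2 D, ell u1 u2 D & forall z, ~ in_lat z -> cder f z (D z).
Proof.
move=> hf; have /choice[D hD] : forall z, exists l, ~ in_lat z -> cder f z l.
  move=> z; have [h|h] := pselect (in_lat z); first by exists 0.
  by have [[l hl] _ _] := hf z h; exists l.
exists D => // z hz.
have sh u v : in_lat v -> (forall z, ~ in_lat z -> f (z + v) = u * f z) -> D (z + v) = u * D z.
  move=> hv h; have hzv := notin_lat_shift hv hz.
  apply: (@cder_unique _ (fun w => f (w + v)) z); first exact: cder_shift (hD _ hzv).
  apply: cder_near (cderZ u (hD z hz)); apply: cnear_imp (lattice_near X0 hz) => w hw.
  by rewrite h.
split; first by apply: (cder_cdiff (f := f)); apply: cnear_imp (lattice_near X0 hz) => w; apply: hD.
  by apply: sh (in_lattice1 _ _) _ => w /hf[].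
by apply: sh (in_lattice2 _ _) _ => w /hf[].
Qed.

Lemma shift_int f (u v : C) : u != 0 -> in_lat v -> (forall z, ~ in_lat z -> f (z + v) = u * f z) ->
  forall m z, ~ in_lat z -> f (z + m%:~R * v) = u ^ m * f z.
Proof.
move=> u0 hv h.
have hn (k : nat) y : ~ in_lat y -> f (y + k%:R * v) = u ^+ k * f y.
  elim: k y => [|k IH] y hy; first by rewrite mul0r addr0 mul1r.
  rewrite -[k.+1%:R]natr1 mulrDl mul1r addrA h ?IH ?exprS ?mulrA //.
  exact: notin_lat_shift (in_latticeM (Posz k) hv) hy.
case=> k z hz; first exact: hn.
rewrite NegzE mulrNz -[in RHS](subrK (k.+1%:R * v) z) (hn k.+1); last first.
  by have := notin_lat_shift (in_latticeM (- Posz k.+1) hv) hz; rewrite mulrNz mulNr.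
by rewrite mulNr -exprnN mulrA mulVf ?mul1r ?expf_neq0.
Qed.

Lemma ell_int u1 u2 f m n : u1 != 0 -> u2 != 0 -> ell u1 u2 f ->
  forall z, ~ in_lat z -> f (z + lat v1 v2 m n) = u1 ^ m * u2 ^ n * f z.
Proof.
move=> u10 u20 hf z hz; rewrite /lat addrA (shift_int u20 (in_lattice2 _ _)); last first.
- exact: notin_lat_shift (in_latticeM m (in_lattice1 _ _)) hz.
- by move=> w /hf[].
by rewrite (shift_int u10 (in_lattice1 _ _)) //; [ring|move=> w /hf[]].
Qed.

Lemma ell_at_lat u1 u2 f p : u1 != 0 -> u2 != 0 -> ell u1 u2 f -> in_lat p ->
  exists m n, u1 ^ m * u2 ^ n != 0 /\ cpnear p (fun w => f w = u1 ^ m * u2 ^ n * f (w - p)).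
Proof.
move=> u10 u20 hf [m [n ep]]; exists m, n; split; first by rewrite mulf_neq0 // expfz_neq0.
apply: cpnear_imp (lattice_pnear X0 p) => w hw.
rewrite -(ell_int m n u10 u20 hf) /lat -?ep ?subrK //.
by apply: notin_lat_shift hw; apply: in_latticeN; exists m, n.
Qed.

Lemma cnear_shift p (P : C -> Prop) : cnear 0 P -> cnear p (fun w => P (w - p)).
Proof. by move=> [d d0 h]; exists d => // w hw; apply: h; rewrite subr0. Qed.

Lemma cpnear_shift p (P : C -> Prop) : cpnear 0 P -> cpnear p (fun w => P (w - p)).
Proof. by move=> [d d0 h]; exists d => // w hw wp; apply: h; rewrite ?subr0 // subr_eq0. Qed.

(** Near a lattice point a section is a nonzero multiple of its translate to the origin, so pole
    data at the origin control every lattice point. *)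
Lemma ell_mero u1 u2 k c f p : u1 != 0 -> u2 != 0 -> ell u1 u2 f -> pole k c f -> in_lat p ->
  exists g, [/\ cnear p (cdiff g), cpnear p (fun w => f w = g w / (w - p) ^+ k) & (c != 0 -> g p != 0)].
Proof.
move=> u10 u20 hf [g [g1 g2 g3]] hp.
have [m [n [hmn h]]] := ell_at_lat u10 u20 hf hp.
exists (fun w => u1 ^ m * u2 ^ n * g (w - p)); split.
- apply: cnear_imp (cnear_shift p g1) => w hw; apply: cdiffZ.
  exact: cdiff_shift.
- by apply: cpnear_imp (cpnearI h (cpnear_shift p g3)) => w [-> ->]; rewrite mulrA.
- by rewrite subrr g2 => c0; rewrite mulf_neq0.
Qed.

Lemma unitary_neq0 (u : C) : cabs u = 1 -> u != 0.
Proof. by move=> h; rewrite -cabs_gt0 h. Qed.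

(** The extension is constant, and a nonzero constant forces both multipliers to be 1; the last two
    equations serve to compare multipliers. *)
Lemma ell_removable_unitary F (u1 u2 : C) : cabs u1 = 1 -> cabs u2 = 1 ->
  (forall p, exists2 g, cnear p (cdiff g) & cpnear p (fun w => F w = g w)) ->
  (forall p, cpnear p (fun w => F (w + v1) = u1 * F w)) ->
  (forall p, cpnear p (fun w => F (w + v2) = u2 * F w)) ->
  exists c, [/\ forall p, cpnear p (fun w => F w = c), c = u1 * c & c = u2 * c].
Proof.
move=> hu1 hu2 hF s1 s2; have [G hG hFG] := removable hF.
have sh u v : (forall p, cpnear p (fun w => F (w + v) = u * F w)) -> forall z, G (z + v) = u * G z.
  move=> h z; apply: (@ccont_unique _ (fun w => G (w + v)) (fun w => u * G w) z).
  - exact/cdiff_cont/cdiff_shift.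
  - exact/cdiff_cont/cdiffZ.
  have [h1 _] := hFG z; have [[d d0 h2] _] := hFG (z + v).
  have h2' : cpnear z (fun w => F (w + v) = G (w + v)).
    exists d => // w hw wz; apply: h2; first by rewrite (_ : w + v - (z + v) = w - z) //; ring.
    by rewrite (inj_eq (addIr v)).
  by apply: cpnear_imp (cpnearI (h z) (cpnearI h1 h2')) => w [a1 [<- <-]].
have e1 := sh _ _ s1; have e2 := sh _ _ s2.
have hc : forall z w, G z = G w.
  by apply: entire_unitary_const => // z; rewrite ?e1 ?e2 cabsM ?hu1 ?hu2 mul1r.
exists (G 0); split.
- by move=> p; have [h _] := hFG p; apply: cpnear_imp h => w ->; apply: hc.
- by rewrite -e1; apply: hc.
- by rewrite -e2; apply: hc.
Qed.

Lemma ell_pole0 f c : ell 1 1 f -> pole 0 c f -> exists c', forall z, ~ in_lat z -> f z = c'.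
Proof.
move=> hf hp.
have [|||||c' [h _ _]] := @ell_removable_unitary f 1 1; rewrite ?cabs1 //.
- move=> p; have [hp'|hp'] := pselect (in_lat p).
    have [g [g1 g2 _]] := ell_mero (oner_neq0 _) (oner_neq0 _) hf hp hp'.
    by exists g => //; apply: cpnear_imp g2 => w ->; rewrite expr0 divr1.
  exists f; last by exists 1.
  by apply: cnear_imp (lattice_near X0 hp') => w /hf[].
- by move=> p; apply: cpnear_imp (lattice_pnear X0 p) => w /hf[].
- by move=> p; apply: cpnear_imp (lattice_pnear X0 p) => w /hf[].
exists c' => z hz; have [hfz _ _] := hf z hz.
exact: ccont_unique (cdiff_cont hfz) (cdiff_cont (cdiff_const c' z)) (h z).
Qed.

End EllipticFunctions.

(** * Sections with a simple pole, the residue theorem, and the ring of elliptic functions *)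

Section EllipticRing.
Variable R : realType.
Local Notation C := (R[i]).
Implicit Types (f g G : C -> C) (a b c l u v w x z p : C) (m n : int) (k K : nat).
Variables v1 v2 : C.
Hypothesis X0 : cross v1 v2 != 0.
Local Notation in_lat := (in_lattice v1 v2).

Let X0' : cross v2 v1 != 0. Proof. by rewrite crossC oppr_eq0. Qed.

Lemma lat_swap m n : lat v2 v1 m n = lat v1 v2 n m.
Proof. by rewrite /lat addrC. Qed.

(** Summation over squares is symmetric in the two indices, so every statement about [v1] yields the
    one about [v2]. *)
Lemma wp_swap z : wp v2 v1 z = wp v1 v2 z.
Proof.
rewrite (wp_lsum X0') (wp_lsum X0).
have -> : wp_term v2 v1 = fun m n => wp_term v1 v2 n m; last exact: lsum_swap.
by apply/funext => m; apply/funext => n; apply/funext => w; rewrite /wp_term lat_swap.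
Qed.

Lemma wp_shift2 z : wp v1 v2 (z + v2) = wp v1 v2 z.
Proof. by rewrite -!wp_swap wp_shift1. Qed.

Lemma ell_wp : ell v1 v2 1 1 (wp v1 v2).
Proof. by move=> z hz; split; [exact: wp_cdiff|rewrite wp_shift1 ?mul1r|rewrite wp_shift2 mul1r]. Qed.

Lemma wp'_cder z : ~ in_lat z -> cder (wp v1 v2) z (wp' v1 v2 z).
Proof. by move=> /(wp_cdiff X0)[l hl]; rewrite /wp' (cder_lim hl). Qed.

Lemma ell_wp' : ell v1 v2 1 1 (wp' v1 v2).
Proof.
have sh v z : (forall w, wp v1 v2 (w + v) = wp v1 v2 w) -> wp' v1 v2 (z + v) = wp' v1 v2 z.
  move=> h; rewrite /wp'.
  have -> // : (fun w => (wp v1 v2 (z + v + w) - wp v1 v2 (z + v)) / w) =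
      (fun w => (wp v1 v2 (z + w) - wp v1 v2 z) / w).
  by apply/funext => w; rewrite h addrAC h.
move=> z hz; split.
- apply: (cder_cdiff (f := wp v1 v2)); apply: cnear_imp (lattice_near X0 hz) => w.
  exact: wp'_cder.
- by rewrite sh ?mul1r // => w; rewrite wp_shift1.
- by rewrite sh ?mul1r // => w; rewrite wp_shift2.
Qed.

Lemma wp'_pole : pole 3 (- 2) (wp' v1 v2).
Proof.
have := pole_der (wp_pole X0) (D := wp' v1 v2); rewrite mulr1; apply.
by apply: cpnear_imp (lattice_pnear X0 0) => w; apply: wp'_cder.
Qed.

(* As [u1] and [u2] differ from [1], adding an affine function to the twisted
   zeta series removes the affine defect of its quasi-periodicity. *)
Lemma ell_section (u1 u2 : C) : cabs u1 = 1 -> cabs u2 = 1 -> u1 != 1 -> u2 != 1 ->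
  exists2 s, ell v1 v2 u1 u2 s & pole 1 1 s.
Proof.
move=> hu1 hu2 n1 n2; set T := zeta_term v1 v2 u1 u2.
have [A1 [B1 h1]] := zeta_shift1 X0 hu1 hu2.
have [A2 [B2 h2]] := zeta_shift1 X0' hu2 hu1.
have sw z : lsum (zeta_term v2 v1 u2 u1) z = lsum T z.
  have -> : zeta_term v2 v1 u2 u1 = fun m n => T n m; last exact: lsum_swap.
  apply/funext => m; apply/funext => n; apply/funext => w.
  by rewrite /T /zeta_term lat_swap [u2 ^ m * _]mulrC.
have {}h2 z : lsum T (z + v2) = u2 * lsum T z + (z * B2 + A2) by rewrite -!sw.
rewrite -/T in h1; set S := lsum T in h1 h2.
(* Translating by [v1] and [v2] in either order makes the two affine defects compatible. The cases 0
   and 1 then show that one affine function corrects both. *)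
have comm z : u2 * (z * B1 + A1) + ((z + v1) * B2 + A2) = u1 * (z * B2 + A2) + ((z + v2) * B1 + A1).
  have e1 : S (z + v1 + v2) = u2 * (u1 * S z + (z * B1 + A1)) + ((z + v1) * B2 + A2) by rewrite h2 h1.
  have e2 : S (z + v1 + v2) = u1 * (u2 * S z + (z * B2 + A2)) + ((z + v2) * B1 + A1) by rewrite addrAC h1 h2.
  apply: (@addrI _ (u1 * u2 * S z)); transitivity (S (z + v1 + v2)).
    by rewrite e1; ring.
  by rewrite e2; ring.
have d1 : u1 - 1 != 0 by rewrite subr_eq0.
have d2 : u2 - 1 != 0 by rewrite subr_eq0.
have c0 := comm 0; have c1 := comm 1.
have cB : (u2 - 1) * B1 = (u1 - 1) * B2.
  apply/eqP; rewrite -subr_eq0; apply/eqP.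
  transitivity ((u2 * (1 * B1 + A1) + ((1 + v1) * B2 + A2)) - (u1 * (1 * B2 + A2) + ((1 + v2) * B1 + A1))
    - ((u2 * (0 * B1 + A1) + ((0 + v1) * B2 + A2)) - (u1 * (0 * B2 + A2) + ((0 + v2) * B1 + A1)))); first by ring.
  by rewrite c0 c1 !subrr.
pose b := B1 / (u1 - 1); pose a := (A1 + b * v1) / (u1 - 1).
have b1 : b * (u1 - 1) = B1 by rewrite /b divfK.
have b2 : b * (u2 - 1) = B2 by rewrite /b mulrAC mulrC [B1 * _]mulrC cB mulKf.
have a1 : a * (u1 - 1) = A1 + b * v1 by rewrite /a divfK.
have a2 : a * (u2 - 1) = A2 + b * v2.
  apply: (mulIf d1); rewrite mulrAC a1; apply/eqP; rewrite -subr_eq0; apply/eqP.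
  rewrite -b1 -b2 in c0; transitivity ((u2 * (0 * (b * (u1 - 1)) + A1) + ((0 + v1) * (b * (u2 - 1)) + A2)) - (u1 * (0 * (b * (u2 - 1)) + A2) + ((0 + v2) * (b * (u1 - 1)) + A1))); first by ring.
  by rewrite c0 subrr.
exists (fun z => S z + (b * z + a)).
  move=> z hz; split.
  - have hS : cdiff S z.
      exact: (lsum_cdiff_off X0 (zeta_term_decay v1 v2 hu1 hu2) (@zeta_term_cdiff _ v1 v2 u1 u2)).
    apply: cdiffD => //.
    by apply: cdiffD (cdiff_const _ _); apply: cdiffZ; apply: cdiff_id.
  - rewrite h1 -b1; apply/eqP; rewrite -subr_eq0; apply/eqP.
    by transitivity (A1 + b * v1 - a * (u1 - 1)); [ring|rewrite a1 subrr].
  - rewrite h2 -b2; apply/eqP; rewrite -subr_eq0; apply/eqP.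
    by transitivity (A2 + b * v2 - a * (u2 - 1)); [ring|rewrite a2 subrr].
have hp : pole 1 0 (fun z : C => b * z + a).
  apply: pole_raise; apply: pole0_cdiff; apply: cnear_all => w.
  by apply: cdiffD (cdiff_const _ _); apply: cdiffZ; apply: cdiff_id.
have := pole_lin 1 (zeta_pole X0 hu1 hu2) hp; rewrite mulr1 addr0.
by apply: pole_ext; exists 1 => // w _ _; rewrite mul1r.
Qed.

Lemma lat_coord (s t : R) : in_lat (s%:C * v1 + t%:C * v2) ->
  exists m n, s = m%:~R /\ t = n%:~R.
Proof.
move=> [m [n e]]; exists m, n.
have e1 : cross v1 (s%:C * v1 + t%:C * v2) = cross v1 (m%:~R * v1 + n%:~R * v2) by rewrite e.
have e2 : cross v2 (s%:C * v1 + t%:C * v2) = cross v2 (m%:~R * v1 + n%:~R * v2) by rewrite e.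
move: e1 e2; rewrite !crossD !intrC !crossZ !crossxx !mulr0 !add0r !addr0.
by move=> /(mulIf X0) -> /(mulIf X0') ->.
Qed.

Lemma half_neq (y : R) : y - 1 / 2 = 0 -> y <> 0 /\ y <> 1.
Proof. by move=> h; split=> e; (suff : (1 : R) < 0 by rewrite ltr10); lra. Qed.

Lemma segment_unit (a b q : R) : 0 <= a <= 1 -> 0 <= b <= 1 -> 0 <= q <= 1 ->
  0 <= a + q * (b - a) <= 1.
Proof. by nra. Qed.

(** The residue theorem on the period parallelogram centred at the origin: by periodicity the
    boundary integral of [f] is zero, that of [f - c / z] is zero by [goursat], and that of [1 / z]
    is not. *)
Lemma ell_pole1 f c : ell v1 v2 1 1 f -> pole 1 c f -> c = 0.
Proof.
move=> hf [g [g1 g2 g3]].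
have [l hl] := cnear_at g1.
pose h := dslope g 0 l.
have hd : cdiff h 0 by apply: cdiff_dslope.
(* The principal part is removed and the gap filled in; the centred parallelogram contains no other
   lattice point. *)
pose phi z := if z == 0 then h 0 else f z - c / z.
have phi0 : cdiff phi 0.
  apply: cdiff_near hd; have [d d0 hg] := g3; exists d => // w hw.
  rewrite /phi; case: eqVneq => [-> //|w0]; rewrite hg // expr1.
  by rewrite {1}(dslopeE g 0 l w) g2 subr0 -/h; field.
have phid z : (~ in_lat z \/ z = 0) -> cdiff phi z.
  move=> [hz|-> //]; have z0 : z != 0 by apply/eqP => e; apply: hz; rewrite e; exact: in_lattice0.
  apply: (@cdiff_near _ (fun w => f w - c / w)).
    apply: cnear_imp (cnear_other (z := z) (x := 0) _) => [w|]; last by rewrite eq_sym.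
    by rewrite /phi => /negbTE ->.
  have [h1 _ _] := hf z hz; apply: cdiffB h1 _; apply: cdiffZ; apply: cdiffV => //; exact: cdiff_id.
pose P (s t : R) : C := (s - 1 / 2)%:C * v1 + (t - 1 / 2)%:C * v2.
have small (y : R) (j : int) : 0 <= y <= 1 -> y - 1 / 2 = j%:~R -> j = 0.
  move=> hy e; have a1 : (-1 < j)%R by rewrite -(ltr_int R) -e mulrN1z; lra.
  have a2 : (j < 1)%R by rewrite -(ltr_int R) -e mulr1z; lra.
  lia.
have inP (s t : R) : 0 <= s <= 1 -> 0 <= t <= 1 -> cdiff phi (P s t).
  move=> hs ht; apply: phid; have [hlat|] := pselect (in_lat (P s t)); last by left.
  right; have [m [n [e1 e2]]] := lat_coord hlat.
  by rewrite /P e1 e2 (small _ _ hs e1) (small _ _ ht e2) !mul0r addr0.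
pose A := P 0 0; pose B := P 1 0; pose D := P 1 1; pose E := P 0 1.
have PB s t s' t' q : seg (P s t) (P s' t') q = P (s + q * (s' - s)) (t + q * (t' - t)).
  by rewrite /seg /P !(rmorphB, rmorphD, rmorphM) /=; ring.
(* The parallelogram is cut along a diagonal into two triangles. *)
have t1 : Tri phi A B D = 0.
  have e (p q : R) : bary A B D p q = P (p + q) q.
    by rewrite /bary /A /B /D /P !(rmorphB, rmorphD, rmorphM) /= rmorph0 rmorph1; ring.
  have hc (p q : R) : simplex p q -> cdiff phi (bary A B D p q).
    by move=> [? ? ?]; rewrite e; apply: inP; lra.
  by apply: goursat => p q /hc // /cdiff_cont.
have t2 : Tri phi A D E = 0.
  have e (p q : R) : bary A D E p q = P p (p + q).
    by rewrite /bary /A /D /E /P !(rmorphB, rmorphD, rmorphM) /= rmorph0 rmorph1; ring.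
  have hc (p q : R) : simplex p q -> cdiff phi (bary A D E p q).
    by move=> [? ? ?]; rewrite e; apply: inP; lra.
  by apply: goursat => p q /hc // /cdiff_cont.
have sphi (s t s' t' : R) : 0 <= s <= 1 -> 0 <= t <= 1 -> 0 <= s' <= 1 -> 0 <= t' <= 1 ->
    scont phi (P s t) (P s' t').
  move=> hs ht hs' ht'; apply: scontP => q hq; rewrite PB; apply: cdiff_cont; apply: inP; nra.
have l01 : 0 <= (0 : R) <= 1 by lra.
have l11 : 0 <= (1 : R) <= 1 by lra.
have sum0 : J phi A B + J phi B D + J phi D E + J phi E A = 0.
  have := t1; have := t2; rewrite /Tri (J_rev (sphi 0 0 1 1 l01 l01 l11 l11)) -/A -/D.
  move: (J phi A B) (J phi B D) (J phi D E) (J phi E A) (J phi A D) => j1 j2 j3 j4 j5 e2 e1.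
  by rewrite -[RHS](addr0 0) -{1}e1 -e2; ring.
pose inv z : C := (z - 0)^-1.
pose L : R := cabs v1 + cabs v2 + 1.
have L0 : 0 < L by have := cabs_ge0 v1; have := cabs_ge0 v2; rewrite /L; lra.
have Pb (s t : R) : 0 <= s <= 1 -> 0 <= t <= 1 -> cabs (P s t - 0) <= L.
  move=> hs ht; rewrite subr0; apply: le_trans (cabsD _ _) _; rewrite !cabsM !cabsR.
  have h1 : `|s - 1 / 2| <= 1 by rewrite ler_norml; lra.
  have h2 : `|t - 1 / 2| <= 1 by rewrite ler_norml; lra.
  by have := cabs_ge0 v1; have := cabs_ge0 v2; rewrite /L; nra.
have crossP s t s' t' : cross (P s t - 0) (P s' t' - 0) =
    ((s - 1 / 2) * (t' - 1 / 2) - (t - 1 / 2) * (s' - 1 / 2)) * cross v1 v2.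
  rewrite !subr0 /P crossD !crossZ crossC (crossC _ v2) !crossD !crossZ !crossxx (crossC v2 v1); ring.
(* For every side the cross product of its endpoints is half that of the basis, so the four
   imaginary parts have a common sign and cannot cancel. *)
have half0 : (2^-1 : R) * cross v1 v2 != 0 by rewrite mulf_neq0 // invr_neq0.
have side (s t s' t' : R) : 0 <= s <= 1 -> 0 <= t <= 1 -> 0 <= s' <= 1 -> 0 <= t' <= 1 ->
   (s - 1 / 2) * (t' - 1 / 2) - (t - 1 / 2) * (s' - 1 / 2) = 2^-1 ->
   scont inv (P s t) (P s' t') /\
   0 < (2^-1 * cross v1 v2) * complex.Im (J inv (P s t) (P s' t')).
  move=> hs ht hs' ht' e.
  have [|||h1 h2] := @J_inv_Im _ 0 (P s t) (P s' t') L L0; rewrite ?crossP ?e ?Pb //.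
  split => //; rewrite crossP e in h2; apply: lt_le_trans h2.
  by apply: divr_gt0; [rewrite exprn_even_gt0|exact: exprn_gt0].
have [|sAB iAB] := side 0 0 1 0 l01 l01 l11 l01; first by field.
have [|sBD iBD] := side 1 0 1 1 l11 l01 l11 l11; first by field.
have [|sDE iDE] := side 1 1 0 1 l11 l11 l01 l11; first by field.
have [|sEA iEA] := side 0 1 0 0 l01 l11 l01 l01; first by field.
have isum : J inv A B + J inv B D + J inv D E + J inv E A != 0.
  apply/eqP => e; have := addr_gt0 (addr_gt0 (addr_gt0 iAB iBD) iDE) iEA.
  by rewrite -!mulrDr -!ImD e mulr0 ltxx.
(* periodicity makes the integrals of [f] over opposite sides cancel *)
have per v a b : (v = v1 \/ v = v2) -> scont f a b ->
    (forall q : R, 0 <= q <= 1 -> ~ in_lat (seg a b q)) -> J f (a + v) (b + v) = J f a b.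
  move=> hv sf hq; rewrite /J (_ : b + v - (a + v) = b - a); last by ring.
  congr (_ * _); apply: pint_ext => q /hq hqq.
  rewrite (_ : seg (a + v) (b + v) q = seg a b q + v); last by rewrite /seg; ring.
  by have [_ h1 h2] := hf _ hqq; case: hv => ->; rewrite ?h1 ?h2 mul1r.
have edge (s t : R) : 0 <= s <= 1 -> 0 <= t <= 1 -> [\/ s = 0, s = 1 | t = 0 \/ t = 1] -> ~ in_lat (P s t).
  move=> hs ht he hlat; have [m [n [e1 e2]]] := lat_coord hlat.
  have m0 := small _ _ hs e1; have n0 := small _ _ ht e2.
  rewrite m0 in e1; rewrite n0 in e2; move: e1 e2 he; rewrite !mulr0z => e1 e2.
  by case=> [| |[]] h0; [case: (half_neq e1)|case: (half_neq e1)|case: (half_neq e2)|case: (half_neq e2)].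
have onside (s t s' t' : R) : 0 <= s <= 1 -> 0 <= t <= 1 -> 0 <= s' <= 1 -> 0 <= t' <= 1 ->
    [\/ s = 0 /\ s' = 0, s = 1 /\ s' = 1 | (t = 0 /\ t' = 0) \/ (t = 1 /\ t' = 1)] ->
    forall q : R, 0 <= q <= 1 -> ~ in_lat (seg (P s t) (P s' t') q).
  move=> hs ht hs' ht' he q hq; rewrite PB; apply: edge; [exact: segment_unit|exact: segment_unit|].
  by case: he => [[-> ->]|[-> ->]|[[-> ->]|[-> ->]]];
    rewrite subrr mulr0 addr0; [apply: Or31|apply: Or32|apply: Or33; left|apply: Or33; right].
have fsc a b : (forall q : R, 0 <= q <= 1 -> ~ in_lat (seg a b q)) -> scont f a b.
  by move=> hq; apply: scontP => q /hq /hf[/cdiff_cont].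
have Jf a b : scont phi a b -> scont inv a b -> (forall q : R, 0 <= q <= 1 -> ~ in_lat (seg a b q)) ->
    J f a b = c * J inv a b + J phi a b.
  move=> h1 h2 hq; rewrite -J_lin //; apply: J_ext => q /hq hqq.
  have z0 : seg a b q != 0 by apply/eqP => e; apply: hqq; rewrite e; exact: in_lattice0.
  by rewrite /inv /phi (negbTE z0) subr0; ring.
have oAB : forall q : R, 0 <= q <= 1 -> ~ in_lat (seg A B q).
  by apply: onside => //; apply: Or33; left.
have oBD : forall q : R, 0 <= q <= 1 -> ~ in_lat (seg B D q).
  by apply: onside => //; apply: Or32.
have oDE : forall q : R, 0 <= q <= 1 -> ~ in_lat (seg D E q).
  by apply: onside => //; apply: Or33; right.
have oEA : forall q : R, 0 <= q <= 1 -> ~ in_lat (seg E A q).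
  by apply: onside => //; apply: Or31.
have DB : D = B + v2 by rewrite /D /B /P !rmorphB /= rmorph0 rmorph1; ring.
have EA : E = A + v2 by rewrite /E /A /P !rmorphB /= rmorph0 rmorph1; ring.
have DE : D = E + v1 by rewrite /D /E /P !rmorphB /= rmorph0 rmorph1; ring.
have BA : B = A + v1 by rewrite /B /A /P !rmorphB /= rmorph0 rmorph1; ring.
have oAE : forall q : R, 0 <= q <= 1 -> ~ in_lat (seg A E q).
  by move=> q hq; rewrite seg_rev; apply: oEA; lra.
have c1 : J f D E = - J f A B.
  rewrite -(per v2 A B (or_intror erefl) (fsc _ _ oAB) oAB) -DB -EA.
  by rewrite (J_rev (fsc _ _ oDE)) opprK.
have c2 : J f B D = - J f E A.
  rewrite -(J_rev (fsc _ _ oEA)) BA DE; exact: per (or_introl erefl) (fsc _ _ oAE) oAE.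
have j1 := Jf A B (sphi 0 0 1 0 l01 l01 l11 l01) sAB oAB.
have j2 := Jf B D (sphi 1 0 1 1 l11 l01 l11 l11) sBD oBD.
have j3 := Jf D E (sphi 1 1 0 1 l11 l11 l01 l11) sDE oDE.
have j4 := Jf E A (sphi 0 1 0 0 l01 l11 l01 l01) sEA oEA.
apply: (mulIf isum); rewrite mul0r.
transitivity (J f A B + J f B D + J f D E + J f E A - (J phi A B + J phi B D + J phi D E + J phi E A)).
  rewrite j1 j2 j3 j4.
  move: (J inv A B) (J inv B D) (J inv D E) (J inv E A) (J phi A B) (J phi B D) (J phi D E) (J phi E A) => *.
  by ring.
rewrite sum0 c1 c2; move: (J f A B) (J f E A) => *; ring.
Qed.

(** Induction on the pole order: Liouville's theorem settles order 0, the residue theorem reduces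
    order 1 to it, and a monomial cancels the leading term of any higher order. *)
Lemma ell_ring k : forall c f, ell v1 v2 1 1 f -> pole k c f ->
  exists P : {poly {poly C}}, forall z, ~ in_lat z -> f z = (P.[(wp v1 v2 z)%:P]).[wp' v1 v2 z].
Proof.
elim: k => [|k IH] c f hf hp.
  by have [a ha] := ell_pole0 X0 hf hp; exists (a%:P)%:P => z /ha ->; rewrite !hornerC.
case: k IH hp => [|k] IH hp.
  have c0 := ell_pole1 hf hp; rewrite c0 in hp.
  by have [a ha] := pole_drop hp; apply: IH hf ha.
(* Every order from 2 on is 2i + 3j with j the parity; an odd order is at least 3, so the
   subtraction does not truncate. *)
pose j := odd k; pose i := (k.+2 - 3 * j)./2.
have eij : (i * 2 + j * 3 = k.+2)%N by rewrite /i /j; lia.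
have hm : pole k.+2 ((- 2) ^+ j) (fun z => wp v1 v2 z ^+ i * wp' v1 v2 z ^+ j).
  have := poleM (poleX i (wp_pole X0)) (poleX j wp'_pole).
  by rewrite eij expr1n mul1r.
pose a := c / (- 2) ^+ j.
have n2 : (- 2 : C) ^+ j != 0 by rewrite expf_neq0 // oppr_eq0.
have hp2 := pole_lin (- a) hm hp.
rewrite (_ : _ + c = 0) in hp2; last by rewrite /a mulNr divfK // addNr.
have [b hb] := pole_drop hp2.
have ellX g (n : nat) : ell v1 v2 1 1 g -> ell v1 v2 1 1 (fun z => g z ^+ n).
  move=> hg; elim: n => [|n IHn]; first exact: ell_const.
  apply: (ell_ext X0 (f := fun z => g z * g z ^+ n)) => [z _|]; first by rewrite exprS.
  by have := ellM hg IHn; rewrite mulr1.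
have hm2 : ell v1 v2 1 1 (fun z => wp v1 v2 z ^+ i * wp' v1 v2 z ^+ j).
  by have := ellM (ellX _ i ell_wp) (ellX _ j ell_wp'); rewrite mulr1.
have [Q hQ] := IH _ _ (ell_lin (- a) hm2 hf) hb.
(* The outer variable is evaluated at [wp] and the coefficients at [wp']. *)
exists (Q + (a *: 'X^j)%:P * 'X^i) => z hz.
rewrite hornerD hornerM hornerC hornerXn hornerD -(hQ z hz) hornerM hornerZ -polyC_exp hornerC hornerXn.
by ring.
Qed.

Definition mero_ell (u1 u2 : C) f := ell v1 v2 u1 u2 f /\ exists k c, pole k c f.

Lemma mero_ell_ext u1 u2 f g : (forall z, ~ in_lat z -> f z = g z) -> mero_ell u1 u2 f -> mero_ell u1 u2 g.
Proof.
move=> e [h1 [k [c h2]]]; split; first exact: ell_ext h1.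
by exists k, c; apply: pole_ext h2; apply: cpnear_imp (lattice_pnear X0 0) => w; apply: e.
Qed.

Lemma mero_ell_lin u1 u2 a f g : mero_ell u1 u2 f -> mero_ell u1 u2 g ->
  mero_ell u1 u2 (fun z => a * f z + g z).
Proof.
have raise k j c h : pole k c h -> exists c', pole (k + j) c' h.
  move=> hp; elim: j => [|j [c' IH]]; first by exists c; rewrite addn0.
  by exists 0; rewrite addnS; apply: pole_raise IH.
move=> [h1 [k [c h2]]] [h3 [m [d h4]]]; split; first exact: ell_lin.
have [c' h5] := raise _ m _ _ h2; have [d' h6] := raise _ k _ _ h4.
by rewrite addnC in h6; exists (k + m)%N, (a * c' + d'); apply: pole_lin.
Qed.

Lemma mero_ellM u1 u2 w1 w2 f g : mero_ell u1 u2 f -> mero_ell w1 w2 g ->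
  mero_ell (u1 * w1) (u2 * w2) (fun z => f z * g z).
Proof.
move=> [h1 [k [c h2]]] [h3 [m [d h4]]]; split; first exact: ellM.
by exists (k + m)%N, (c * d); apply: poleM.
Qed.

Lemma mero_ell_const c : mero_ell 1 1 (fun=> c).
Proof.
split; first exact: ell_const.
by exists 0%N, c; apply: (@pole0_cdiff _ (fun=> c)); apply: cnear_all => w; apply: cdiff_const.
Qed.

Lemma mero_ellZ u1 u2 a f : mero_ell u1 u2 f -> mero_ell u1 u2 (fun z => a * f z).
Proof. by move=> h; have := mero_ellM (mero_ell_const a) h; rewrite !mul1r. Qed.

Lemma mero_ell_ring (P : {poly {poly C}}) :
  mero_ell 1 1 (fun z => (P.[(wp v1 v2 z)%:P]).[wp' v1 v2 z]).
Proof.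
have gD f g : mero_ell 1 1 f -> mero_ell 1 1 g -> mero_ell 1 1 (fun z => f z + g z).
  by move=> hf hg; apply: mero_ell_ext (mero_ell_lin 1 hf hg) => z _; rewrite mul1r.
have gM f g : mero_ell 1 1 f -> mero_ell 1 1 g -> mero_ell 1 1 (fun z => f z * g z).
  by move=> hf hg; have := mero_ellM hf hg; rewrite mulr1.
have gw : mero_ell 1 1 (wp v1 v2) by split; [exact: ell_wp|exists 2%N, 1; exact: wp_pole].
have gw' : mero_ell 1 1 (wp' v1 v2) by split; [exact: ell_wp'|exists 3%N, (- 2); exact: wp'_pole].
have g1 (p : {poly C}) : mero_ell 1 1 (fun z => p.[wp' v1 v2 z]).
  elim/poly_ind: p => [|p c IH]; first by under eq_fun do rewrite horner0; apply: mero_ell_const.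
  by under eq_fun do rewrite hornerMXaddC; apply: (gD _ _ (gM _ _ IH gw') (mero_ell_const c)).
elim/poly_ind: P => [|P p IH]; first by under eq_fun do rewrite !horner0; apply: mero_ell_const.
under eq_fun do rewrite hornerMXaddC hornerD hornerM hornerC.
exact: gD _ _ (gM _ _ IH gw) (g1 p).
Qed.

End EllipticRing.

(** * Zeros of sections and a matrix of sections with determinant one *)

Section Frame.
Variable R : realType.
Local Notation C := (R[i]).
Implicit Types (f g G : C -> C) (a b c l u v w x z p : C) (m n : int) (k K : nat).
Variables v1 v2 : C.
Hypothesis X0 : cross v1 v2 != 0.
Local Notation in_lat := (in_lattice v1 v2).
Local Notation ell := (ell v1 v2).

Lemma cnear_neq0 g p : cnear p (cdiff g) -> g p != 0 -> cnear p (fun w => g w != 0).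
Proof.
move=> /cnear_at/cdiff_cont hg g0.
have g1 : 0 < cabs (g p) by rewrite cabs_gt0.
have [d d0 hd] := hg _ (divr_gt0 g1 (ltr0n _ 2)); exists d => // w /hd h.
by rewrite -cabs_gt0; have := cabs_subl (g p) (g w); rewrite (cabsC (g p)); lra.
Qed.

(* The indicator function of the set of points near which [f] vanishes
   identically is locally constant, hence constant by Liouville's theorem. *)
Lemma ell_order (u1 u2 : C) f k c p : u1 != 0 -> u2 != 0 -> ell u1 u2 f -> pole k c f -> c != 0 ->
  ~ in_lat p ->
  exists (j : nat) g, [/\ cnear p (cdiff g), g p != 0 & cnear p (fun w => f w = (w - p) ^+ j * g w)].
Proof.
move=> u10 u20 hf hp c0; pose I z : C := (`[< ~ in_lat z /\ cnear z (fun w => f w = 0) >])%:R.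
have I01 z : cabs (I z) <= 1 by rewrite /I; case: asboolP => _; rewrite ?cabs1 ?cabs0.
have dicho q : ~ in_lat q -> cnear q (fun w => f w = 0) \/
    exists (j : nat) g, [/\ cnear q (cdiff g), g q != 0 & cnear q (fun w => f w = (w - q) ^+ j * g w)].
  by move=> hq; apply: cdiff_order; apply: cnear_imp (lattice_near X0 hq) => w /hf[].
have I0 q : cpnear q (fun w => f w != 0) -> cnear q (fun w => I w = 0).
  move=> hq; have h q' : ~ cnear q' (fun w => f w = 0) -> I q' = 0.
    by move=> hn; rewrite /I; case: asboolP => // -[_ /hn].
  have [d d0 hd] := hq; exists d => // w hw; apply: h => hz.
  case: (eqVneq w q) => [e|wq].
    by rewrite e in hz; have [y _ [/eqP y1 y2]] := cpnear_ex (cpnearI hq (cnear_pnear hz)).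
  by have := hd w hw wq; rewrite (cnear_at hz) eqxx.
have Ic q : cdiff I q.
  have [hq|hq] := pselect (in_lat q).
    have [g [g1 g2 g3]] := ell_mero X0 u10 u20 hf hp hq.
    apply: (@cdiff_near _ (fun=> 0)); last exact: cdiff_const.
    apply: cnear_imp (I0 q _) => [w -> //|].
    have h : cpnear q (fun w => w != q) by exists 1.
    apply: cpnear_imp (cpnearI h (cpnearI g2 (cnear_pnear (cnear_neq0 g1 (g3 c0))))) => w [wq [-> gw]].
    by rewrite mulf_neq0 // invr_neq0 // expf_neq0 // subr_eq0.
  have [h|[j [g [g1 g2 g3]]]] := dicho q hq.
    apply: (@cdiff_near _ (fun=> 1)); last exact: cdiff_const.
    apply: cnear_imp (cnearI (lattice_near X0 hq) (cnear_open h)) => w hw.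
    by rewrite /I; case: asboolP.
  apply: (@cdiff_near _ (fun=> 0)); last exact: cdiff_const.
  apply: cnear_imp (I0 q _) => [w -> //|].
  have h : cpnear q (fun w => w != q) by exists 1.
  apply: cpnear_imp (cpnearI h (cpnearI (cnear_pnear g3) (cnear_pnear (cnear_neq0 g1 g2)))) => w [wq [-> gw]].
  by rewrite mulf_neq0 // expf_neq0 // subr_eq0.
move=> hpl; have [h|//] := dicho p hpl.
have := liouville Ic I01 p 0.
have -> : I p = 1 by rewrite /I; case: asboolP => // -[].
have -> : I 0 = 0 by rewrite /I; case: asboolP => // -[+ _]; case; exact: in_lattice0.
by move/eqP; rewrite oner_eq0.
Qed.

(** The logarithmic derivative at a zero of order [j], multiplied by [w - p] so that no exponent
    [j - 1] appears when [j = 0]. *)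
Lemma cder_order_mul f g (D E : C -> C) p (j : nat) :
  cnear p (fun w => f w = (w - p) ^+ j * g w) ->
  cnear p (fun w => cder f w (D w)) -> cnear p (fun w => cder g w (E w)) ->
  cnear p (fun w => (w - p) * D w = (w - p) ^+ j * (j%:R * g w + (w - p) * E w)).
Proof.
move=> h1 h2 h3; apply: cnear_imp (cnearI (cnear_open h1) (cnearI h2 h3)) => w [k1 [k2 k3]].
have hX : cder (fun y => (y - p) ^+ j) w (j%:R * (w - p) ^+ j.-1).
  case: j {h1 k1} => [|j] /=; first by rewrite mul0r; under eq_fun do rewrite expr0; apply: cder_const.
  exact: (@cder_shift _ (fun y => y ^+ j.+1) (- p) w _ (cderX j (w - p))).
have := cderM hX k3; move=> /(cder_near (cnear_imp (fun y e => esym e) k1)) k4.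
rewrite (cder_unique k2 k4); case: j {h1 k1 hX k4} => [|j] /=; first by rewrite expr0; ring.
by rewrite exprS; ring.
Qed.

Lemma cder_fun g p : cnear p (cdiff g) -> exists2 E : C -> C, cnear p (fun w => cder g w (E w)) & cnear p (cdiff E).
Proof.
move=> hg; have /choice[E hE] : forall w, exists l, cdiff g w -> cder g w l.
  by move=> w; have [[l hl]|no] := pselect (cdiff g w); [exists l|exists 0].
have h : cnear p (fun w => cder g w (E w)) by apply: cnear_imp hg => w /hE.
exists E => //; apply: cnear_imp (cnear_open h) => w; exact: cder_cdiff.
Qed.

(** The relation says that the logarithmic derivative of [g / f] is the constant [c]. It therefore
    has no poles, which is to say that the zeros of [f] and [g] have equal orders. *)
Lemma ell_log_der (u1 u2 w1 w2 : C) f g (D E : C -> C) c :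
  cabs u1 = 1 -> cabs u2 = 1 -> cabs w1 = 1 -> cabs w2 = 1 ->
  ell u1 u2 f -> ell w1 w2 g -> pole 1 1 f -> pole 1 1 g ->
  (forall z, ~ in_lat z -> cder f z (D z)) -> (forall z, ~ in_lat z -> cder g z (E z)) ->
  (forall z, ~ in_lat z -> f z * E z - g z * D z = c * (f z * g z)) ->
  w1 = u1 /\ w2 = u2.
Proof.
move=> hu1 hu2 hw1 hw2 hf hg pf pg hD hE hW.
have u10 := unitary_neq0 hu1; have u20 := unitary_neq0 hu2.
have w10 := unitary_neq0 hw1; have w20 := unitary_neq0 hw2.
have o1 : (1 : C) != 0 by exact: oner_neq0.
have ne p : cpnear p (fun w => w != p) by exists 1.
have loc p : exists g0, [/\ cnear p (cdiff g0), g0 p != 0 &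
    cpnear p (fun w => f w != 0 /\ g w / f w = g0 w)].
  have [hp|hp] := pselect (in_lat p).
    have [a [a1 a2 a3]] := ell_mero X0 u10 u20 hf pf hp.
    have [b [b1 b2 b3]] := ell_mero X0 w10 w20 hg pg hp.
    have an := cnear_neq0 a1 (a3 o1).
    exists (fun w => b w / a w); split.
    - by apply: cnear_imp (cnearI an (cnearI a1 b1)) => w [? [? ?]]; apply: cdiffM => //; apply: cdiffV.
    - by rewrite mulf_neq0 ?b3 // invr_neq0 // a3.
    apply: cpnear_imp (cpnearI (cpnearI (ne p) (cnear_pnear an)) (cpnearI a2 b2)) => w [[wp aw] [-> ->]].
    have wp0 : w - p != 0 by rewrite subr_eq0.
    by rewrite !expr1; split; [rewrite mulf_neq0 // invr_neq0|field; rewrite aw wp0].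
  have [j [a [a1 a2 a3]]] := ell_order u10 u20 hf pf o1 hp.
  have [i [b [b1 b2 b3]]] := ell_order w10 w20 hg pg o1 hp.
  have [A hA cA] := cder_fun a1; have [B hB cB] := cder_fun b1.
  have dD : cnear p (fun w => cder f w (D w)) by apply: cnear_imp (lattice_near X0 hp) => w; apply: hD.
  have dE : cnear p (fun w => cder g w (E w)) by apply: cnear_imp (lattice_near X0 hp) => w; apply: hE.
  have e1 := cder_order_mul a3 dD hA; have e2 := cder_order_mul b3 dE hB.
  have an := cnear_neq0 a1 a2.
  (* The relation multiplied by [w - p] and divided by the power i + j of [w - p]. It vanishes near
     [p], and its value at [p] is (i - j) a(p) b(p), so the orders agree. *)
  pose Q w := a w * (i%:R * b w + (w - p) * B w) - b w * (j%:R * a w + (w - p) * A w) - c * (w - p) * (a w * b w).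
  have Q0 : Q p = 0.
    apply: (@ccont_unique _ Q (fun=> 0) p).
    - apply: cdiff_cont.
      have ca := cnear_at a1; have cb := cnear_at b1; have cA' := cnear_at cA; have cB' := cnear_at cB.
      have cp : cdiff (fun w => w - p) p by apply: cdiffB (cdiff_id _) (cdiff_const _ _).
      apply: cdiffB; last by apply: cdiffM; [apply: cdiffZ|apply: cdiffM].
      by apply: cdiffB; apply: cdiffM => //; apply: cdiffD; [apply: cdiffZ|apply: cdiffM|apply: cdiffZ|apply: cdiffM].
    - exact/cdiff_cont/cdiff_const.
    have lp := lattice_near X0 hp.
    apply: cpnear_imp (cpnearI (cpnearI (ne p) (cnear_pnear lp)) (cpnearI (cpnearI (cnear_pnear a3) (cnear_pnear b3)) (cpnearI (cnear_pnear e1) (cnear_pnear e2)))) => w [[wp wl] [[fa gb] [k1 k2]]].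
    have wp0 : w - p != 0 by rewrite subr_eq0.
    have P0 : (w - p) ^+ j * (w - p) ^+ i != 0 by rewrite mulf_neq0 // expf_neq0.
    apply: (mulfI P0); rewrite mulr0.
    transitivity ((w - p) * (f w * E w - g w * D w - c * (f w * g w))); last by rewrite (hW w wl) subrr mulr0.
    transitivity (f w * ((w - p) * E w) - g w * ((w - p) * D w) - c * (w - p) * (f w * g w)); last by ring.
    rewrite k1 k2 fa gb /Q.
    by move: ((w - p) ^+ j) ((w - p) ^+ i) => y1 y2; ring.
  have ij : i = j.
    move: Q0; rewrite /Q subrr mulr0 !mul0r !addr0 subr0.
    rewrite (_ : _ - _ = (i%:R - j%:R) * (a p * b p)); last by ring.
    move/eqP; rewrite mulf_eq0 (negbTE (mulf_neq0 a2 b2)) orbF subr_eq0 eqr_nat.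
    by move/eqP.
  exists (fun w => b w / a w); split.
  - by apply: cnear_imp (cnearI an (cnearI a1 b1)) => w [? [? ?]]; apply: cdiffM => //; apply: cdiffV.
  - by rewrite mulf_neq0 // invr_neq0.
  apply: cpnear_imp (cpnearI (cpnearI (ne p) (cnear_pnear an)) (cpnearI (cnear_pnear a3) (cnear_pnear b3))) => w [[wp aw] [-> ->]].
  have wp0 : (w - p) ^+ j != 0 by rewrite expf_neq0 // subr_eq0.
  by rewrite ij; split; [rewrite mulf_neq0|rewrite -mulf_div mulfV // mul1r].
pose F w := g w / f w.
have hF p : exists2 g0, cnear p (cdiff g0) & cpnear p (fun w => F w = g0 w).
  by have [g0 [h1 _ h2]] := loc p; exists g0 => //; apply: cpnear_imp h2 => w [].
have sh p v u w : u != 0 -> (forall z, ~ in_lat z -> f (z + v) = u * f z) -> (forall z, ~ in_lat z -> g (z + v) = w * g z) ->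
    cpnear p (fun z => F (z + v) = (w / u) * F z).
  move=> u0 h1 h2; have [g0 [_ _ h3]] := loc p.
  apply: cpnear_imp (cpnearI (lattice_pnear X0 p) h3) => z [hz [fz _]].
  by rewrite /F h1 // h2 // mulf_div.
have cdiv (u w : C) : cabs u = 1 -> cabs w = 1 -> cabs (w / u) = 1.
  by move=> h1 h2; rewrite cabsM cabsV h1 h2 divr1.
have s1 p : cpnear p (fun z => F (z + v1) = (w1 / u1) * F z).
  by apply: sh => // z; [move=> /hf[]|move=> /hg[]].
have s2 p : cpnear p (fun z => F (z + v2) = (w2 / u2) * F z).
  by apply: sh => // z; [move=> /hf[]|move=> /hg[]].
have [c' [h1 h2 h3]] := ell_removable_unitary X0 (cdiv _ _ hu1 hw1) (cdiv _ _ hu2 hw2) hF s1 s2.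
(* The extension of [g / f] has no zero; the origin, a simple pole of both, is as good a point as
   any. *)
have c'0 : c' != 0.
  have [g0 [k1 k2 k3]] := loc 0.
  rewrite (_ : c' = g0 0) //; apply: (@ccont_unique _ (fun=> c') g0 0).
  - exact/cdiff_cont/cdiff_const.
  - exact: cdiff_cont (cnear_at k1).
  by apply: cpnear_imp (cpnearI (h1 0) k3) => w [<- [_ <-]].
have fin (u w : C) : u != 0 -> c' = w / u * c' -> w = u.
  move=> u0 e; have : w / u = 1 by apply: (mulIf c'0); rewrite mul1r -e.
  by move/eqP; rewrite -subr_eq0 -{1}(divff u0) -mulrBl mulf_eq0 invr_eq0 (negbTE u0) orbF subr_eq0 => /eqP.
by split; apply: fin.
Qed.

Lemma ell_frame (u1 u2 : C) : cabs u1 = 1 -> cabs u2 = 1 -> u1 != 1 -> u2 != 1 ->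
  (u1 ^+ 2 != 1) || (u2 ^+ 2 != 1) ->
  exists x y u v : C -> C, [/\ ell u1 u2 x, ell u1 u2 u, ell u1^-1 u2^-1 y & ell u1^-1 u2^-1 v] /\
   [/\ exists k c, pole k c x, exists k c, pole k c u, exists k c, pole k c y & exists k c, pole k c v] /\
   forall z, ~ in_lat z -> x z * v z - y z * u z = 1.
Proof.
move=> hu1 hu2 n1 n2 n12.
have u10 := unitary_neq0 hu1; have u20 := unitary_neq0 hu2.
have hv1 : cabs u1^-1 = 1 by rewrite cabsV hu1 invr1.
have hv2 : cabs u2^-1 = 1 by rewrite cabsV hu2 invr1.
have [s es ps] := ell_section X0 hu1 hu2 n1 n2.
have [||t et pt] := ell_section X0 hv1 hv2; rewrite ?invr_eq1 //.
have [D eD hD] := ell_der X0 es; have [E eE hE] := ell_der X0 et.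
have pD : pole 2 (- 1%:R * 1) D.
  by apply: pole_der ps _; apply: cpnear_imp (lattice_pnear X0 0) => w; apply: hD.
have pE : pole 2 (- 1%:R * 1) E.
  by apply: pole_der pt _; apply: cpnear_imp (lattice_pnear X0 0) => w; apply: hE.
have one (a b : C) : a != 0 -> b != 0 -> ell (a * a^-1) (b * b^-1) = ell 1 1.
  by move=> a0 b0; rewrite !divff.
have est : ell 1 1 (fun z => s z * t z) by rewrite -(one u1 u2) //; apply: ellM.
have pst : pole 2 1 (fun z => s z * t z) by have := poleM ps pt; rewrite mulr1.
have esE : ell 1 1 (fun z => s z * E z) by rewrite -(one u1 u2) //; apply: ellM.
have psE : pole 3 (-1) (fun z => s z * E z) by have := poleM ps pE; rewrite mul1r mulr1.
have etD : ell 1 1 (fun z => t z * D z).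
  by have := ellM et eD; rewrite !mulVf.
have ptD : pole 3 (-1) (fun z => t z * D z) by have := poleM pt pD; rewrite mul1r mulr1.
have eW := ell_lin (-1) etD esE.
(* Both triple poles have leading coefficient -1 and cancel. As [s * t] has leading coefficient 1,
   subtracting [c2] times it removes the double pole; the next coefficient [c1] is a residue. *)
have := pole_lin (-1) ptD psE; rewrite mulrNN mulr1 subrr => /pole_drop[c2 pW].
have eK := ell_lin (- c2) est eW.
have := pole_lin (- c2) pst pW; rewrite mulr1 addNr => /pole_drop[c1 pK1].
have c10 := ell_pole1 X0 eK pK1; rewrite c10 in pK1.
have [c0 pK0] := pole_drop pK1.
have [K hK] := ell_pole0 X0 eK pK0.
have K0 : K != 0.
  apply/eqP => e.
  have [e1 e2] : u1^-1 = u1 /\ u2^-1 = u2.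
    apply: (ell_log_der hu1 hu2 hv1 hv2 es et ps pt hD hE (c := c2)) => z hz.
    have := hK z hz; rewrite e => h; apply/eqP; rewrite -subr_eq0 -h; apply/eqP; ring.
  move: n12; rewrite !expr2 -{1}e1 -{1}e2 !mulVf // eqxx //.
exists s, (fun z => K^-1 * t z), D, (fun z => K^-1 * ((- c2) * t z + E z)).
have ev := ell_lin (- c2) et eE.
split; first by split => //; apply: ellZ.
split.
  split; [by exists 1%N, 1|by exists 2%N, (- 1%:R * 1)| |].
    by exists 1%N, (K^-1 * 1); apply: poleZ.
  by exists 2%N; eexists; apply: poleZ; apply: pole_lin pE; apply: pole_raise pt.
move=> z hz.
transitivity (K^-1 * (- c2 * (s z * t z) + (-1 * (t z * D z) + s z * E z))).
  by move: (K^-1) => y; ring.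
by rewrite (hK z hz) mulVf.
Qed.

End Frame.

Lemma ord2_ind (Q : 'I_2 -> 'I_2 -> Prop) : Q 0 0 -> Q 0 1 -> Q 1 0 -> Q 1 1 -> forall i j, Q i j.
Proof.
have e (i : 'I_2) : i = 0 \/ i = 1.
  by case: i => -[|[|//]] hi; [left|right]; apply: val_inj.
by move=> h1 h2 h3 h4 i j; case: (e i) => ->; case: (e j) => ->.
Qed.

(** * Explicit two-by-two matrices *)

Section TwoByTwo.
Variable F : comNzRingType.
Implicit Types (a b c d : F) (A : 'M[F]_2).

Definition mx2 a b c d : 'M[F]_2 :=
  \matrix_(i < 2, j < 2) (if i == 0 then if j == 0 then a else b else if j == 0 then c else d).

Lemma mx2_ext (A B : 'M[F]_2) : A 0 0 = B 0 0 -> A 0 1 = B 0 1 -> A 1 0 = B 1 0 -> A 1 1 = B 1 1 -> A = B.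
Proof. by move=> h1 h2 h3 h4; apply/matrixP; apply: ord2_ind. Qed.

Lemma mx2E A : A = mx2 (A 0 0) (A 0 1) (A 1 0) (A 1 1).
Proof. by apply: mx2_ext; rewrite mxE. Qed.

Lemma mx2M a b c d a' b' c' d' :
  mx2 a b c d *m mx2 a' b' c' d' = mx2 (a * a' + b * c') (a * b' + b * d') (c * a' + d * c') (c * b' + d * d').
Proof. by apply: mx2_ext; rewrite !mxE !big_ord_recl big_ord0 /= !mxE /= addr0. Qed.

Lemma mx2D a b c d a' b' c' d' :
  mx2 a b c d + mx2 a' b' c' d' = mx2 (a + a') (b + b') (c + c') (d + d').
Proof. by apply: mx2_ext; rewrite !mxE. Qed.

Lemma mx2N a b c d : - mx2 a b c d = mx2 (- a) (- b) (- c) (- d).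
Proof. by apply: mx2_ext; rewrite !mxE. Qed.

Lemma mx2Z k a b c d : k *: mx2 a b c d = mx2 (k * a) (k * b) (k * c) (k * d).
Proof. by apply: mx2_ext; rewrite !mxE. Qed.

Lemma mx2_scalar a : a%:M = mx2 a 0 0 a.
Proof. by apply: mx2_ext; rewrite !mxE. Qed.

Lemma mx2_tr a b c d : \tr (mx2 a b c d) = a + d.
Proof. by rewrite /mxtrace !big_ord_recl big_ord0 !mxE /= addr0. Qed.

End TwoByTwo.

(** * Automorphisms of sl2 of finite order *)

Section Automorphism.
Variable R : realType.
Local Notation C := (R[i]).
Implicit Types (a b c d : C) (A B : 'M[C]_2).

Definition sl2_e : 'M[C]_2 := mx2 0 1 0 0.
Definition sl2_f : 'M[C]_2 := mx2 0 0 1 0.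
Definition sl2_h : 'M[C]_2 := mx2 1 0 0 (-1).

Lemma sl2E A : in_sl2 A -> A = A 0 1 *: sl2_e + (A 1 0 *: sl2_f + A 0 0 *: sl2_h).
Proof.
rewrite {1 2}[A]mx2E /in_sl2 mx2_tr => h.
rewrite !mx2Z !mx2D; have -> : A 1 1 = - A 0 0 by apply/eqP; rewrite -addr_eq0 addrC h.
by congr mx2; ring.
Qed.

Lemma sl2_e_in : in_sl2 sl2_e. Proof. by rewrite /in_sl2 mx2_tr addr0. Qed.
Lemma sl2_f_in : in_sl2 sl2_f. Proof. by rewrite /in_sl2 mx2_tr addr0. Qed.
Lemma sl2_h_in : in_sl2 sl2_h. Proof. by rewrite /in_sl2 mx2_tr subrr. Qed.

Lemma lie_he : lie_br sl2_h sl2_e = 2 *: sl2_e.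
Proof. by rewrite /lie_br !mx2M mx2Z mx2N mx2D; congr mx2; ring. Qed.
Lemma lie_hf : lie_br sl2_h sl2_f = (-2) *: sl2_f.
Proof. by rewrite /lie_br !mx2M mx2Z mx2N mx2D; congr mx2; ring. Qed.
Lemma lie_ef : lie_br sl2_e sl2_f = sl2_h.
Proof. by rewrite /lie_br !mx2M mx2N mx2D; congr mx2; ring. Qed.

(** The polarised Cayley-Hamilton identity for traceless matrices. *)
Lemma sl2_anticomm A B : in_sl2 A -> in_sl2 B -> A *m B + B *m A = (\tr (A *m B))%:M.
Proof.
rewrite [A]mx2E [B]mx2E /in_sl2 !mx2_tr => /eqP; rewrite addrC addr_eq0 => /eqP ->.
move=> /eqP; rewrite addrC addr_eq0 => /eqP ->.
by rewrite !mx2M mx2_tr mx2_scalar mx2D; congr mx2; ring.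
Qed.

(** The triple vector product of sl2; it turns bracket relations into equations between traces. *)
Lemma sl2_double_bracket A B : in_sl2 A -> in_sl2 B ->
  lie_br A (lie_br A B) = (2 * \tr (A *m A)) *: B - (2 * \tr (A *m B)) *: A.
Proof.
rewrite [A]mx2E [B]mx2E /in_sl2 !mx2_tr => /eqP; rewrite addrC addr_eq0 => /eqP ->.
move=> /eqP; rewrite addrC addr_eq0 => /eqP ->.
by rewrite /lie_br !(mx2M, mx2_tr, mx2Z, mx2N, mx2D); congr mx2; ring.
Qed.


Lemma lie_brDr A B D a : lie_br A (a *: B + D) = a *: lie_br A B + lie_br A D.
Proof. by rewrite /lie_br mulmxDr mulmxDl -scalemxAr -scalemxAl scalerBr opprD addrACA. Qed.

Lemma lie_brZr A B a : lie_br A (a *: B) = a *: lie_br A B.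
Proof. by rewrite /lie_br -scalemxAr -scalemxAl scalerBr. Qed.

Lemma lie_xx A : lie_br A A = 0. Proof. exact: subrr. Qed.

(** The bracket relation determines the traces of [h *m h], [h *m e] and [e *m e], and the
    anticommutators then give the products themselves. *)
Lemma sl2_weight_vector (e h : 'M[C]_2) : in_sl2 e -> in_sl2 h -> e != 0 -> lie_br h e = 2 *: e ->
  h *m e = e /\ e *m e = 0.
Proof.
move=> se sh e0 he.
have two0 : 2 != 0 :> C by rewrite pnatr_eq0.
have h0 : h != 0.
  apply: (contraNneq _ e0) => h0; move: he; rewrite h0 /lie_br mul0mx mulmx0 subrr => /esym/eqP.
  by rewrite scaler_eq0 (negPf two0).
have hh := sl2_double_bracket sh se.
(* A further bracket with [h] kills the multiple of [h] and leaves an equation for the trace of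
   [h *m h] alone. *)
have := congr1 (lie_br h) hh.
rewrite -scaleNr addrC lie_brDr lie_xx scaler0 add0r !(he, lie_brZr, scalerA) => /eqP.
rewrite -subr_eq0 -scalerBl scaler_eq0 (negPf e0) orbF => /eqP q2.
have q : \tr (h *m h) = 2.
  by apply: (mulfI (mulf_neq0 two0 two0)); rewrite -[RHS]subr0 -q2; ring.
have p : \tr (h *m e) = 0.
  move: hh; rewrite he lie_brZr he q scalerA => /eqP.
  rewrite -subr_eq0 opprB addrC subrK scaler_eq0 (negPf h0) orbF mulf_eq0 (negPf two0) /=.
  by move/eqP.
have ac : h *m e = - (e *m h).
  by apply/eqP; rewrite -addr_eq0 sl2_anticomm // p -scalemx1 scale0r.
have e1 : h *m e = e.
  apply: (scalerI two0); rewrite -he /lie_br -[X in _ - X]opprK -ac opprK.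
  by rewrite scaler_nat mulr2n.
split=> //; have := sl2_double_bracket se sh.
have -> : lie_br e h = (- 2) *: e by rewrite scaleNr -he /lie_br opprB.
rewrite lie_brZr lie_xx scaler0 (mxtrace_mulC e h) p mulr0 scale0r subr0 => /esym/eqP.
rewrite scaler_eq0 (negPf h0) orbF mulf_eq0 (negPf two0) /= => /eqP t0.
have := sl2_anticomm se se; rewrite t0 -scalemx1 scale0r -mulr2n -scaler_nat => /eqP.
by rewrite scaler_eq0 (negPf two0) => /eqP.
Qed.

(* An sl2-triple acts irreducibly: a highest weight vector [v] gives the
   intertwining basis [v, f v]. *)
Lemma sl2_triple_conj (e f h : 'M[C]_2) : in_sl2 e -> in_sl2 f -> in_sl2 h -> e != 0 -> f != 0 ->
  lie_br h e = 2 *: e -> lie_br h f = (-2) *: f -> lie_br e f = h ->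
  exists2 g : 'M[C]_2, g \in unitmx & [/\ e *m g = g *m sl2_e, f *m g = g *m sl2_f & h *m g = g *m sl2_h].
Proof.
move=> se sf sh e0 f0 he hf ef.
have [e1 e2] := sl2_weight_vector se sh e0 he.
(* The pair of [f] and [- h] satisfies the same relation as that of [e] and [h]. *)
have [f1 f2] : - h *m f = f /\ f *m f = 0.
  apply: sl2_weight_vector => //; first by rewrite /in_sl2 raddfN /= sh oppr0.
  by rewrite /lie_br mulNmx mulmxN opprK -[X in X = _]opprK opprD opprK -/(lie_br h f) hf scaleNr opprK.
(* Any nonzero vector in the image of [e] is a highest weight vector, because [e *m e = 0]. *)
have [w w0] : exists w : 'cV[C]_2, e *m w != 0.
  apply: contrapT => hn; case/eqP: e0; apply/matrixP => i j; rewrite mxE.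
  have : e *m (delta_mx j 0 : 'cV[C]_2) = 0.
    by apply: contrapT => /eqP h1; apply: hn; exists (delta_mx j 0).
  rewrite -colE => /matrixP/(_ i 0); by rewrite !mxE.
set v := e *m w in w0.
have ev : e *m v = 0 by rewrite mulmxA e2 mul0mx.
have hv : h *m v = v by rewrite mulmxA e1.
have efv : e *m (f *m v) = v.
  by have := congr1 (fun M => M *m v) ef; rewrite /= mulmxBl -!mulmxA ev mulmx0 subr0 hv.
have hfv : h *m (f *m v) = - (f *m v) by rewrite mulmxA -[h]opprK mulNmx f1 mulNmx.
move: v w0 ev hv efv hfv => {w} v v0 ev hv efv hfv.
pose r0 : 'rV[C]_2 := delta_mx 0 0; pose r1 : 'rV[C]_2 := delta_mx 0 1.
have rE (M : 'M[C]_2) j : (delta_mx 0 j : 'rV_2) *m M = M j 0 *: r0 + M j 1 *: r1.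
  by rewrite -rowE; apply/rowP => i; rewrite !mxE; case: i => -[|[|//]] hi /=;
     rewrite ?mulr1 ?mulr0 ?addr0 ?add0r; congr (M j _); apply: val_inj.
have [r0e r1e] : r0 *m sl2_e = r1 /\ r1 *m sl2_e = 0.
  by rewrite !rE !mxE /= !scale0r scale1r addr0 add0r.
have [r0f r1f] : r0 *m sl2_f = 0 /\ r1 *m sl2_f = r0.
  by rewrite !rE !mxE /= !scale0r scale1r !addr0.
have [r0h r1h] : r0 *m sl2_h = r0 /\ r1 *m sl2_h = - r1.
  by rewrite !rE !mxE /= !scale0r scale1r scaleN1r addr0 add0r.
exists (v *m r0 + f *m v *m r1); last first.
  rewrite !mulmxDr !mulmxDl -!mulmxA r0e r1e r0f r1f r0h r1h !mulmxA ev -(mulmxA e f) efv f2 hv.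
  by rewrite -(mulmxA h f) hfv !mul0mx -!mulmxA !mulmx0 !addr0 !add0r !mulmxN !mulNmx !mulmxA.
rewrite unitmxE -det_tr unitfE; apply/det0P => -[u u0]; rewrite raddfD /= !trmx_mul.
(* Applying [e] kills [v] and sends [f *m v] back to [v], which isolates [b]. *)
have key (a b : C) : a *: v + b *: (f *m v) = 0 -> a = 0 /\ b = 0.
  move=> hab; have b0 : b = 0.
    have := congr1 (mulmx e) hab; rewrite mulmx0 mulmxDr -!scalemxAr ev efv scaler0 add0r => /eqP.
    by rewrite scaler_eq0 (negPf v0) orbF => /eqP.
  by move: hab; rewrite b0 scale0r addr0 => /eqP; rewrite scaler_eq0 (negPf v0) orbF => /eqP.
move=> /(congr1 trmx); rewrite trmx_mul raddfD /= !trmx_mul !trmxK trmx0 mulmxDl -!mulmxA.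
have rr j : (delta_mx 0 j : 'rV[C]_2) *m u^T = (u 0 j)%:M.
  by rewrite -rowE; apply/matrixP => x y; rewrite !ord1 !mxE eqxx mulr1n.
rewrite !rr !mulmxA !mul_mx_scalar => /key[a0 b0].
case/eqP: u0; apply/rowP => -[[|[|//]] hi]; rewrite mxE; [rewrite -[RHS]a0|rewrite -[RHS]b0];
  by congr (u _ _); apply: val_inj.
Qed.

Lemma sl2_centralizer_scalar (M : 'M[C]_2) : (forall A, in_sl2 A -> A *m M = M *m A) -> exists c, M = c%:M.
Proof.
move=> h; have := h _ sl2_e_in; have := h _ sl2_f_in; rewrite [M]mx2E !mx2M => /matrixP hf /matrixP he.
have := hf 1 0; have := he 0 0; have := he 0 1; have := hf 1 1; rewrite !mxE /= => h1 h2 h3 h4.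
exists (M 0 0); rewrite mx2_scalar; congr mx2.
- by move: h1; rewrite !(mul0r, mul1r, mulr0, mulr1, addr0, add0r).
- by move: h3; rewrite !(mul0r, mul1r, mulr0, mulr1, addr0, add0r).
- by move: h2; rewrite !(mul0r, mul1r, mulr0, mulr1, addr0, add0r).
Qed.

(** The minimal polynomial divides X^N - c, which is separable as c is nonzero, and it splits over
    the complex numbers. *)
Lemma finite_order_diagonalizable (N : nat) (g : 'M[C]_2) c : (0 < N)%N -> c != 0 -> g ^+ N = c%:M ->
  exists2 P : 'M[C]_2, P \in unitmx & exists a b, g *m P = P *m mx2 a 0 0 b.
Proof.
move=> N0 c0 hg; pose p : {poly C} := 'X^N - c%:P.
have sp : separable_poly p.
  (* The Bezout relation is X p' - N p = N c, a nonzero constant. *)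
  rewrite unlock; apply/Bezout_coprimepP; exists (- N%:R, 'X) => /=.
  have -> : - N%:R * p + 'X * p^`() = (N%:R * c)%:P.
    rewrite /p derivB derivXn derivC subr0 -(prednK N0) exprS polyCM polyC_natr -mulr_natl.
    by move: ('X^(N.-1)) => x /=; ring.
  by rewrite polyC_eqp1 mulf_neq0 // pnatr_eq0 -lt0n.
have [rs hrs] := closed_field_poly_normal p.
have lp : lead_coef p = 1 by apply/monicP; apply: monicXnsubC.
rewrite lp scale1r in hrs.
have urs : uniq rs by rewrite -separable_prod_XsubC -hrs.
have [Q uQ /similar_diagPex[D /(similarRL uQ) hD]] : diagonalizable g.
  apply/diagonalizableP; exists rs => //; rewrite -hrs; apply: mxminpoly_min.
  by rewrite /p rmorphB rmorphXn /= horner_mx_X horner_mx_C hg subrr.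
exists (invmx Q); first by rewrite unitmx_inv.
exists (D 0 0), (D 0 1).
have <- : diag_mx D = mx2 (D 0 0) 0 0 (D 0 1) by apply: mx2_ext; rewrite !mxE ?mulr0n ?mulr1n.
by rewrite hD -mulmxA mulKmx.
Qed.

Lemma conjM (P A B : 'M[C]_2) : P \in unitmx ->
  (P *m A *m invmx P) *m (P *m B *m invmx P) = P *m (A *m B) *m invmx P.
Proof. by move=> uP; rewrite -!mulmxA (mulKmx uP). Qed.

Lemma conj_lie (A B M1 M2 : 'M[C]_2) : B *m A = 1%:M ->
  lie_br (A *m M1 *m B) (A *m M2 *m B) = A *m lie_br M1 M2 *m B.
Proof.
move=> h; have k M M' : (A *m M *m B) *m (A *m M' *m B) = A *m (M *m M') *m B.
  by rewrite !mulmxA -!(mulmxA _ B A) h !mulmx1.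
by rewrite /lie_br !k mulmxBr mulmxBl.
Qed.

Section Aut.
Variable r : 'M[C]_2 -> 'M[C]_2.
Hypothesis hr : is_sl2_aut r.

Lemma aut_in A : in_sl2 A -> in_sl2 (r A). Proof. by case: hr => + _; apply. Qed.

Lemma aut_lin a A B : in_sl2 A -> in_sl2 B -> r (a *: A + B) = a *: r A + r B.
Proof. by case: hr => _ [+ _]; apply. Qed.

Lemma sl2_0 : in_sl2 (0 : 'M[C]_2). Proof. exact: raddf0. Qed.

Lemma aut0 : r 0 = 0.
Proof.
have := aut_lin 1 sl2_0 sl2_0; rewrite !scale1r addr0 => /eqP.
by rewrite -subr_eq subrr eq_sym => /eqP.
Qed.

Lemma autZ a A : in_sl2 A -> r (a *: A) = a *: r A.
Proof. by move=> hA; have := aut_lin a hA sl2_0; rewrite !addr0 aut0 addr0. Qed.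

Lemma aut_neq0 A : in_sl2 A -> A != 0 -> r A != 0.
Proof.
case: hr => _ [_ [_ [inj _]]] hA; apply: contraNneq => h; apply/eqP; apply: inj => //.
  exact: sl2_0.
by rewrite h aut0.
Qed.

(** The images of the standard basis form again an sl2-triple, and a matrix intertwining the two
    triples induces the automorphism by linearity. *)
Lemma aut_conj : exists2 g : 'M[C]_2, g \in unitmx & forall A, in_sl2 A -> r A *m g = g *m A.
Proof.
have [_ [_ [br _]]] := hr.
have e0 : sl2_e != 0 by apply/eqP => /matrixP/(_ 0 1)/eqP; rewrite !mxE /= oner_eq0.
have f0 : sl2_f != 0 by apply/eqP => /matrixP/(_ 1 0)/eqP; rewrite !mxE /= oner_eq0.
have [||||||||g ug [ge gf gh]] := @sl2_triple_conj (r sl2_e) (r sl2_f) (r sl2_h).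
- exact: aut_in sl2_e_in.
- exact: aut_in sl2_f_in.
- exact: aut_in sl2_h_in.
- exact: aut_neq0 sl2_e_in e0.
- exact: aut_neq0 sl2_f_in f0.
- by rewrite -br ?lie_he ?autZ //; [exact: sl2_e_in|exact: sl2_h_in|exact: sl2_e_in].
- by rewrite -br ?lie_hf ?autZ //; [exact: sl2_f_in|exact: sl2_h_in|exact: sl2_f_in].
- by rewrite -br ?lie_ef //; [exact: sl2_e_in|exact: sl2_f_in].
exists g => // A hA; rewrite (sl2E hA).
have hh : in_sl2 (A 0 0 *: sl2_h) by rewrite -[X in in_sl2 X]addr0 -[X in _ + X](scale0r sl2_h) /in_sl2 raddfD /= !linearZ /= sl2_h_in !mulr0 addr0.
have hfh : in_sl2 (A 1 0 *: sl2_f + A 0 0 *: sl2_h).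
  by rewrite /in_sl2 raddfD /= !linearZ /= sl2_h_in sl2_f_in !mulr0 addr0.
rewrite !aut_lin ?autZ //; [|exact: sl2_h_in|exact: sl2_f_in|exact: sl2_e_in].
by rewrite !mulmxDl !mulmxDr -!scalemxAl -!scalemxAr ge gf gh.
Qed.

(* In a basis diagonalising [g], [Ad g] multiplies the root vectors by
   [eps = a / b] and its inverse. *)
Lemma aut_diag (N : nat) : (0 < N)%N -> aut_of_order N r ->
  exists (P : 'M[C]_2) (eps : C), [/\ P \in unitmx, eps ^+ N = 1,
    (forall k, (0 < k < N)%N -> eps ^+ k != 1) &
    forall a b c, r (P *m mx2 a b c (- a) *m invmx P) = P *m mx2 a (eps * b) (eps^-1 * c) (- a) *m invmx P].
Proof.
move=> N0 [_ [hN hk]]; have [g ug hg] := aut_conj.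
have it k A : in_sl2 A -> in_sl2 (iter k r A) /\ iter k r A *m g ^+ k = g ^+ k *m A.
  move=> hA; elim: k => [|k [IH1 IH2]] /=; first by rewrite mulmx1 mul1mx.
  split; first exact: aut_in.
  by rewrite exprS -mulmxE mulmxA hg // -mulmxA IH2 mulmxA.
(* As the N-th iterate of [r] is the identity, [g ^+ N] commutes with all of sl2. *)
have [c hc] : exists c, g ^+ N = c%:M.
  by apply: sl2_centralizer_scalar => A hA; have := (it N A hA).2; rewrite hN.
have c0 : c != 0.
  apply/eqP => c0; have : g ^+ N \is a GRing.unit by apply: unitrX.
  by rewrite hc c0 raddf0 unitr0.
have [P uP [a [b hab]]] := finite_order_diagonalizable N0 c0 hc.
have uD : mx2 a 0 0 b \in unitmx.
  by rewrite -(mulKmx uP (mx2 a 0 0 b)) -hab unitmx_mul unitmx_inv uP unitmx_mul ug.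
have e0 : sl2_e != 0 by apply/eqP => /matrixP/(_ 0 1)/eqP; rewrite !mxE /= oner_eq0.
have f0 : sl2_f != 0 by apply/eqP => /matrixP/(_ 1 0)/eqP; rewrite !mxE /= oner_eq0.
have a0 : a != 0.
  apply: contra_neq e0 => a0; rewrite -(mulKmx uD sl2_e) a0 mx2M.
  by rewrite !(mul0r, mulr0, addr0) -mx2_scalar raddf0 mulmx0.
have b0 : b != 0.
  apply: contra_neq f0 => b0; rewrite -(mulKmx uD sl2_f) b0 mx2M.
  by rewrite !(mul0r, mulr0, addr0) -mx2_scalar raddf0 mulmx0.
have conjr x y z : r (P *m mx2 x y z (- x) *m invmx P) = P *m mx2 x (a / b * y) ((a / b)^-1 * z) (- x) *m invmx P.
  apply: (can_inj (mulmxK ug)); rewrite hg; last first.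
    by rewrite /in_sl2 mxtrace_mulC mulKmx // mx2_tr subrr.
  have -> : g = P *m mx2 a 0 0 b *m invmx P by rewrite -hab mulmxK.
  rewrite !(conjM _ _ uP) !mx2M; apply: (congr1 (fun M => P *m M *m invmx P)).
  by congr mx2; field; rewrite ?a0 ?b0.
have itE k x y z : iter k r (P *m mx2 x y z (- x) *m invmx P) =
    P *m mx2 x ((a / b) ^+ k * y) ((a / b) ^- k * z) (- x) *m invmx P.
  elim: k => [|k IH] /=; first by rewrite invr1 !mul1r.
  by rewrite IH conjr !mulrA -exprVn -!exprS exprVn.
exists P, (a / b); split => // [|k hk0].
  have h : in_sl2 (P *m mx2 0 1 0 (-0) *m invmx P).
    by rewrite /in_sl2 mxtrace_mulC mulKmx // mx2_tr subrr.
  have := hN _ h; rewrite itE => /(can_inj (mulmxK (_ : invmx P \in unitmx))).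
  rewrite unitmx_inv => /(_ uP)/(can_inj (mulKmx uP))/matrixP/(_ 0 1).
  by rewrite !mxE /= mulr1.
have [A [hA]] := hk k hk0; apply: contraNneq => ek.
have -> : A = P *m (invmx P *m A *m P) *m invmx P by rewrite !mulmxA mulmxV // mul1mx mulmxK.
have : \tr (invmx P *m A *m P) = 0 by rewrite mxtrace_mulC mulmxA mulmxV // mul1mx.
move: (invmx P *m A *m P) => B; rewrite [B]mx2E mx2_tr addrC => /eqP; rewrite addr_eq0 => /eqP ->.
by rewrite itE ek invr1 !mul1r.
Qed.
End Aut.
End Automorphism.

(** * The superlattice and its characters *)

Section Superlattice.
Variable R : realType.
Local Notation C := (R[i]).
Implicit Types (a b c l u v w x z p : C) (m n : int) (k K : nat).

(** The cross product is bilinear, unlike the imaginary part of a quotient, and so behaves well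
    under change of basis. *)
Lemma lattice_cross w1 w2 : is_lattice w1 w2 <-> cross w1 w2 != 0.
Proof.
rewrite /is_lattice; split.
  move=> [w0]; apply: contraNneq => h; rewrite -complexIm Im_div_cross // h mul0r; exact/eqP.
move=> h; have w0 : w1 != 0 by apply: contraNneq h => ->; rewrite /cross /=; apply/eqP; ring.
split=> //; rewrite -complexIm Im_div_cross // (_ : 0 = 0%:C) // (inj_eq (@complexI R)).
by rewrite mulf_neq0 // invr_neq0 // expf_neq0 // cabs_eq0.
Qed.

Lemma lattice_sub_cross v1 v2 w1 w2 : in_lattice v1 v2 w1 -> in_lattice v1 v2 w2 ->
  cross w1 w2 != 0 -> cross v1 v2 != 0.
Proof.
move=> [m [n ->]] [m' [n' ->]]; apply: contraNneq => h; apply/eqP.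
transitivity ((m%:~R * n'%:~R - n%:~R * m'%:~R) * cross v1 v2); last by rewrite h mulr0.
rewrite !intrC !crossD !crossZ (crossC _ v1) (crossC _ v2) !crossD !crossZ !crossxx (crossC v2 v1).
by ring.
Qed.

Lemma in_lattice_sub v1 v2 w1 w2 z : in_lattice v1 v2 w1 -> in_lattice v1 v2 w2 ->
  in_lattice w1 w2 z -> in_lattice v1 v2 z.
Proof. by move=> h1 h2 [m [n ->]]; apply: in_latticeD; apply: in_latticeM. Qed.

(** Two steps of integral row reduction on the relation N t = m w1 + n w2. Bezout for m and N gives
    [v1] and a combination of [t] and [w1] on the line of [w2]; Bezout for n and gcd(m, N) merges
    that combination with [w2] into [v2]. The integers [k1] and [k2] are the coefficients of [t]. *)
Lemma superlattice_basis w1 w2 (N : nat) t : (0 < N)%N -> in_lattice w1 w2 (N%:R * t) ->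
  exists v1 v2 (k1 k2 : int), [/\ in_lattice w1 w2 (v1 - k1%:~R * t), in_lattice w1 w2 (v2 - k2%:~R * t),
    in_lattice v1 v2 w1, in_lattice v1 v2 w2 & in_lattice v1 v2 t].
Proof.
move=> N0 [m [n hN]].
have Nz : (N%:Z != 0)%R by case: (N) N0.
have [al [be hg]] := Bezoutz m N%:Z; set g := gcdz m N%:Z in hg.
have g0 : g != 0 by rewrite gcdz_eq0 negb_and Nz orbT.
have [ga [de hd]] := Bezoutz n g; set d := gcdz n g in hd.
have d0 : d != 0 by rewrite gcdz_eq0 negb_and g0 orbT.
have [m' em] : exists m', m = m' * g by apply/dvdzP; apply: dvdz_gcdl.
have [N' eN] : exists N', N%:Z = N' * g by apply/dvdzP; apply: dvdz_gcdr.
have [n' en] : exists n', n = n' * d by apply/dvdzP; apply: dvdz_gcdl.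
have [g' eg] : exists g', g = g' * d by apply/dvdzP; apply: dvdz_gcdr.
have b1 : al * m' + be * N' = 1.
  by apply: (mulIf g0); rewrite mulrDl -!mulrA -em -eN hg mul1r.
have b2 : ga * n' + de * g' = 1.
  by apply: (mulIf d0); rewrite mulrDl -!mulrA -en -eg hd mul1r.
have g'0 : g' != 0 by apply: contraNneq g0 => h; rewrite eg h mul0r.
have B1 : al%:~R * m'%:~R + be%:~R * N'%:~R = 1 :> C by rewrite -!rmorphM -rmorphD b1.
have B2 : ga%:~R * n'%:~R + de%:~R * g'%:~R = 1 :> C by rewrite -!rmorphM -rmorphD b2.
have G0 : g'%:~R != 0 :> C by rewrite intr_eq0.
have D0 : d%:~R != 0 :> C by rewrite intr_eq0.
have rel : g'%:~R * (N'%:~R * t - m'%:~R * w1) = n'%:~R * w2.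
  apply: (mulfI D0).
  have -> : d%:~R * (n'%:~R * w2) = N%:R * t - m%:~R * w1 by rewrite hN en rmorphM /=; ring.
  have -> : N%:R = (N%:Z)%:~R :> C by [].
  by rewrite eN em eg !rmorphM /=; ring.
pose v1 := al%:~R * t + be%:~R * w1.
pose v2 := ga%:~R * (N'%:~R * t - m'%:~R * w1) + de%:~R * w2.
have r1 : w2 = g'%:~R * v2.
  by rewrite /v2 mulrDr mulrCA rel -{1}[w2]mul1r -{1}B2; ring.
have r2 : N'%:~R * t - m'%:~R * w1 = n'%:~R * v2.
  by apply: (mulfI G0); rewrite rel r1; ring.
have r3 : w1 = N'%:~R * v1 - al%:~R * n'%:~R * v2.
  by rewrite -mulrA -r2 -{1}[w1]mul1r -{1}B1 /v1; ring.
have r4 : t = m'%:~R * v1 + be%:~R * n'%:~R * v2.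
  by rewrite -mulrA -r2 -{1}[t]mul1r -{1}B1 /v1; ring.
exists v1, v2, al, (ga * N'); split.
- by exists be, 0; rewrite /v1; ring.
- by exists (- (ga * m')), de; rewrite /v2 !rmorphM rmorphN rmorphM /=; ring.
- by exists N', (- (al * n')); rewrite {1}r3 rmorphN rmorphM /=; ring.
- by exists 0, g'; rewrite {1}r1; ring.
- by exists m', (be * n'); rewrite {1}r4 rmorphM /=.
Qed.

End Superlattice.

(** * Characters of the superlattice and invariance under translation *)

Section Characters.
Variable R : realType.
Local Notation C := (R[i]).
Implicit Types (f g : C -> C) (e c z p : C) (m n : int) (k : nat).
Variables (w1 w2 t v1 v2 : C) (N : nat) (k1 k2 : int).
Hypothesis N0 : (0 < N)%N.
Hypothesis ht : translation_of_order w1 w2 N t.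
Hypothesis X0 : cross v1 v2 != 0.
Hypothesis V1 : in_lattice w1 w2 (v1 - k1%:~R * t).
Hypothesis V2 : in_lattice w1 w2 (v2 - k2%:~R * t).
Hypothesis W1 : in_lattice v1 v2 w1.
Hypothesis W2 : in_lattice v1 v2 w2.
Hypothesis Wt : in_lattice v1 v2 t.
Local Notation in_lat := (in_lattice v1 v2).

Lemma modN m : exists2 k : nat, (k < N)%N & exists q : int, m = q * N%:Z + k%:Z.
Proof.
exists `|(m %% N)%Z|%N.
  by rewrite -ltz_nat gez0_abs ?modz_ge0 ?ltz_pmod //; case: (N) N0.
by exists (m %/ N)%Z; rewrite gez0_abs ?modz_ge0 -?divz_eq //; case: (N) N0.
Qed.

Lemma order_dvd m : in_lattice w1 w2 (m%:~R * t) -> exists q, m = q * N%:Z.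
Proof.
have [h1 h2] := ht; have [k kN [q em]] := modN m; move=> h; exists q.
suff k0 : k = 0%N by rewrite em k0 addr0.
case: (posnP k) => // k0; exfalso.
apply: (h2 k); first by rewrite k0 kN.
have -> : k%:R * t = m%:~R * t - q%:~R * (N%:R * t).
  by rewrite em rmorphD rmorphM /=; ring.
by apply: in_latticeB => //; apply: in_latticeM.
Qed.

Lemma in_S_lattice z : in_S w1 w2 t z <-> in_lat z.
Proof.
have [h1 _] := ht; split => [[k hk]|[m [n ez]]].
  rewrite -(subrK (k%:R * t) z); apply: in_latticeD (in_lattice_sub W1 W2 hk) _.
  exact: (in_latticeM (Posz k)).
(* [in_S] asks for a natural multiple of [t], so the integral coefficient is reduced modulo N, with
   N t in the smaller lattice. *)
have [k _ [q eq]] := modN (m * k1 + n * k2); exists k.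
have -> : z - k%:R * t = m%:~R * (v1 - k1%:~R * t) + n%:~R * (v2 - k2%:~R * t) + q%:~R * (N%:R * t).
  have : (m%:~R * k1%:~R + n%:~R * k2%:~R : C) = q%:~R * N%:R + k%:R.
    by rewrite -!rmorphM -rmorphD eq rmorphD rmorphM.
  move=> /eqP; rewrite -subr_eq0 => /eqP e; apply/eqP; rewrite -subr_eq0; apply/eqP.
  by rewrite -(mulr0 t) -e ez; ring.
by apply: in_latticeD; [apply: in_latticeD|]; apply: in_latticeM.
Qed.

Lemma root_unity_intz e m n q : e ^+ N = 1 -> m = n + q * N%:Z -> e ^ m = e ^ n.
Proof.
move=> he ->; have e0 : e != 0.
  by apply: contraTneq (oner_neq0 C) => h; rewrite -he h expr0n eqn0Ngt N0 /= eqxx.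
by rewrite expfzDr // mulrC -exprz_exp exprzAC [e ^ N]he exp1rz mul1r.
Qed.

(* [e ^ k1] and [e ^ k2] are the values at [v1] and [v2] of the character of
   the superlattice that is trivial on [w1], [w2] and sends [t] to [e]. *)
Lemma mero_ell_char e f : e ^+ N = 1 ->
  mero_ell v1 v2 (e ^ k1) (e ^ k2) f <->
  (forall z, ~ in_lat z -> [/\ cdiff f z, f (z + w1) = f z, f (z + w2) = f z & f (z + t) = e * f z]) /\
  (exists k c, pole k c f).
Proof.
move=> he; have e0 : e != 0.
  by apply: contraTneq (oner_neq0 C) => h; rewrite -he h expr0n eqn0Ngt N0 /= eqxx.
split=> -[hf hp]; split=> // z hz.
  have sh w j : in_lat w -> in_lattice w1 w2 (w - j%:~R * t) -> f (z + w) = e ^ j * f z.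
    move=> [m [n ew]] h; have [|q eq] := @order_dvd (m * k1 + n * k2 - j).
      have -> : (m * k1 + n * k2 - j)%:~R * t =
          (w - j%:~R * t) - (m%:~R * (v1 - k1%:~R * t) + n%:~R * (v2 - k2%:~R * t)).
        by rewrite ew rmorphB rmorphD !rmorphM /=; ring.
      by apply: in_latticeB => //; apply: in_latticeD; apply: in_latticeM.
    rewrite ew (ell_int m n _ _ hf) ?expfz_neq0 // !exprz_exp -expfzDr //; congr (_ * _).
    by apply: (root_unity_intz (q := q)) => //; rewrite -eq; ring.
  have [a1 _ _] := hf z hz; split=> //.
  - by have := sh w1 0 W1; rewrite mul0r subr0 expr0z mul1r; apply; apply: in_lattice1.
  - by have := sh w2 0 W2; rewrite mul0r subr0 expr0z mul1r; apply; apply: in_lattice2.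
  - by have := sh t 1 Wt; rewrite mul1r subrr expr1z; apply; apply: in_lattice0.
have sh v j : in_lattice w1 w2 (v - j%:~R * t) -> f (z + v) = e ^ j * f z.
  move=> [m [n ev]]; have -> : v = m%:~R * w1 + n%:~R * w2 + j%:~R * t by rewrite -ev subrK.
  rewrite !addrA (shift_int e0 Wt) => [|y /hf[]//|]; last first.
    by apply: notin_lat_shift (in_latticeM n W2) _; apply: notin_lat_shift (in_latticeM m W1) hz.
  have one : (1 : C) != 0 by exact: oner_neq0.
  rewrite (shift_int one W2) => [|y /hf[_ _ ->]|]; rewrite ?mul1r //; last first.
    exact: notin_lat_shift (in_latticeM m W1) hz.
  by rewrite (shift_int one W1) => [|y /hf[_ -> _ _]|]; rewrite ?mul1r // !exp1rz !mul1r.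
have [a1 _ _ _] := hf z hz; split; [exact: a1|exact: sh V1|exact: sh V2].
Qed.

Lemma unity_root_cabs e : e ^+ N = 1 -> cabs e = 1.
Proof.
move=> he; apply/eqP; rewrite -(@pexpr_eq1 _ _ N) ?cabs_ge0 // -cabsX he cabs1 //.
Qed.


Lemma sqrt_neq1 (c : C) : exists2 b : C, b * b = c & b != 1.
Proof.
have h : sqrtC c * sqrtC c = c by rewrite -expr2 sqrtCK.
case: (eqVneq (sqrtC c) 1) => [e|]; last by exists (sqrtC c).
exists (-1); first by rewrite mulrNN mul1r -h e mulr1.
by rewrite eq_sym -subr_eq0 opprK -(natrD _ 1 1) pnatr_eq0.
Qed.

Lemma gauge_frame e : e ^+ N = 1 -> (forall k, (0 < k < N)%N -> e ^+ k != 1) ->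
  exists (p1 p2 : C) (x y u v : C -> C),
    [/\ p1 * p1 = e ^ k1, p2 * p2 = e ^ k2, p1 != 0 & p2 != 0] /\
    [/\ mero_ell v1 v2 p1 p2 x, mero_ell v1 v2 p1 p2 u, mero_ell v1 v2 p1^-1 p2^-1 y,
        mero_ell v1 v2 p1^-1 p2^-1 v & forall z, ~ in_lat z -> x z * v z - y z * u z = 1].
Proof.
move=> he hk; have [N1|N1] := leqP N 1.
  (* The trivial character is its own square root and the identity matrix is a frame. *)
  have eN : N = 1%N by apply/eqP; rewrite eqn_leq N1 N0.
  have e1 : e = 1 by rewrite -he eN expr1.
  exists 1, 1, (fun=> 1), (fun=> 0), (fun=> 0), (fun=> 1).
  split; first by rewrite e1 !exp1rz !mulr1 oner_neq0.
  have h c := mero_ell_const v1 v2 c.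
  by split; rewrite ?invr1 //; move=> z _; ring.
have [p1 h1 n1] := sqrt_neq1 (e ^ k1); have [p2 h2 n2] := sqrt_neq1 (e ^ k2).
have cb (k : int) (p : C) : p * p = e ^ k -> cabs p = 1.
  move=> hp; have : (p * p) ^+ N = 1 by rewrite hp -[_ ^+ N]/(_ ^ (N : int)) exprzAC [e ^ N]he exp1rz.
  move/unity_root_cabs; rewrite cabsM -expr2 => /eqP; rewrite pexpr_eq1 ?cabs_ge0 //.
  by move/eqP.
have c1 := cb _ _ h1; have c2 := cb _ _ h2.
(* Otherwise the character is trivial on both basis vectors, so the constant 1 is a section of it
   and has multiplier [e] at [t], whence [e = 1]. *)
have n12 : (p1 ^+ 2 != 1) || (p2 ^+ 2 != 1).
  rewrite -negb_and; apply/negP => /andP[/eqP q1 /eqP q2].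
  have /(mero_ell_char _ he)[h _] : mero_ell v1 v2 (e ^ k1) (e ^ k2) (fun=> 1).
    by rewrite -h1 -h2 -!expr2 q1 q2; apply: mero_ell_const.
  have [z _ hz] := cpnear_ex (lattice_pnear X0 0).
  have [_ _ _] := h _ hz; rewrite mulr1 => e1; have := hk 1%N N1.
  by rewrite expr1 -e1 eqxx.
have [x [y [u [v [[a1 a2 a3 a4] [[b1 b2 b3 b4] d]]]]]] := ell_frame X0 c1 c2 n1 n2 n12.
by exists p1, p2, x, y, u, v; split; split => //; apply: unitary_neq0.
Qed.

Local Notation O := (O_TT w1 w2 t).

Lemma O_TT_ext f g : (forall z, ~ in_lat z -> f z = g z) -> O f -> O g.
Proof.
move=> e [h1 [h2 h3]]; split; [|split] => z; rewrite in_S_lattice => hz.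
- have a1 := notin_lat_shift W1 hz; have a2 := notin_lat_shift W2 hz.
  by rewrite -!e //; apply: h1; rewrite in_S_lattice.
- apply/holo_atP; apply: (@cdiff_near _ f); first by apply: cnear_imp (lattice_near X0 hz) => w; apply: e.
  by apply/holo_atP; apply: h2; rewrite in_S_lattice.
have hS : in_S w1 w2 t z by rewrite in_S_lattice.
have /mero_atP[k [u [u1 u2]]] := h3 z hS; apply/mero_atP.
exists k, u; split=> //; apply: cpnear_imp (cpnearI u2 (lattice_pnear X0 z)) => w [<- hw].
by rewrite e.
Qed.

Lemma mero_at_lin (a : C) f g p : mero_at f p -> mero_at g p -> mero_at (fun z => a * f z + g z) p.
Proof.
move=> /mero_atP[k [u [u1 u2]]] /mero_atP[m [v [q1 q2]]]; apply/mero_atP.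
exists (k + m)%N, (fun z => a * (u z * (z - p) ^+ m) + v z * (z - p) ^+ k); split.
  have hX (n : nat) w : cdiff (fun z : C => (z - p) ^+ n) w.
    apply: (@cdiff_shift _ (fun z => z ^+ n)); exact: cdiffX (cdiff_id _).
  apply: cnear_imp (cnearI u1 q1) => w [hu hv].
  by apply: cdiffD; [apply: cdiffZ|]; apply: cdiffM.
have h : cpnear p (fun w => w != p) by exists 1.
apply: cpnear_imp (cpnearI h (cpnearI u2 q2)) => w [wp [-> ->]].
have n0 (n : nat) : (w - p) ^+ n != 0 by rewrite expf_neq0 // subr_eq0.
by rewrite exprD; move: (n0 k) (n0 m) => ? ?; field; apply/andP.
Qed.

Lemma O_TT_lin (a : C) f g : O f -> O g -> O (fun z => a * f z + g z).
Proof.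
move=> [f1 [f2 f3]] [g1 [g2 g3]]; split; [|split] => z hz.
- by have [-> ->] := f1 z hz; have [-> ->] := g1 z hz.
- apply/holo_atP; apply: cdiffD; [apply: cdiffZ|]; apply/holo_atP; [exact: f2|exact: g2].
by apply: mero_at_lin; [apply: f3|apply: g3].
Qed.

Lemma O_TT_const (c : C) : O (fun=> c).
Proof.
split=> //; split=> z _; first by apply/holo_atP; apply: cdiff_const.
apply/mero_atP; exists 0%N, (fun=> c); split; first by apply: cnear_all => w; apply: cdiff_const.
by exists 1 => // w _ _; rewrite divr1.
Qed.

(** Translates between multipliers on the basis [v1], [v2], where elliptic function theory applies,
    and the eigenvalue under translation by [t], which the group action prescribes. *)
Lemma mero_ell_O_TT e f : e ^+ N = 1 ->
  mero_ell v1 v2 (e ^ k1) (e ^ k2) f <-> O f /\ forall z, ~ in_lat z -> f (z + t) = e * f z.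
Proof.
move=> he; have e0 : e != 0.
  by apply: contraTneq (oner_neq0 C) => h; rewrite -he h expr0n eqn0Ngt N0 /= eqxx.
split=> [hf|[[h1 [h2 h3]] h4]]; last first.
  apply/mero_ell_char => //; split; last first.
    by apply: mero_pole; apply: h3; rewrite in_S_lattice; apply: in_lattice0.
  move=> z hz; have hS : ~ in_S w1 w2 t z by rewrite in_S_lattice.
  by have [a1 a2] := h1 z hS; split => //; [apply/holo_atP; apply: h2|apply: h4].
have [h hp] := (mero_ell_char f he).1 hf; split=> [|z /h[]//].
split; [|split] => z; rewrite in_S_lattice => hz.
- by have [] := h z hz.
- by apply/holo_atP; have [] := h z hz.
case: hf => hf [k [c hk]]; apply/mero_atP.
have [g [g1 g2 _]] := ell_mero X0 (expfz_neq0 k1 e0) (expfz_neq0 k2 e0) hf hk hz.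
by exists k, g.
Qed.

Lemma O_TT_shift f m : O f -> forall z, ~ in_lat z -> f (z + m%:~R * (N%:R * t)) = f z.
Proof.
move=> [h _] z hz; have h' w : ~ in_lat w -> f (w + w1) = 1 * f w /\ f (w + w2) = 1 * f w.
  by move=> hw; rewrite !mul1r; apply: h; rewrite in_S_lattice.
have one : (1 : C) != 0 by exact: oner_neq0.
have [a [b ->]] := ht.1; rewrite mulrDr !mulrA -!rmorphM addrA.
rewrite (shift_int one W2) => [|y /h'[]//|]; last exact: notin_lat_shift (in_latticeM _ W1) hz.
by rewrite (shift_int one W1) ?exp1rz ?mul1r // => y /h'[].
Qed.

Lemma s_invariant_mero_ell f : s_invariant_fun w1 w2 t N f <-> mero_ell v1 v2 1 1 f.
Proof.
have o : (1 : C) ^+ N = 1 by rewrite expr1n.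
have := mero_ell_O_TT f o; rewrite !exp1rz => ->.
split=> -[h1 h2]; (split=> //); [move=> z hz|].
  (* For N = 1 invariance is only required for [k = 0], and periodicity in [t] holds because [t]
     lies in the original lattice. *)
  rewrite mul1r; have hzt := notin_lat_shift Wt hz; case: (ltnP 1 N) => [N1|].
    rewrite -[in RHS](addrK t z) -[X in _ - X]mul1r; apply/esym.
    by apply: (h2 1%N N1); rewrite in_S_lattice.
  rewrite leq_eqVlt ltnNge N0 orbF => /eqP N1.
  by have := O_TT_shift 1 h1 hz; rewrite N1 !mul1r.
move=> k _ z; rewrite in_S_lattice => hz; elim: k => [|k IH]; first by rewrite mul0r subr0.
rewrite -IH -[k.+1%:R]natr1 mulrDl mul1r opprD addrA.
have hk : ~ in_lat (z - k%:R * t) by apply: notin_lat_shift (in_latticeN _) hz; apply: (in_latticeM (Posz k)).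
by rewrite -{2}(subrK t (z - k%:R * t)) h2 ?mul1r //; apply: (notin_lat_shift (in_latticeN Wt)) hk.
Qed.

End Characters.

(** * The gauge transformation *)

Section Gauge.
Variable R : realType.
Local Notation C := (R[i]).
Implicit Types (f g a b c : C -> C) (e z p : C) (m n : int) (k : nat) (X Y Z : C -> 'M[C]_2).
Variables (w1 w2 t v1 v2 : C) (N : nat) (k1 k2 : int).
Hypothesis N0 : (0 < N)%N.
Hypothesis ht : translation_of_order w1 w2 N t.
Hypothesis X0 : cross v1 v2 != 0.
Hypothesis V1 : in_lattice w1 w2 (v1 - k1%:~R * t).
Hypothesis V2 : in_lattice w1 w2 (v2 - k2%:~R * t).
Hypothesis W1 : in_lattice v1 v2 w1.
Hypothesis W2 : in_lattice v1 v2 w2.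
Hypothesis Wt : in_lattice v1 v2 t.
Local Notation in_lat := (in_lattice v1 v2).
Local Notation mell := (mero_ell v1 v2).
Local Notation O := (O_TT w1 w2 t).
Let S_lat := in_S_lattice N0 ht V1 V2 W1 W2 Wt.

Lemma O_TT_mulmx_l (A : 'M[C]_2) X : (forall i j, O (fun z => X z i j)) ->
  forall i j, O (fun z => (A *m X z) i j).
Proof.
move=> h i j; apply: (O_TT_ext N0 ht X0 V1 V2 W1 W2 Wt
    (f := fun z => A i 0 * X z 0 j + (A i 1 * X z 1 j + 0))) => [z _|].
  rewrite mxE !big_ord_recl big_ord0; congr (_ + (A i _ * X z _ j + _)); exact: val_inj.
apply: (O_TT_lin _ (h _ _)); apply: (O_TT_lin _ (h _ _)); exact: O_TT_const.
Qed.

Lemma O_TT_mulmx_r (A : 'M[C]_2) X : (forall i j, O (fun z => X z i j)) ->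
  forall i j, O (fun z => (X z *m A) i j).
Proof.
move=> h i j; have e z : (X z *m A) i j = (A^T *m (X z)^T) j i by rewrite -trmx_mul [RHS]mxE.
under eq_fun do rewrite e; apply: (@O_TT_mulmx_l A^T (fun z => (X z)^T)) => k l.
by under eq_fun do rewrite mxE.
Qed.

Variables (r : 'M[C]_2 -> 'M[C]_2) (P : 'M[C]_2) (eps : C).
Hypothesis hr : aut_of_order N r.
Hypothesis uP : P \in unitmx.
Hypothesis epsN : eps ^+ N = 1.
Hypothesis rP : forall x y z : C,
  r (P *m mx2 x y z (- x) *m invmx P) = P *m mx2 x (eps * y) (eps^-1 * z) (- x) *m invmx P.
Local Notation q1 := (eps ^ k1).
Local Notation q2 := (eps ^ k2).
Local Notation rs := (rs_invariant w1 w2 t N r).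

Definition gauged a b c z := P *m mx2 (a z) (b z) (c z) (- a z) *m invmx P.

Lemma eps_neq0 : eps != 0.
Proof. by apply: contraTneq (oner_neq0 C) => h; rewrite -epsN h expr0n eqn0Ngt N0 /= eqxx. Qed.

Lemma mell_O f : mell q1 q2 f <-> O f /\ forall z, ~ in_lat z -> f (z + t) = eps * f z.
Proof. exact: (mero_ell_O_TT N0 ht X0 V1 V2 W1 W2 Wt f epsN). Qed.

Lemma mell_OV f : mell q1^-1 q2^-1 f <-> O f /\ forall z, ~ in_lat z -> f (z + t) = eps^-1 * f z.
Proof.
have h : eps^-1 ^+ N = 1 by rewrite exprVn epsN invr1.
by rewrite !invr_expz -!exprz_inv; exact: (mero_ell_O_TT N0 ht X0 V1 V2 W1 W2 Wt f h).
Qed.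

Lemma mell_O1 f : mell 1 1 f <-> O f /\ forall z, ~ in_lat z -> f (z + t) = f z.
Proof.
have h : (1 : C) ^+ N = 1 by rewrite expr1n.
have := mero_ell_O_TT N0 ht X0 V1 V2 W1 W2 Wt f h; rewrite !exp1rz => ->.
by split=> -[h1 h2]; split=> // z /h2; rewrite mul1r.
Qed.

Lemma rs_ext X Y : (forall z, ~ in_lat z -> X z = Y z) -> rs X -> rs Y.
Proof.
move=> e [[h1 h2] h3]; split; [split|].
- move=> i j; apply: (O_TT_ext N0 ht X0 V1 V2 W1 W2 Wt _ (h1 i j)) => z hz.
  by rewrite e.
- by move=> z hz; rewrite -e -?S_lat //; apply: h2.
move=> k kN z hz; rewrite -!e -?S_lat //; first exact: h3.
move: hz; rewrite !S_lat; apply: notin_lat_shift.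
by apply: in_latticeN; apply: (in_latticeM (Posz k)).
Qed.

Lemma gauged_rs a b c : mell 1 1 a -> mell q1 q2 b -> mell q1^-1 q2^-1 c -> rs (gauged a b c).
Proof.
move=> /mell_O1[a1 a2] /mell_O[b1 b2] /mell_OV[c1 c2]; split; [split|].
- apply: O_TT_mulmx_r; apply: O_TT_mulmx_l; apply: ord2_ind; under eq_fun do rewrite mxE /=; [exact: a1|exact: b1|exact: c1|].
  under eq_fun do rewrite -[- _]addr0 -mulN1r.
  by apply: O_TT_lin => //; apply: O_TT_const.
- by move=> z _; rewrite /in_sl2 /gauged mxtrace_mulC mulKmx // mx2_tr subrr.
have step z : ~ in_lat z -> r (gauged a b c (z - t)) = gauged a b c z.
  move=> hz; have hzt := notin_lat_shift (in_latticeN Wt) hz.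
  have := a2 _ hzt; have := b2 _ hzt; have := c2 _ hzt; rewrite subrK /gauged rP => -> -> ->.
  by [].
move=> k _ z; rewrite S_lat; elim: k z => [|k IH] z hz; first by rewrite mul0r subr0.
have hzt := notin_lat_shift (in_latticeN Wt) hz.
by rewrite -[k.+1%:R]nat1r mulrDl mul1r opprD addrA iterS IH // step.
Qed.

Lemma rs_gauged X : rs X -> exists a b c, [/\ mell 1 1 a, mell q1 q2 b, mell q1^-1 q2^-1 c &
  forall z, ~ in_lat z -> X z = gauged a b c z].
Proof.
move=> [[h1 h2] h3]; pose M z := invmx P *m X z *m P.
have XM z : X z = P *m M z *m invmx P by rewrite /M !mulmxA mulmxV // mul1mx mulmxK.
have MO : forall i j, O (fun z => M z i j) by apply: O_TT_mulmx_r; apply: O_TT_mulmx_l.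
have Mtr z : ~ in_lat z -> M z = mx2 (M z 0 0) (M z 0 1) (M z 1 0) (- M z 0 0).
  move=> hz; have : \tr (M z) = 0.
    by rewrite /M mxtrace_mulC mulmxA mulmxV // mul1mx; apply: h2; rewrite S_lat.
  by rewrite {1 2}[M z]mx2E mx2_tr addrC => /eqP; rewrite addr_eq0 => /eqP ->.
clearbody M.
(* For N = 1 the invariance hypothesis concerns [k = 0] only; then [r] is the identity on sl2 and
   [t] is a period. *)
have step z : ~ in_lat z -> r (X z) = X (z + t).
  move=> hz; have hzt := notin_lat_shift Wt hz; have [N1|] := ltnP 1 N.
    have := h3 1%N N1 (z + t); rewrite S_lat mul1r addrK /=; exact.
  rewrite leq_eqVlt ltnNge N0 orbF => /eqP N1.
  have [_ [+ _]] := hr; rewrite N1 /= => -> //; last by apply: h2; rewrite S_lat.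
  apply/matrixP => i j.
  by have := O_TT_shift N0 ht V1 V2 W1 W2 Wt 1 (h1 i j) hz; rewrite N1 !mul1r.
have Mstep z : ~ in_lat z -> mx2 (M (z + t) 0 0) (M (z + t) 0 1) (M (z + t) 1 0) (- M (z + t) 0 0) =
    mx2 (M z 0 0) (eps * M z 0 1) (eps^-1 * M z 1 0) (- M z 0 0).
  move=> hz; have hzt := notin_lat_shift Wt hz; rewrite -Mtr //.
  have := step z hz; rewrite !XM {1}Mtr // rP.
  move=> /(can_inj (mulmxK _)) h; apply/esym/(can_inj (mulKmx uP)); apply: h.
  by rewrite unitmx_inv.
exists (fun z => M z 0 0), (fun z => M z 0 1), (fun z => M z 1 0); split.
- apply/mell_O1; split=> // z /Mstep/matrixP/(_ 0 0); by rewrite !mxE /=.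
- apply/mell_O; split=> // z /Mstep/matrixP/(_ 0 1); by rewrite !mxE /=.
- apply/mell_OV; split=> // z /Mstep/matrixP/(_ 1 0); by rewrite !mxE /=.
by move=> z hz; rewrite /gauged -Mtr // XM.
Qed.


Variables (p1 p2 : C) (x y u v : C -> C).
Hypothesis sq1 : p1 * p1 = q1.
Hypothesis sq2 : p2 * p2 = q2.
Hypothesis p10 : p1 != 0.
Hypothesis p20 : p2 != 0.
Hypothesis hx : mell p1 p2 x.
Hypothesis hu : mell p1 p2 u.
Hypothesis hy : mell p1^-1 p2^-1 y.
Hypothesis hv : mell p1^-1 p2^-1 v.
Hypothesis det1 : forall z, ~ in_lat z -> x z * v z - y z * u z = 1.
Local Notation sinv := (in_current_sinv w1 w2 t N).

(** The rows carry the characters psi and psi^-1. The inverse [coframe] is the adjugate, the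
    determinant being 1, so its entries have poles on the lattice only. *)
Definition frame z := P *m mx2 (x z) (u z) (y z) (v z).
Definition coframe z := mx2 (v z) (- u z) (- y z) (x z) *m invmx P.
Definition gauge Z z := frame z *m Z z *m coframe z.
Definition ungauge X z := coframe z *m X z *m frame z.

Lemma frameK z : ~ in_lat z -> frame z *m coframe z = 1%:M.
Proof.
move=> /det1 h; rewrite /frame /coframe mulmxA -(mulmxA P) mx2M.
suff -> : mx2 (x z * v z + u z * - y z) (x z * - u z + u z * x z) (y z * v z + v z * - y z)
    (y z * - u z + v z * x z) = 1%:M by rewrite mulmx1 mulmxV.
by rewrite mx2_scalar; congr mx2; rewrite -?h; ring.
Qed.

Lemma coframeK z : ~ in_lat z -> coframe z *m frame z = 1%:M.
Proof. by move=> /frameK/mulmx1C. Qed.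

Lemma ungaugeK X z : ~ in_lat z -> gauge (ungauge X) z = X z.
Proof.
rewrite /gauge /ungauge => /frameK; move: (frame z) (coframe z) => A B h.
by rewrite !mulmxA h mul1mx -mulmxA h mulmx1.
Qed.

Lemma gaugeK Z z : ~ in_lat z -> ungauge (gauge Z) z = Z z.
Proof.
rewrite /gauge /ungauge => /coframeK; move: (frame z) (coframe z) => A B h.
by rewrite !mulmxA h mul1mx -mulmxA h mulmx1.
Qed.

Lemma mellM11 f g (s1 s2 : C) : s1 != 0 -> s2 != 0 -> mell s1 s2 f -> mell s1^-1 s2^-1 g ->
  mell 1 1 (fun z => f z * g z).
Proof. by move=> s10 s20 hf hg; have := mero_ellM hf hg; rewrite !mulfV. Qed.

Lemma mellMV f g (s1 s2 : C) : s1 != 0 -> s2 != 0 -> mell s1^-1 s2^-1 f -> mell s1 s2 g ->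
  mell 1 1 (fun z => f z * g z).
Proof. by move=> s10 s20 hf hg; have := mero_ellM hf hg; rewrite !mulVf. Qed.

Lemma mellMq f g : mell p1 p2 f -> mell p1 p2 g -> mell q1 q2 (fun z => f z * g z).
Proof. by move=> hf hg; have := mero_ellM hf hg; rewrite sq1 sq2. Qed.

Lemma mellMqV f g : mell p1^-1 p2^-1 f -> mell p1^-1 p2^-1 g -> mell q1^-1 q2^-1 (fun z => f z * g z).
Proof. by move=> hf hg; have := mero_ellM hf hg; rewrite -!invfM sq1 sq2. Qed.

Lemma mellM1 f g (s1 s2 : C) : mell 1 1 f -> mell s1 s2 g -> mell s1 s2 (fun z => f z * g z).
Proof. by move=> hf hg; have := mero_ellM hf hg; rewrite !mul1r. Qed.

Lemma ungauge_sinv X : rs X -> sinv (ungauge X).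
Proof.
move=> hX; have [a [b [c [ha hb hc hXe]]]] := rs_gauged hX.
(* The entries of the conjugated matrix: in each monomial the characters cancel, as psi^2 = chi. The
   factors 1 and -1 give the shape that [mero_ell_lin] expects. *)
pose al z := 1 * (a z * (x z * v z)) + (1 * (a z * (u z * y z)) + (1 * (b z * (v z * y z)) + - 1 * (c z * (x z * u z)))).
pose be z := 2 * (a z * (u z * v z)) + (1 * (b z * (v z * v z)) + - 1 * (c z * (u z * u z))).
pose ga z := (- 2) * (a z * (x z * y z)) + (- 1 * (b z * (y z * y z)) + 1 * (c z * (x z * x z))).
have e z : ~ in_lat z -> ungauge X z = mx2 (al z) (be z) (ga z) (- al z).
  move=> hz; rewrite /ungauge (hXe _ hz) /gauged /frame /coframe !mulmxA !(mulmxKV uP) !mx2M.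
  by congr mx2; rewrite /al /be /ga; ring.
have q10 : q1 != 0 by rewrite expfz_neq0 // eps_neq0.
have q20 : q2 != 0 by rewrite expfz_neq0 // eps_neq0.
have hal : mell 1 1 al.
  apply: mero_ell_lin; first exact: mellM1 ha (mellM11 p10 p20 hx hv).
  apply: mero_ell_lin; first exact: mellM1 ha (mellM11 p10 p20 hu hy).
  apply: mero_ell_lin; first exact: mellM11 q10 q20 hb (mellMqV hv hy).
  by apply: mero_ellZ; apply: mellMV q10 q20 hc (mellMq hx hu).
have hbe : mell 1 1 be.
  apply: mero_ell_lin; first exact: mellM1 ha (mellM11 p10 p20 hu hv).
  apply: mero_ell_lin; first exact: mellM11 q10 q20 hb (mellMqV hv hv).
  by apply: mero_ellZ; apply: mellMV q10 q20 hc (mellMq hu hu).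
have hga : mell 1 1 ga.
  apply: mero_ell_lin; first exact: mellM1 ha (mellM11 p10 p20 hx hy).
  apply: mero_ell_lin; first exact: mellM11 q10 q20 hb (mellMqV hy hy).
  by apply: mero_ellZ; apply: mellMV q10 q20 hc (mellMq hx hx).
split=> [|z]; last by rewrite S_lat => /e ->; rewrite /in_sl2 mx2_tr subrr.
move=> i j; rewrite (s_invariant_mero_ell N0 ht X0 V1 V2 W1 W2 Wt).
apply: (mero_ell_ext X0 (f := fun z => mx2 (al z) (be z) (ga z) (- al z) i j)) => [z /e -> //|].
move: i j; apply: ord2_ind; under eq_fun do rewrite mxE /=; [exact: hal|exact: hbe|exact: hga|].
by under eq_fun do rewrite -mulN1r; apply: mero_ellZ.
Qed.

Lemma gauge_rs Z : sinv Z -> rs (gauge Z).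
Proof.
move=> [h1 h2]; pose al z := Z z 0 0; pose be z := Z z 0 1; pose ga z := Z z 1 0.
have hm i j : mell 1 1 (fun z => Z z i j) by rewrite -(s_invariant_mero_ell N0 ht X0 V1 V2 W1 W2 Wt).
have hal := hm 0 0; have hbe := hm 0 1; have hga := hm 1 0; rewrite -/al -/be -/ga in hal hbe hga.
have e z : ~ in_lat z -> Z z = mx2 (al z) (be z) (ga z) (- al z).
  move=> hz; have : \tr (Z z) = 0 by apply: h2; rewrite S_lat.
  rewrite {1 2}[Z z]mx2E mx2_tr addrC => /eqP; rewrite addr_eq0 => /eqP ->.
  by rewrite /al /be /ga.
(* Conversely, products of two entries of the frame carry the characters 1, chi and chi^-1 of [a],
   [b] and [c]. *)
pose a z := 1 * (al z * (x z * v z)) + (1 * (al z * (u z * y z)) + (- 1 * (be z * (x z * y z)) + 1 * (ga z * (u z * v z)))).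
pose b z := (- 2) * (al z * (x z * u z)) + (1 * (be z * (x z * x z)) + - 1 * (ga z * (u z * u z))).
pose c z := 2 * (al z * (y z * v z)) + (- 1 * (be z * (y z * y z)) + 1 * (ga z * (v z * v z))).
apply: (rs_ext (X := gauged a b c)) => [z hz|].
  rewrite /gauge /frame /coframe (e _ hz) mulmxA -(mulmxA P) mx2M -(mulmxA P) mx2M.
  apply: (congr1 (fun M => P *m M *m invmx P)).
  by congr mx2; rewrite /a /b /c; ring.
apply: gauged_rs.
- apply: mero_ell_lin; first exact: mellM1 hal (mellM11 p10 p20 hx hv).
  apply: mero_ell_lin; first exact: mellM1 hal (mellM11 p10 p20 hu hy).
  apply: mero_ell_lin; first exact: mellM1 hbe (mellM11 p10 p20 hx hy).
  by apply: mero_ellZ; apply: mellM1 hga (mellM11 p10 p20 hu hv).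
- apply: mero_ell_lin; first exact: mellM1 hal (mellMq hx hu).
  apply: mero_ell_lin; first exact: mellM1 hbe (mellMq hx hx).
  by apply: mero_ellZ; apply: mellM1 hga (mellMq hu hu).
- apply: mero_ell_lin; first exact: mellM1 hal (mellMqV hy hv).
  apply: mero_ell_lin; first exact: mellM1 hbe (mellMqV hy hy).
  by apply: mero_ellZ; apply: mellM1 hga (mellMqV hv hv).
Qed.

Lemma ungauge_lin (s : C) X Y z : ungauge (fun z => s *: X z + Y z) z = s *: ungauge X z + ungauge Y z.
Proof. by rewrite /ungauge mulmxDr mulmxDl -scalemxAr -scalemxAl. Qed.

Lemma gauge_br Y Z z : ~ in_lat z -> gauge (cur_br Y Z) z = lie_br (gauge Y z) (gauge Z z).
Proof. by move=> /coframeK h; rewrite /gauge conj_lie. Qed.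

Lemma ungauge_br X Y z : ~ in_lat z -> ungauge (cur_br X Y) z = lie_br (ungauge X z) (ungauge Y z).
Proof. by move=> /frameK h; rewrite /ungauge conj_lie. Qed.

Local Notation eqT := (eqTT w1 w2 t).
Local Notation ring := (in_wp_ring w1 w2 t v1 v2).

Lemma in_wp_ringP f : ring f <-> mell 1 1 f.
Proof.
split=> [[Q hQ]|[h [k [c hp]]]].
  by apply: mero_ell_ext (mero_ell_ring X0 Q) => // z; rewrite -S_lat => /hQ.
have [Q hQ] := ell_ring X0 h hp.
by exists Q => z; rewrite S_lat => /hQ.
Qed.

Lemma sinv_const (M : 'M[C]_2) : in_sl2 M -> sinv (fun=> M).
Proof.
move=> hM; split=> // i j.
by rewrite (s_invariant_mero_ell N0 ht X0 V1 V2 W1 W2 Wt); apply: mero_ell_const.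
Qed.

Lemma sinvZ f (M : 'M[C]_2) : mell 1 1 f -> in_sl2 M -> sinv (fun z => f z *: M).
Proof.
move=> hf hM; split=> [i j|z _]; last by rewrite /in_sl2 linearZ /= hM mulr0.
rewrite (s_invariant_mero_ell N0 ht X0 V1 V2 W1 W2 Wt).
by under eq_fun do rewrite mxE mulrC; apply: mero_ellZ.
Qed.

Lemma sinvD Y Z : sinv Y -> sinv Z -> sinv (fun z => Y z + Z z).
Proof.
move=> [y1 y2] [z1 z2]; split=> [i j|z hz]; last by rewrite /in_sl2 raddfD /= y2 // z2 // addr0.
rewrite (s_invariant_mero_ell N0 ht X0 V1 V2 W1 W2 Wt); under eq_fun do rewrite mxE -[Y _ _ _]mul1r.
by apply: mero_ell_lin; rewrite -(s_invariant_mero_ell N0 ht X0 V1 V2 W1 W2 Wt).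
Qed.

Local Notation E := (gauge (fun=> sl2_e R)).
Local Notation F := (gauge (fun=> sl2_f R)).
Local Notation H := (gauge (fun=> sl2_h R)).
Local Notation comb f g h := (cur_add (cur_fmul f E) (cur_add (cur_fmul g F) (cur_fmul h H))).

Lemma combE f g h z : comb f g h z = gauge (fun z => f z *: sl2_e R + (g z *: sl2_f R + h z *: sl2_h R)) z.
Proof. by rewrite /cur_add /cur_fmul /gauge !mulmxDr !mulmxDl -!(scalemxAr, scalemxAl). Qed.

Lemma comb_rs f g h : ring f -> ring g -> ring h -> rs (comb f g h).
Proof.
rewrite !in_wp_ringP => hf hg hh; apply: rs_ext (fun z _ => esym (combE f g h z)) _.
apply: gauge_rs; apply: sinvD; first exact: sinvZ (sl2_e_in R).
by apply: sinvD; apply: sinvZ => //; [exact: sl2_f_in|exact: sl2_h_in].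
Qed.

Lemma rs_comb X : rs X -> exists f g h, ring f /\ ring g /\ ring h /\ eqT X (comb f g h).
Proof.
move=> /ungauge_sinv[h1 h2].
exists (fun z => ungauge X z 0 1), (fun z => ungauge X z 1 0), (fun z => ungauge X z 0 0).
have hm i j : ring (fun z => ungauge X z i j).
  by rewrite in_wp_ringP -(s_invariant_mero_ell N0 ht X0 V1 V2 W1 W2 Wt).
do 3!split=> //; move=> z hz; rewrite combE -(@ungaugeK X z); last by rewrite -S_lat.
rewrite {1}/gauge; move/sl2E: (h2 _ hz) => ->.
by [].
Qed.

(** Ungauging turns [E], [F], [H] into the constant standard basis, so the coefficients are read off
    as matrix entries at each point. *)
Lemma comb_inj f g h f' g' h' : eqT (comb f g h) (comb f' g' h') -> eqT f f' /\ eqT g g' /\ eqT h h'.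
Proof.
move=> e; have key z : ~ in_S w1 w2 t z -> [/\ f z = f' z, g z = g' z & h z = h' z].
  move=> hz; have hl : ~ in_lat z by rewrite -S_lat.
  have : ungauge (comb f g h) z = ungauge (comb f' g' h') z by rewrite /ungauge e.
  have uc a b c : ungauge (comb a b c) z = mx2 (c z) (a z) (b z) (- c z).
    have := gaugeK (fun z => a z *: sl2_e R + (b z *: sl2_f R + c z *: sl2_h R)) hl.
    rewrite /ungauge -combE => ->; rewrite !mx2Z !mx2D.
    by congr mx2; rewrite !(mulr0, mulr1, addr0, add0r, mulrN).
  rewrite !uc => /matrixP M.
  by have := M 0 1; have := M 1 0; have := M 0 0; rewrite !mxE.
by split; [|split] => z /key[].
Qed.

End Gauge.

Theorem theorem6p8 (R : realType) (w1 w2 : CC R) (N : nat) (t : CC R)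
    (r : 'M[CC R]_2 -> 'M[CC R]_2) :
  (0 < N)%N ->
  is_lattice w1 w2 ->
  translation_of_order w1 w2 N t ->
  aut_of_order N r ->
  (* (sl2 (x) O_TT)^{rho (x) sigma~} is isomorphic, as a complex Lie algebra,
     to sl2 (x) O_TT^{sigma~} *)
  (exists phi : (CC R -> 'M[CC R]_2) -> (CC R -> 'M[CC R]_2),
     (forall X, rs_invariant w1 w2 t N r X -> in_current_sinv w1 w2 t N (phi X)) /\
     (forall X Y, rs_invariant w1 w2 t N r X -> rs_invariant w1 w2 t N r Y ->
        eqTT w1 w2 t X Y -> eqTT w1 w2 t (phi X) (phi Y)) /\
     (forall (a : CC R) X Y, rs_invariant w1 w2 t N r X -> rs_invariant w1 w2 t N r Y ->
        eqTT w1 w2 t (phi (cur_add (cur_scale a X) Y)) (cur_add (cur_scale a (phi X)) (phi Y))) /\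
     (forall X Y, rs_invariant w1 w2 t N r X -> rs_invariant w1 w2 t N r Y ->
        eqTT w1 w2 t (phi (cur_br X Y)) (cur_br (phi X) (phi Y))) /\
     (forall X Y, rs_invariant w1 w2 t N r X -> rs_invariant w1 w2 t N r Y ->
        eqTT w1 w2 t (phi X) (phi Y) -> eqTT w1 w2 t X Y) /\
     (forall Z, in_current_sinv w1 w2 t N Z ->
        exists X, rs_invariant w1 w2 t N r X /\ eqTT w1 w2 t (phi X) Z)) /\
  (* the explicit description *)
  (exists v1 v2 : CC R, is_lattice v1 v2 /\
   exists E F H : CC R -> 'M[CC R]_2,
     rs_invariant w1 w2 t N r E /\ rs_invariant w1 w2 t N r F /\
     rs_invariant w1 w2 t N r H /\
     eqTT w1 w2 t (cur_br H E) (cur_scale 2 E) /\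
     eqTT w1 w2 t (cur_br H F) (cur_scale (-2) F) /\
     eqTT w1 w2 t (cur_br E F) H /\
     (forall f g h, in_wp_ring w1 w2 t v1 v2 f -> in_wp_ring w1 w2 t v1 v2 g ->
        in_wp_ring w1 w2 t v1 v2 h ->
        rs_invariant w1 w2 t N r (cur_add (cur_fmul f E) (cur_add (cur_fmul g F) (cur_fmul h H)))) /\
     (forall X, rs_invariant w1 w2 t N r X ->
        exists f g h, in_wp_ring w1 w2 t v1 v2 f /\ in_wp_ring w1 w2 t v1 v2 g /\
          in_wp_ring w1 w2 t v1 v2 h /\
          eqTT w1 w2 t X (cur_add (cur_fmul f E) (cur_add (cur_fmul g F) (cur_fmul h H)))) /\
     (forall f g h f' g' h',
        in_wp_ring w1 w2 t v1 v2 f -> in_wp_ring w1 w2 t v1 v2 g ->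
        in_wp_ring w1 w2 t v1 v2 h -> in_wp_ring w1 w2 t v1 v2 f' ->
        in_wp_ring w1 w2 t v1 v2 g' -> in_wp_ring w1 w2 t v1 v2 h' ->
        eqTT w1 w2 t (cur_add (cur_fmul f E) (cur_add (cur_fmul g F) (cur_fmul h H)))
                     (cur_add (cur_fmul f' E) (cur_add (cur_fmul g' F) (cur_fmul h' H))) ->
        eqTT w1 w2 t f f' /\ eqTT w1 w2 t g g' /\ eqTT w1 w2 t h h')).
Proof.
move=> N0 /lattice_cross w0 ht hr.
have [v1 [v2 [k1 [k2 [V1 V2 W1 W2 Wt]]]]] := superlattice_basis N0 ht.1.
have X0 := lattice_sub_cross W1 W2 w0.
have S_lat := in_S_lattice N0 ht V1 V2 W1 W2 Wt.
have [P [eps [uP epsN epsk rP]]] := aut_diag hr.1 N0 hr.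
have [p1 [p2 [x [y [u [v [[s1 s2 p10 p20] [hx hu hy hv det1]]]]]]]] :=
  gauge_frame N0 ht X0 V1 V2 W1 W2 Wt epsN epsk.
have g_rs := gauge_rs N0 ht X0 V1 V2 W1 W2 Wt uP epsN rP s1 s2 p10 p20 hx hu hy hv.
have br := gauge_br uP det1.
split.
  exists (ungauge P x y u v); split; last split; last split; last split; last split.
  - move=> X hX; refine (ungauge_sinv N0 ht X0 V1 V2 W1 W2 Wt hr uP epsN rP s1 s2 p10 p20 hx hu hy hv hX).
  - by move=> X Y _ _ e z hz; rewrite /ungauge e.
  - by move=> a X Y _ _ z _; apply: ungauge_lin.
  - by move=> X Y _ _ z; rewrite S_lat => hz; apply: (ungauge_br uP det1).
  - move=> X Y _ _ e z hz; have hl : ~ in_lattice v1 v2 z by rewrite -S_lat.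
    by rewrite -(ungaugeK uP det1 X hl) -(ungaugeK uP det1 Y hl) /gauge e.
  - move=> Z hZ; exists (gauge P x y u v Z); split; first exact: g_rs.
    by move=> z; rewrite S_lat => hz; apply: (gaugeK uP det1).
exists v1, v2; split; first exact/lattice_cross.
pose E := gauge P x y u v (fun=> sl2_e R); pose F := gauge P x y u v (fun=> sl2_f R).
pose H := gauge P x y u v (fun=> sl2_h R).
have cst M : in_sl2 M -> rs_invariant w1 w2 t N r (gauge P x y u v (fun=> M)).
  by move=> hM; apply/g_rs/(sinv_const N0 ht X0 V1 V2 W1 W2 Wt).
have scal a M z : a *: gauge P x y u v (fun=> M) z = gauge P x y u v (fun=> a *: M) z.
  by rewrite /gauge -scalemxAr -scalemxAl.
exists E, F, H; split; [exact: cst (sl2_e_in R)|split; [exact: cst (sl2_f_in R)|split; [exact: cst (sl2_h_in R)|]]].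
split; last split; last split; last split; last split.
- by move=> z; rewrite S_lat => hz; rewrite /cur_br /cur_scale -br // scal /cur_br /gauge lie_he.
- by move=> z; rewrite S_lat => hz; rewrite /cur_br /cur_scale -br // scal /cur_br /gauge lie_hf.
- by move=> z; rewrite S_lat => hz; rewrite /cur_br -br // /cur_br /H /gauge lie_ef.
- exact: (comb_rs N0 ht X0 V1 V2 W1 W2 Wt uP epsN rP s1 s2 p10 p20 hx hu hy hv).
- exact: (rs_comb N0 ht X0 V1 V2 W1 W2 Wt hr uP epsN rP s1 s2 p10 p20 hx hu hy hv det1).
- move=> f g h f' g' h' _ _ _ _ _ _.
  exact: (comb_inj N0 ht V1 V2 W1 W2 Wt uP det1).
Qed.
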